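(* Let $n\ge 2$ and let $M\subset \mathbb{C}^n$ be a real-analytic submanifold of real dimension $n$, totally real at a generic point, with a complex tangent at $0$, defined near $0$ by the equations $$z_n = \rho(z_1,\bar z_1, x'),\qquad y_\alpha = r_\alpha(z_1,\bar z_1, x'),\quad \alpha = 2,\dots, n-1,$$ where $z_j=x_j+iy_j$, $x'=(x_2,\dots,x_{n-1})$, the functions $\rho$ (complex-valued) and $r_\alpha$ (real-valued) are real-analytic and have no constant or linear terms, and $r_\alpha(0,\bar z_1,0)\equiv 0$ for all $\alpha$. Then the following are equivalent: (i) There are a totally real submanifold $N$ of dimension $n$ in $\mathbb{C}^n$ and a germ of a finite holomorphic map $F \colon (\mathbb{C}^n,0) \to (\mathbb{C}^n,0)$ such that $F|_N$ is a diffeomorphism onto $M = F(N)$ (as germs at $0$). (ii) $\rho(0,\bar{z}_1, 0) \not\equiv 0$. Furthermore, if (ii) holds, then $$\rho(0,\bar{z}_1, 0 ) = c\,\bar{z}_1^k + O(\bar{z}_1^{k+1}), \quad c\neq 0,$$ with $k=\mathrm{mult}_0(F)$, where $F$ is as in (i).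
   Context: Here $(z_1,\dots,z_n)$ are the coordinates in $\mathbb{C}^n$ (when $n=2$ the variable $x'$ and the functions $r_\alpha$ are absent). The variables $z_1$ and $\bar z_1$ are treated as independent in the convergent power series of $\rho$ and $r_\alpha$; thus $\rho(0,\bar z_1,0)$ is the series obtained by setting $z_1=0$ and $x'=0$ while keeping $\bar z_1$. A real submanifold $N\subset\mathbb{C}^n$ is totally real at $p$ if $T_pN\cap J(T_pN)=\{0\}$, where $J$ is the complex structure. A germ at $0$ of a holomorphic map $F=(F_1,\dots,F_n)$ with $F(0)=0$ is finite if $\mathrm{mult}_0(F):=\dim_{\mathbb{C}}\mathcal{O}_0/\mathcal{I}(F)<\infty$, where $\mathcal{O}_0$ is the ring of germs of holomorphic functions at $0$ and $\mathcal{I}(F)$ is the ideal generated by $F_1,\dots,F_n$; $\mathrm{mult}_0(F)$ is the multiplicity of $F$ at $0$. *)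

(* Defs.v *)
From HB Require Import structures.
From mathcomp Require Import all_boot all_order all_algebra.
From mathcomp Require Import complex.
From mathcomp Require Import all_classical all_reals all_analysis.

Set Implicit Arguments.
Unset Strict Implicit.
Unset Printing Implicit Defensive.

Import Order.TTheory GRing.Theory Num.Theory.
Import numFieldNormedType.Exports.

Local Open Scope classical_set_scope.
Local Open Scope ring_scope.

(* The topology of R[i] is that of its norm, as for any numFieldType; the
   library only registers it for R[i]^o. *)
HB.instance Definition _ (R : realType) := NormedModule.copy R[i] (R[i]^o).

(* Power series in n variables over K = R (real-analytic functions) or
   K = R[i] (holomorphic functions). *)
Section PowerSeries.
Variables (K : numFieldType) (n : nat).

Definition multiindex := {ffun 'I_n -> nat}.

Definition monomial (h : 'rV[K]_n) (al : multiindex) : K :=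
  \prod_i h 0 i ^+ al i.

(* Partial sum over the multi-indices all of whose entries are < N. *)
Definition box_sum (a : multiindex -> K) (h : 'rV[K]_n) (N : nat) : K :=
  \sum_(be : {ffun 'I_n -> 'I_N})
     let al : multiindex := [ffun i => val (be i)] in a al * monomial h al.

(* The series with coefficients a converges absolutely on a polydisc around p,
   with sum f; absolute convergence makes the choice of partial sums
   irrelevant. *)
Definition has_expansion (f : 'rV[K]_n -> K) (p : 'rV[K]_n)
    (a : multiindex -> K) : Prop :=
  exists2 r : K, 0 < r &
    (exists B : K, forall N,
       box_sum (fun al => `|a al|) (const_mx r) N <= B) /\
    (forall h : 'rV[K]_n, (forall i, `|h 0 i| < r) ->
       box_sum a h N @[N --> \oo] --> f (p + h)).

Definition analytic_at (f : 'rV[K]_n -> K) (p : 'rV[K]_n) : Prop :=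
  exists a, has_expansion f p a.

Definition analytic_no_affine_part (f : 'rV[K]_n -> K) : Prop :=
  exists2 a, has_expansion f 0 a &
    forall al : multiindex, (\sum_i al i <= 1)%N -> a al = 0.

End PowerSeries.

Section RealSubmanifolds.
Variable R : realType.

Inductive regularity := Smooth | Analytic.

(* Meant for open U. *)
Fixpoint Ck (k : nat) (V W : normedModType R) (U : set V) (f : V -> W) : Prop :=
  match k with
  | 0 => forall x, U x -> {for x, continuous f}
  | k'.+1 => (forall x, U x -> differentiable f x) /\
             (forall v, Ck k' U (fun x => 'D_v f x))
  end.

Definition regular_on (reg : regularity) (d e : nat) (U : set 'rV[R]_d)
    (f : 'rV[R]_d -> 'rV[R]_e) : Prop :=
  match reg with
  | Smooth => forall k, Ck k U f
  | Analytic => forall x, U x -> forall j, analytic_at (fun y => f y 0 j) x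
  end.

(* Around each of its points, S is straightened by a diffeomorphism Phi
   (with inverse Psi) onto the points whose coordinates of index >= d vanish. *)
Definition submanifold (reg : regularity) (d e : nat) (S : set 'rV[R]_e) :
    Prop :=
  forall p, S p ->
  exists (U V : set 'rV[R]_e) (Phi Psi : 'rV[R]_e -> 'rV[R]_e),
    [/\ open U, open V & U p] /\
    [/\ regular_on reg U Phi,
        regular_on reg V Psi,
        forall x, U x -> V (Phi x) /\ Psi (Phi x) = x,
        forall y, V y -> U (Psi y) /\ Phi (Psi y) = y &
        forall x, U x ->
          (S x <-> forall j : 'I_e, (d <= j)%N -> Phi x 0 j = 0)].

Definition realify (n : nat) (z : 'rV[R[i]]_n) : 'rV[R]_(n + n) :=
  row_mx (map_mx (@complex.Re R) z) (map_mx (@complex.Im R) z).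

Definition unrealify (n : nat) (v : 'rV[R]_(n + n)) : 'rV[R[i]]_n :=
  \row_j Complex (lsubmx v 0 j) (rsubmx v 0 j).

Definition real_submanifold (reg : regularity) (d n : nat)
    (S : set 'rV[R[i]]_n) : Prop :=
  submanifold reg d (@realify n @` S).

(* v is in T_p S: v is the velocity at p of a curve in S. *)
Definition tangent (n : nat) (S : set 'rV[R[i]]_n) (p v : 'rV[R[i]]_n) : Prop :=
  exists gamma : R -> 'rV[R[i]]_n,
    [/\ gamma 0 = p,
        \forall t \near (0 : R), S (gamma t) &
        is_derive (0 : R) (1 : R) (fun t => realify (gamma t)) (realify v)].

(* T_p S and J (T_p S) meet only in 0, J being multiplication by i. *)
Definition totally_real_at (n : nat) (S : set 'rV[R[i]]_n)
    (p : 'rV[R[i]]_n) : Prop :=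
  forall v w, tangent S p v -> tangent S p w -> v = 'i *: w -> v = 0.

Definition totally_real_submanifold (reg : regularity) (n : nat)
    (N : set 'rV[R[i]]_n) : Prop :=
  real_submanifold reg n N /\ forall p, N p -> totally_real_at N p.

End RealSubmanifolds.

Section HolomorphicGerms.
Variables (R : realType) (n : nat).
Local Notation C := R[i].
Local Notation Cn := 'rV[R[i]]_n.

(* Germs at 0 are represented by functions Cn -> C (or Cn -> Cn), of which only
   the restriction to small neighbourhoods of 0 matters. *)

Definition in_germ_ideal (F : Cn -> Cn) (g : Cn -> C) : Prop :=
  exists2 h : 'I_n -> Cn -> C, (forall j, analytic_at (h j) 0) &
    \forall z \near (0 : Cn), g z = \sum_j h j z * F z 0 j.

(* mult_0(F) = k: some b_1, ..., b_k in O_0 induce a basis of the complex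
   vector space O_0 / I(F). *)
Definition multiplicity (F : Cn -> Cn) (k : nat) : Prop :=
  exists2 b : 'I_k -> Cn -> C, (forall i, analytic_at (b i) 0) &
    forall g : Cn -> C, analytic_at g 0 ->
      exists! c : 'rV[C]_k,
        in_germ_ideal F (fun z => g z - \sum_i c 0 i * b i z).

Definition finite_holomorphic_germ (F : Cn -> Cn) : Prop :=
  [/\ forall j, analytic_at (fun z => F z 0 j) 0,
      F 0 = 0 &
      exists k, multiplicity F k].

(* F restricted to N is a diffeomorphism onto M, as germs at 0.  Since M is a
   submanifold, its inverse is regular iff it extends to a regular map G of a
   neighbourhood; F itself is holomorphic near 0. *)
Definition germ_diffeo (reg : regularity) (F : Cn -> Cn) (N M : set Cn) : Prop :=
  exists (U V : set Cn) (G : Cn -> Cn),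
    [/\ open U, open V, U 0 & V 0] /\
    [/\ regular_on reg (@realify R n @` V)
          (fun v => realify (G (unrealify v))),
        forall z, N z -> U z -> [/\ M (F z), V (F z) & G (F z) = z] &
        forall w, M w -> V w -> [/\ N (G w), U (G w) & F (G w) = w]].

Definition finite_image_of (reg : regularity) (M N : set Cn) (F : Cn -> Cn) :
    Prop :=
  [/\ totally_real_submanifold reg N,
      N 0,
      finite_holomorphic_germ F &
      germ_diffeo reg F N M].

End HolomorphicGerms.

(* Coordinates on C^(m + 2): z_1, (z_2, ..., z_(m+1)) and z_(m+2). *)
Section Coordinates.
Variables (R : realType) (m : nat).

Definition mid (al : 'I_m) : 'I_m.+2 := lift ord0 (widen_ord (leqnSn m) al).

Definition xprime (z : 'rV[R[i]]_m.+2) : 'rV[R[i]]_m :=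
  \row_al (complex.Re (z 0 (mid al)))%:C%C.

(* A real-analytic germ f(z_1, zbar_1, x') is given by the sum of its power
   series with z_1, zbar_1 and x' replaced by independent complex variables
   (z, w, x): joint f is holomorphic near 0, and restr f is the real-analytic
   function itself. *)
Definition joint (f : R[i] -> R[i] -> 'rV[R[i]]_m -> R[i])
    (v : 'rV[R[i]]_(1 + (1 + m))) : R[i] :=
  f (lsubmx v 0 0) (lsubmx (rsubmx v) 0 0) (rsubmx (rsubmx v)).

Definition restr (f : R[i] -> R[i] -> 'rV[R[i]]_m -> R[i])
    (z : 'rV[R[i]]_m.+2) : R[i] :=
  f (z 0 0) (z 0 0)^* (xprime z).

End Coordinates.

(* Main.v *)
Require Import Defs.
From mathcomp Require Import all_boot all_order all_algebra.
From mathcomp Require Import perm complex ring.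
From mathcomp Require Import all_classical all_reals all_analysis.

(** Replacing the conjugate of [z_1] by an independent variable [w] turns the
    equations of [M] into a holomorphic map of the coordinates [(z, w, x)],

      F0 (z, w, x) = (z, x + i r(z, w, x), rho(z, w, x)),

    called [model] below.  It maps the flat totally real subspace
    [w = conj z, Im x = 0] onto [M] near [0], and the inverse is the restriction
    of the real-linear map [z |-> (z_1, conj z_1, Re z')].  Everything is thus
    about the ideal of [F0].  As [r(0, w, 0) = 0] and neither [r] nor [rho] has
    affine terms, this ideal is generated by [z], [x] and [w ^ e] if
    [rho(0, w, 0)] has finite order [e]: one can write [F0 = B Y] with [Y] the
    vector of these generators and [B 0] invertible.  Hence [F0] is finite of
    multiplicity [e] ([multiplicity_axis]), and it realises [M] as a finite
    image as soon as [rho(0, w, 0)] is not identically zero ([sufficiency]).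

    Conversely let [F] be a finite map of multiplicity [k], diffeomorphic from a
    totally real [N] onto [M].  Composing the linear parametrisation [G] of the
    flat subspace with [F0] and with the inverse of [F] on [N] gives a
    parametrisation [H] of [N] with [F (H t) = F0 (G t)] for small real [t].  Since [N] may be only smooth, [H]
    has no expansion in general, but it has a jet of every finite order
    ([regular_jet]).  Its linear part is invertible over the complex numbers
    because [N] is totally real and [F0 o G] is an immersion.  Along such an [H],
    holomorphic germs and jets on the real space determine each other:
    every jet is that of a holomorphic germ ([jet_liftable]), and a germ that is
    flat along [H] has no terms of low order ([flat_pullback_coef]).  So germs
    along [H] correspond to germs along [G], up to any chosen order, and the
    quotients of the ring of germs by the ideals of [F] and of [F0] can be
    compared.

    A finite order suffices.  Modulo the ideal of [F] the powers
    [1, z_i, ..., z_i ^ k] are linearly dependent, hence [z_i ^ k] lies in the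
    ideal ([coordinate_power_ideal]), and with it every germ of order [n k]
    ([high_order_ideal]).  If [rho(0, w, 0)] vanished beyond order [k], the
    dependence of [1, w, ..., w ^ k] transported from [H] to [G] and restricted
    to the axis of [w] would be contradictory ([axis_order_le]).  So [e] is
    finite with [e <= k], and then the transported powers [1, w, ..., w ^ (e - 1)]
    generate the quotient by the ideal of [F], whence [k <= e]
    ([axis_order_ge]).  The expansion claimed for [rho(0, conj z, 0)] is
    then that of [rho(0, w, 0)], with the remainder of [axis_remainder].

    Power series are handled through their coefficient functions together with
    explicit bounds ([dominated], [expands]); the ring of germs, its units and
    the division by powers of the coordinates are built from these. *)

Set Implicit Arguments.
Unset Strict Implicit.
Unset Printing Implicit Defensive.

Import Order.TTheory GRing.Theory Num.Theory.
Import numFieldNormedType.Exports.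

Local Open Scope classical_set_scope.
Local Open Scope ring_scope.

(** * Multi-indices and dominated power series *)

Section MultiIndex.
Variable n : nat.
Implicit Types (al be ga : multiindex n).

Definition deg al : nat := (\sum_i al i)%N.

Definition addm al be : multiindex n := [ffun i => al i + be i]%N.

Definition subm al be : multiindex n := [ffun i => al i - be i]%N.

Definition mle al be : bool := [forall i, al i <= be i]%N.

Definition zerom : multiindex n := [ffun => 0%N].

Definition powm (i : 'I_n) (k : nat) : multiindex n :=
  [ffun j => if j == i then k else 0%N].

Definition box (N : nat) : seq (multiindex n) :=
  [seq [ffun i => val (u i)] | u : {ffun 'I_n -> 'I_N} <- enum {ffun 'I_n -> 'I_N}].

Lemma box_uniq N : uniq (box N).
Proof.
rewrite map_inj_uniq ?enum_uniq // => u v /ffunP e.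
by apply/ffunP => i; have := e i; rewrite !ffunE => /val_inj.
Qed.

Lemma mem_box N al : (al \in box N) = [forall i, al i < N]%N.
Proof.
apply/mapP/forallP => [[be _ ->] i|lt_al]; first by rewrite ffunE ltn_ord.
exists [ffun i => Ordinal (lt_al i)]; first by rewrite mem_enum.
by apply/ffunP => i; rewrite !ffunE.
Qed.

Lemma deg_ge al i : (al i <= deg al)%N.
Proof. by rewrite /deg (bigD1 i) //= leq_addr. Qed.

Lemma mem_box_deg al N : (deg al < N)%N -> al \in box N.
Proof.
move=> lt; rewrite mem_box; apply/forallP => i.
exact: leq_ltn_trans (deg_ge al i) lt.
Qed.

Lemma box_sub N N' : (N <= N')%N -> {subset box N <= box N'}.
Proof.
move=> le al; rewrite !mem_box => /forallP H; apply/forallP => i.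
exact: leq_trans (H i) le.
Qed.

Lemma sub_box (s : seq (multiindex n)) : exists N, {subset s <= box N}.
Proof.
exists (\max_(al <- s) deg al).+1 => al als.
by apply: mem_box_deg; rewrite ltnS; apply: (leq_bigmax_seq (F := deg)).
Qed.

Lemma deg_notin_box N al : al \notin box N -> (N <= deg al)%N.
Proof. by apply: contraR; rewrite -ltnNge => /mem_box_deg. Qed.

Lemma degD al be : deg (addm al be) = (deg al + deg be)%N.
Proof.
by rewrite /deg -big_split /=; apply: eq_bigr => i _; rewrite ffunE.
Qed.

Lemma addmK al be : subm (addm al be) al = be.
Proof. by apply/ffunP => i; rewrite !ffunE addKn. Qed.

Lemma submKC al be : mle al be -> addm al (subm be al) = be.
Proof. by move=> /forallP le; apply/ffunP => i; rewrite !ffunE subnKC. Qed.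

Lemma mle_addm al be : mle al (addm al be).
Proof. by apply/forallP => i; rewrite ffunE leq_addr. Qed.

Lemma addm_eq al be ga : (addm al be == ga) = mle al ga && (be == subm ga al).
Proof.
apply/eqP/andP => [<-|[le /eqP ->]]; last exact: submKC.
by rewrite mle_addm addmK.
Qed.

Lemma deg_powm i k : deg (powm i k) = k.
Proof.
rewrite /deg (bigD1 i) //= ffunE eqxx big1 ?addn0 // => j /negbTE ji.
by rewrite ffunE ji.
Qed.

Lemma deg_zerom : deg zerom = 0%N.
Proof. by rewrite /deg big1 // => i _; rewrite ffunE. Qed.

Lemma deg_eq0 al : (deg al == 0%N) = (al == zerom).
Proof.
apply/idP/eqP => [|->]; last by rewrite deg_zerom.
rewrite /deg sum_nat_eq0 => /forallP H; apply/ffunP => i.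
by rewrite ffunE; apply/eqP; exact: (implyP (H i)).
Qed.

End MultiIndex.

Section Series.
Variables (K : numFieldType) (n : nat).
Implicit Types (al be ga : multiindex n) (a b : multiindex n -> K).
Implicit Types (h p : 'rV[K]_n) (f g : 'rV[K]_n -> K) (r B q : K).

Lemma box_sumE a h N :
  box_sum a h N = \sum_(al <- box n N) a al * monomial h al.
Proof. by rewrite /box_sum /box big_map big_enum. Qed.

Lemma monomialD h al be :
  monomial h (addm al be) = monomial h al * monomial h be.
Proof.
by rewrite /monomial -big_split; apply: eq_bigr => i _; rewrite ffunE exprD.
Qed.

Lemma monomial_powm h i k : monomial h (powm i k) = h 0 i ^+ k.
Proof.
rewrite /monomial (bigD1 i) //= ffunE eqxx big1 ?mulr1 // => j /negbTE ji.
by rewrite ffunE ji expr0.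
Qed.

Lemma monomial_zerom h : monomial h (zerom n) = 1.
Proof. by rewrite /monomial big1 // => i _; rewrite ffunE expr0. Qed.

Lemma monomial_const r al : monomial (const_mx r) al = r ^+ deg al.
Proof.
rewrite /monomial /deg -prodrXr; apply: eq_bigr => i _; by rewrite mxE.
Qed.

Lemma monomial_le h al (c : K) : (forall i, `|h 0 i| <= c) ->
  `|monomial h al| <= c ^+ deg al.
Proof.
move=> hc; rewrite /monomial normr_prod /deg -prodrXr.
by apply: ler_prod => i _; rewrite normr_ge0 normrX lerXn2r // ?nnegrE // (le_trans _ (hc i)).
Qed.

Lemma sum_sub_le (T : eqType) (s t : seq T) (F : T -> K) :
  uniq s -> uniq t -> {subset s <= t} -> (forall x, 0 <= F x) ->
  \sum_(x <- s) F x <= \sum_(x <- t) F x.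
Proof.
move=> us ut st F0.
have ps : perm_eq s [seq x <- t | x \in s].
  apply: uniq_perm; rewrite ?filter_uniq // => x; rewrite mem_filter.
  by case xs: (x \in s) => //=; rewrite st.
rewrite (perm_big _ ps) big_filter [leRHS](bigID (mem s)) /=.
by rewrite lerDl sumr_ge0.
Qed.

(** Absolute summability with sum at most [B] on the polydisc of radius [r],
    tested on arbitrary finite families, so that no order of summation is fixed. *)
Definition dominated r B a : Prop :=
  forall s : seq (multiindex n), uniq s ->
  \sum_(al <- s) `|a al| * r ^+ deg al <= B.

Lemma dominatedP r B a : 0 <= r ->
  (forall N, box_sum (fun al => `|a al|) (const_mx r) N <= B) <->
  dominated r B a.
Proof.
move=> r0; split => [H s us|H N].
  have [N sN] := sub_box s; apply: le_trans (H N).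
  rewrite box_sumE [leRHS](eq_bigr (fun al => `|a al| * r ^+ deg al)).
    2: by move=> al _; rewrite monomial_const.
  apply: sum_sub_le => //; first exact: box_uniq.
  by move=> al; rewrite mulr_ge0 // exprn_ge0.
rewrite box_sumE (eq_bigr (fun al => `|a al| * r ^+ deg al)); last first.
  by move=> al _; rewrite monomial_const.
exact/H/box_uniq.
Qed.

Lemma dominated_ge0 r B a : dominated r B a -> 0 <= B.
Proof. by move=> /(_ [::] isT); rewrite big_nil. Qed.

Lemma dominated_le r r' B B' a : 0 <= r' -> r' <= r -> B <= B' ->
  dominated r B a -> dominated r' B' a.
Proof.
move=> r0 rr BB H s us; apply: le_trans BB; apply: le_trans (H s us).
apply: ler_sum => al _; rewrite ler_wpM2l // lerXn2r // nnegrE //.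
exact: le_trans rr.
Qed.

Lemma tail_le r B a q h d (s : seq (multiindex n)) : 0 <= r ->
  dominated r B a -> 0 <= q <= 1 -> (forall i, `|h 0 i| <= q * r) ->
  uniq s -> (forall al, al \in s -> d <= deg al)%N ->
  \sum_(al <- s) `|a al * monomial h al| <= B * q ^+ d.
Proof.
move=> r0 dom /andP[q0 q1] hq us sd.
apply: (@le_trans _ _ (\sum_(al <- s) (`|a al| * r ^+ deg al) * q ^+ d)).
  rewrite big_seq [leRHS]big_seq; apply: ler_sum => al als.
  rewrite normrM -mulrA ler_wpM2l //.
  apply: le_trans (monomial_le al hq) _.
  rewrite exprMn mulrC ler_wpM2l ?exprn_ge0 //.
  exact: ler_wiXn2l (sd _ als).
by rewrite -mulr_suml ler_wpM2r ?exprn_ge0 // dom.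
Qed.

(** The expansion with a rate of convergence.  The bound [B q ^ N] on the
    polydisc of radius [q r] comes from the terms outside the box, all of degree at
    least [N].  Bounds of this kind combine under sums and products with the radius
    unchanged, and [N = D] gives the Taylor remainder of order [D]. *)
Definition expands p f a r B : Prop :=
  dominated r B a /\
  forall q h N, 0 <= q -> q < 1 -> (forall i, `|h 0 i| <= q * r) ->
    `|f (p + h) - box_sum a h N| <= B * q ^+ N.

Lemma expands_le p f a r r' B B' : 0 < r' -> r' <= r -> B <= B' ->
  expands p f a r B -> expands p f a r' B'.
Proof.
move=> r0 rr BB [dom H]; split; first by apply: dominated_le dom => //; exact: ltW.
move=> q h N q0 q1 hq; apply: (@le_trans _ _ (B * q ^+ N)); last first.
  by rewrite ler_wpM2r ?exprn_ge0.
apply: H => // i; apply: le_trans (hq i) _; exact: ler_wpM2l.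
Qed.

Lemma box_sum_le r B a q h N : 0 <= r ->
  dominated r B a -> 0 <= q <= 1 -> (forall i, `|h 0 i| <= q * r) ->
  `|box_sum a h N| <= B.
Proof.
move=> r0 dom q01 hq; rewrite box_sumE.
apply: le_trans (ler_norm_sum _ _ _) _.
rewrite -[B]mulr1 -(expr0 q); apply: (tail_le (r := r)) => //; exact: box_uniq.
Qed.

Lemma box_sum_tail r B a q h N N' : 0 <= r ->
  dominated r B a -> 0 <= q <= 1 -> (forall i, `|h 0 i| <= q * r) ->
  (N <= N')%N -> `|box_sum a h N' - box_sum a h N| <= B * q ^+ N.
Proof.
move=> r0 dom q01 hq le; rewrite !box_sumE.
have pN : perm_eq (box n N) [seq x <- box n N' | x \in box n N].
  apply: uniq_perm; rewrite ?filter_uniq ?box_uniq // => x.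
  by rewrite mem_filter; case xs: (x \in _) => //=; rewrite (box_sub le).
rewrite (perm_big _ pN) big_filter /= [X in X - _](bigID [in box n N]) /=.
rewrite addrAC subrr add0r.
rewrite -big_filter; apply: le_trans (ler_norm_sum _ _ _) _.
apply: (tail_le (r := r)) => //; rewrite ?filter_uniq ?box_uniq // => al.
by rewrite mem_filter => /andP[/deg_notin_box].
Qed.

Lemma cvg_dist_le (u : nat -> K) (l x c : K) N :
  u N @[N --> \oo] --> l -> (forall M, (N <= M)%N -> `|u M - x| <= c) ->
  `|l - x| <= c.
Proof.
move=> /cvgrPdist_lt ul H; apply/ler_addgt0Pr => e e0.
have [M _ HM] := ul e e0.
have := HM (maxn M N) (leq_maxl _ _); have := H (maxn M N) (leq_maxr _ _).
set v := u _ => vx lv.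
rewrite -(subrK v l) -addrA addrC; apply: le_trans (ler_normD _ _) _.
by apply: lerD => //; exact: ltW.
Qed.

Lemma has_expansion_expands f p a : has_expansion f p a ->
  exists r, exists2 B, 0 < r & expands p f a r B.
Proof.
move=> [r r0 [[B HB] H]]; exists r, B => //.
have dom : dominated r B a by apply/dominatedP => //; exact: ltW.
split=> // q h N q0 q1 hq.
apply: (@cvg_dist_le (box_sum a h) _ _ _ N).
  apply: H => i; apply: le_lt_trans (hq i) _; by rewrite gtr_pMl.
by move=> M NM; apply: (box_sum_tail (r := r)) => //; rewrite ?q0 ?ltW.
Qed.

(* This fails over a non-archimedean field of scalars. *)
Hypothesis geometric_null : forall q, 0 <= q < 1 ->
  q ^+ N @[N --> \oo] --> (0 : K).

Lemma expands_has_expansion f p a r B : 0 < r -> expands p f a r B ->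
  has_expansion f p a.
Proof.
move=> r0 [dom H]; exists (r / 2); first by rewrite divr_gt0.
have r20 : 0 <= r / 2 by rewrite divr_ge0 // ltW.
split.
  exists B; apply/dominatedP => //; apply: dominated_le dom => //.
  by rewrite ler_pdivrMr // ler_peMr ?(ltW r0) // ler1n.
move=> h hr; apply/cvgrPdist_le => e e0.
have B0 := dominated_ge0 dom.
have half : 0 <= (2^-1 : K) < 1.
  by rewrite invr_ge0 ler0n invf_lt1 ?ltr0n // ltr1n.
have e1 : 0 < e / (B + 1) by rewrite divr_gt0 // ltr_wpDl.
have [N _ HN] := (cvgrPdist_le _ _).1 (geometric_null half) _ e1.
exists N => // M NM /=.
apply: (le_trans (H 2^-1 h M _ _ _)).
- by case/andP: half.
- by case/andP: half.
- by move=> i; rewrite mulrC ltW.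
have := HN M NM; rewrite /= sub0r normrN ger0_norm; last first.
  by rewrite exprn_ge0 //; case/andP: half.
rewrite ler_pdivlMr ?ltr_wpDl // mulrC; apply: le_trans.
by rewrite ler_wpM2r ?lerDl // exprn_ge0 //; case/andP: half.
Qed.

End Series.

(** * Products of power series *)

Section Algebra.
Variables (K : numFieldType) (n : nat).
Implicit Types (al be ga : multiindex n) (a b : multiindex n -> K).
Implicit Types (h p : 'rV[K]_n) (f g : 'rV[K]_n -> K) (r A B q c : K).

Lemma sum_supp1 (T : eqType) (s : seq T) (F : T -> K) x0 : uniq s ->
  (forall x, x != x0 -> F x = 0) ->
  \sum_(x <- s) F x = if x0 \in s then F x0 else 0.
Proof.
move=> us F0; case: ifP => [x0s|x0s].
  by rewrite (bigD1_seq x0) //= big1 ?addr0 // => x; exact: F0.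
rewrite big_seq big1 // => x xs; apply: F0; apply: contraFN x0s => /eqP <-.
exact: xs.
Qed.

Definition mono_coef ga c al : K := if al == ga then c else 0.

Lemma dominated_mono ga c r : 0 <= r ->
  dominated r (`|c| * r ^+ deg ga) (mono_coef ga c).
Proof.
move=> r0 s us; rewrite (sum_supp1 (x0 := ga)) //; last first.
  by move=> al /negbTE e; rewrite /mono_coef e normr0 mul0r.
by rewrite /mono_coef eqxx; case: ifP => // _; rewrite mulr_ge0 ?exprn_ge0.
Qed.

Lemma box_sum_mono ga c h N :
  box_sum (mono_coef ga c) h N =
  if ga \in box n N then c * monomial h ga else 0.
Proof.
rewrite box_sumE (sum_supp1 (x0 := ga)) ?box_uniq //; last first.
  by move=> al /negbTE e; rewrite /mono_coef e mul0r.
by rewrite /mono_coef eqxx.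
Qed.

Lemma expands_mono p f ga c r : 0 <= r ->
  (forall h, f (p + h) = c * monomial h ga) ->
  expands p f (mono_coef ga c) r (`|c| * r ^+ deg ga).
Proof.
move=> r0 fE; split; first exact: dominated_mono.
move=> q h N q0 q1 hq; rewrite box_sum_mono fE.
case: ifPn => [_|/deg_notin_box le].
  by rewrite subrr normr0 !mulr_ge0 // exprn_ge0.
rewrite subr0 normrM -mulrA ler_wpM2l //.
apply: le_trans (monomial_le _ hq) _; rewrite exprMn mulrC.
by rewrite ler_wpM2l ?exprn_ge0 // ler_wiXn2l // ltW.
Qed.

Lemma box_sumD a b h N :
  box_sum (fun al => a al + b al) h N = box_sum a h N + box_sum b h N.
Proof.
by rewrite !box_sumE -big_split; apply: eq_bigr => al _; rewrite mulrDl.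
Qed.

Lemma dominatedD r A B a b : 0 <= r -> dominated r A a -> dominated r B b ->
  dominated r (A + B) (fun al => a al + b al).
Proof.
move=> r0 Ha Hb s us; apply: le_trans (lerD (Ha s us) (Hb s us)).
rewrite -big_split; apply: ler_sum => al _ /=; rewrite -mulrDl.
by rewrite ler_wpM2r ?exprn_ge0 ?ler_normD.
Qed.

Lemma expandsD p f g a b r A B : 0 <= r -> expands p f a r A ->
  expands p g b r B ->
  expands p (fun x => f x + g x) (fun al => a al + b al) r (A + B).
Proof.
move=> r0 [da Ha] [db Hb]; split; first exact: dominatedD.
move=> q h N q0 q1 hq; rewrite box_sumD opprD addrACA mulrDl.
by apply: le_trans (ler_normD _ _) _; apply: lerD; [exact: Ha|exact: Hb].
Qed.

Definition lower al : seq (multiindex n) :=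
  [seq be <- box n (deg al).+1 | mle be al].

Lemma lower_uniq al : uniq (lower al).
Proof. by rewrite filter_uniq ?box_uniq. Qed.

Lemma mle_box be al N : mle be al -> al \in box n N -> be \in box n N.
Proof.
rewrite !mem_box => /forallP le /forallP lt; apply/forallP => i.
exact: leq_ltn_trans (le i) (lt i).
Qed.

Lemma mem_lower al be : (be \in lower al) = mle be al.
Proof.
rewrite mem_filter; case le: (mle be al) => //=.
by apply: mle_box le _; exact: mem_box_deg.
Qed.

Definition cprod a b al : K := \sum_(be <- lower al) a be * b (subm al be).

Lemma subm_mle al be : mle (subm al be) al.
Proof. by apply/forallP => i; rewrite ffunE leq_subr. Qed.

Lemma cprod_pairs a b al N : al \in box n N ->
  cprod a b al =
  \sum_(be <- box n N) \sum_(ga <- box n N | addm be ga == al) a be * b ga.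
Proof.
move=> alN.
have pl : perm_eq (lower al) [seq be <- box n N | mle be al].
  apply: uniq_perm; rewrite ?lower_uniq ?filter_uniq ?box_uniq // => be.
  rewrite mem_lower mem_filter; case le: (mle be al) => //=.
  by rewrite (mle_box le).
rewrite /cprod (perm_big _ pl) big_filter big_mkcond /=.
apply: eq_bigr => be _; under eq_bigl do rewrite addm_eq.
case: ifP => le /=; last by rewrite big_pred0.
rewrite big_mkcond (sum_supp1 (x0 := subm al be)) ?box_uniq //; last first.
  by move=> ga /negbTE ->.
by rewrite eqxx (mle_box (subm_mle _ _) alN).
Qed.

Lemma sum_cprod a b (G : multiindex n -> K) N :
  \sum_(al <- box n N) cprod a b al * G al =
  \sum_(be <- box n N) \sum_(ga <- box n N | addm be ga \in box n N)
     a be * b ga * G (addm be ga).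
Proof.
transitivity (\sum_(al <- box n N) \sum_(be <- box n N) \sum_(ga <- box n N)
   (if addm be ga == al then a be * b ga * G al else 0)).
  rewrite big_seq [RHS]big_seq; apply: eq_bigr => al alN.
  rewrite (cprod_pairs _ _ alN) mulr_suml; apply: eq_bigr => be _.
  rewrite big_mkcond mulr_suml /=; apply: eq_bigr => ga _.
  by case: ifP => // _; rewrite mul0r.
rewrite exchange_big; apply: eq_bigr => be _ /=.
rewrite exchange_big [RHS]big_mkcond; apply: eq_bigr => ga _ /=.
rewrite (sum_supp1 (x0 := addm be ga)) ?box_uniq ?eqxx // => al.
by rewrite eq_sym => /negbTE ->.
Qed.

Lemma dominated_cprod r A B a b : 0 <= r -> dominated r A a ->
  dominated r B b -> dominated r (A * B) (cprod a b).
Proof.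
move=> r0 da db; apply/dominatedP => // N.
rewrite box_sumE; under eq_bigr do rewrite monomial_const.
have db' := db _ (box_uniq n N); have da' := da _ (box_uniq n N).
apply: le_trans (ler_pM _ _ da' db'); first last.
- by apply: sumr_ge0 => *; rewrite mulr_ge0 ?exprn_ge0.
- by apply: sumr_ge0 => *; rewrite mulr_ge0 ?exprn_ge0.
apply: (@le_trans _ _ (\sum_(al <- box n N)
   cprod (fun al => `|a al|) (fun al => `|b al|) al * r ^+ deg al)).
  apply: ler_sum => al _; rewrite ler_wpM2r ?exprn_ge0 //.
  apply: le_trans (ler_norm_sum _ _ _) _; apply: ler_sum => be _.
  by rewrite normrM.
rewrite sum_cprod mulr_suml; apply: ler_sum => be _; rewrite mulr_sumr.
rewrite big_mkcond; apply: ler_sum => ga _; case: ifP => _.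
  by rewrite degD exprD mulrACA.
by rewrite !mulr_ge0 ?exprn_ge0.
Qed.

(** The two sides differ by the pairs of indices in the box whose sum leaves
    it; such a sum has degree at least [N]. *)
Lemma cprod_box_sum r A B a b q h N : 0 <= r -> dominated r A a ->
  dominated r B b -> 0 <= q <= 1 -> (forall i, `|h 0 i| <= q * r) ->
  `|box_sum a h N * box_sum b h N - box_sum (cprod a b) h N|
     <= A * B * q ^+ N.
Proof.
move=> r0 da db /andP[q0 q1] hq; rewrite !box_sumE sum_cprod mulr_suml -sumrB.
have db' := db _ (box_uniq n N); have da' := da _ (box_uniq n N).
apply: (@le_trans _ _ ((\sum_(al <- box n N) `|a al| * r ^+ deg al) *
   (\sum_(al <- box n N) `|b al| * r ^+ deg al) * q ^+ N)); last first.
  rewrite ler_wpM2r ?exprn_ge0 // ler_pM //;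
  by apply: sumr_ge0 => *; rewrite mulr_ge0 ?exprn_ge0.
apply: le_trans (ler_norm_sum _ _ _) _.
rewrite 2!mulr_suml; apply: ler_sum => be _.
rewrite mulr_sumr [X in _ - X]big_mkcond -sumrB mulr_sumr mulr_suml.
apply: le_trans (ler_norm_sum _ _ _) _; apply: ler_sum => ga _.
case: ifPn => [_|/deg_notin_box le].
  by rewrite monomialD mulrACA subrr normr0 !mulr_ge0 ?exprn_ge0.
rewrite subr0 mulrACA [leRHS](_ : _ =
  `|a be| * `|b ga| * (r ^+ deg be * r ^+ deg ga * q ^+ N)); last first.
  by rewrite mulrACA !mulrA.
rewrite normrM normrM ler_wpM2l ?mulr_ge0 // -monomialD -exprD -degD.
apply: le_trans (monomial_le _ hq) _; rewrite exprMn mulrC.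
by rewrite ler_wpM2l ?exprn_ge0 // ler_wiXn2l.
Qed.

Lemma expands_val_le p f a r A q h : 0 <= r -> expands p f a r A ->
  0 <= q -> q < 1 -> (forall i, `|h 0 i| <= q * r) -> `|f (p + h)| <= A + A.
Proof.
move=> r0 [da Ha] q0 q1 hq.
rewrite -(subrK (box_sum a h 0) (f (p + h))).
apply: le_trans (ler_normD _ _) _; apply: lerD.
  by rewrite -[A]mulr1 -(expr0 q); exact: Ha.
by apply: (box_sum_le _ r0 da) hq; rewrite q0 ltW.
Qed.

Lemma expandsM p f g a b r A B : 0 <= r -> expands p f a r A ->
  expands p g b r B ->
  expands p (fun x => f x * g x) (cprod a b) r (A * B *+ 4).
Proof.
move=> r0 aA bB; have [da Ha] := aA; have [db Hb] := bB.
have A0 := dominated_ge0 da; have B0 := dominated_ge0 db.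
split.
  apply: dominated_le (dominated_cprod r0 da db) => //.
  by rewrite mulrS lerDl mulrn_wge0 // mulr_ge0.
move=> q h N q0 q1 hq.
have q01 : 0 <= q <= 1 by rewrite q0 ltW.
set F := f _; set G := g _; set U := box_sum a h N; set V := box_sum b h N.
rewrite (_ : F * G - _ = (F - U) * G + U * (G - V) +
  (U * V - box_sum (cprod a b) h N)); last first.
  by rewrite mulrBl mulrBr !addrA !subrK.
apply: le_trans (ler_normD _ _) _; rewrite mulrS [leRHS]mulrDl [leRHS]addrC; apply: lerD; last exact: (cprod_box_sum N r0 da db q01 hq).
apply: le_trans (ler_normD _ _) _; rewrite mulrS [leRHS]mulrDl [leRHS]addrC.
apply: lerD.
  rewrite normrM mulr2n -mulrDr mulrAC ler_pM //; first exact: Ha.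
  exact: expands_val_le bB q0 q1 hq.
rewrite normrM -mulrA ler_pM //; last exact: Hb.
exact: (box_sum_le _ r0 da q01 hq).
Qed.

End Algebra.

(** * Limits in the complex numbers *)

Section ComplexLimits.
Variable R : realType.
Local Notation C := R[i].

Lemma ge0_complexE (x : C) : 0 <= x -> x = (complex.Re x)%:C%C.
Proof. by move=> x0; rewrite RRe_real // ger0_real. Qed.

Lemma real_geometric_null (q : R) : 0 <= q < 1 ->
  q ^+ N @[N --> \oo] --> (0 : R).
Proof. by move=> /andP[q0 q1]; apply: cvg_expr; rewrite ger0_norm. Qed.

Lemma complex_geometric_null (q : C) : 0 <= q < 1 ->
  q ^+ N @[N --> \oo] --> (0 : C).
Proof.
move=> /andP[q0 q1]; apply/cvgrPdist_le => e e0.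
have eE := ge0_complexE (ltW e0); have qE := ge0_complexE q0.
have q01 : 0 <= complex.Re q < 1 by rewrite -lecR -ltcR -qE q0.
have e0' : 0 < complex.Re e by rewrite -ltcR -eE.
have [N _ HN] := (cvgrPdist_le _ _).1 (real_geometric_null q01) _ e0'.
exists N => // M /HN /=; rewrite !sub0r !normrN !normrX (ger0_norm q0).
rewrite ger0_norm; last by case/andP: q01.
by move=> H; rewrite qE eE -rmorphXn lecR.
Qed.

Lemma normc_ge_Im (x : C) : `|complex.Im x|%:C%C <= `|x|.
Proof.
have := normc_ge_Re (x * 'i%C); rewrite ReiNIm normrN normrM.
by rewrite (_ : `|'i%C| = 1) ?mulr1 // normc_def /= expr0n add0r expr1n sqrtr1.
Qed.

Lemma normc_le_ReIm (x : C) :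
  `|x| <= (`|complex.Re x| + `|complex.Im x|)%:C%C.
Proof.
rewrite [x in `|x|]complexE rmorphD; apply: le_trans (ler_normD _ _) _.
have nE (y : R) : `|y%:C%C| = `|y|%:C%C :> C.
  by rewrite normc_def /= expr0n addr0 sqrtr_sqr.
rewrite normrM !nE (_ : `|'i%C| = 1) ?mul1r //.
by rewrite normc_def /= expr0n add0r expr1n sqrtr1.
Qed.

Lemma real_cauchy_cvg (u : nat -> R) :
  (forall e : R, 0 < e -> exists N, forall M, (N <= M)%N ->
    `|u M - u N| <= e) ->
  exists l : R, u N @[N --> \oo] --> l.
Proof.
move=> H; suff : cvg (u N @[N --> \oo]) by move=> c; exists (lim (u @ \oo)).
apply/cauchy_cvgP/cauchy_exP => e e0.
have [N HN] := H (e / 2) (divr_gt0 e0 (ltr0n _ 2)).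
exists (u N); exists N => // M NM; rewrite /ball /= distrC.
by apply: le_lt_trans (HN M NM) _; rewrite ltr_pdivrMr // ltr_pMr // ltr1n.
Qed.

Lemma complex_cauchy_cvg (u : nat -> C) :
  (forall e : R, 0 < e -> exists N, forall M, (N <= M)%N ->
    `|u M - u N| <= e%:C%C) ->
  exists l : C, u N @[N --> \oo] --> l.
Proof.
move=> H.
have [a Ha] : exists a : R, complex.Re (u N) @[N --> \oo] --> a.
  apply: real_cauchy_cvg => e /H[N HN]; exists N => M /HN le.
  rewrite -lecR; apply: le_trans le; apply: le_trans _ (normc_ge_Re _).
  by rewrite raddfB.
have [b Hb] : exists b : R, complex.Im (u N) @[N --> \oo] --> b.
  apply: real_cauchy_cvg => e /H[N HN]; exists N => M /HN le.
  rewrite -lecR; apply: le_trans le; apply: le_trans _ (normc_ge_Im _).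
  by rewrite raddfB.
exists (Complex a b); apply/cvgrPdist_le => e e0.
have eE := ge0_complexE (ltW e0).
have e2 : 0 < complex.Re e / 2 by rewrite divr_gt0 // -ltcR -eE.
have [N _ HN] := (cvgrPdist_le _ _).1 Ha _ e2.
have [M _ HM] := (cvgrPdist_le _ _).1 Hb _ e2.
exists (maxn N M) => // P; rewrite /= geq_max => /andP[/HN/= h1 /HM/= h2].
apply: le_trans (normc_le_ReIm _) _; rewrite eE lecR.
rewrite [leRHS]splitr.
have -> : complex.Re (Complex a b - u P) = a - complex.Re (u P) by case: (u P).
have -> : complex.Im (Complex a b - u P) = b - complex.Im (u P) by case: (u P).
exact: lerD.
Qed.

End ComplexLimits.

Section Analytic.
Variables (R : realType) (n : nat).
Local Notation C := R[i].
Local Notation Cn := 'rV[C]_n.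
Implicit Types (al be ga : multiindex n) (a b : multiindex n -> C).
Implicit Types (h z : Cn) (f g : Cn -> C) (r A B q c : C).

Lemma expansionP f a : has_expansion f 0 a <->
  exists r, exists2 B, 0 < r & expands 0 f a r B.
Proof.
split; first exact: has_expansion_expands.
move=> [r [B r0 H]]; apply: expands_has_expansion r0 H.
exact: complex_geometric_null.
Qed.

Lemma dominated_sum r B a : 0 < r -> dominated r B a ->
  exists f, expands 0 f a r B.
Proof.
move=> r0 dom.
have H q h : 0 <= q -> q < 1 -> (forall i, `|h 0 i| <= q * r) ->
    exists l : C, box_sum a h N @[N --> \oo] --> l.
  move=> q0 q1 hq; apply: complex_cauchy_cvg => e e0.
  have B0 := dominated_ge0 dom.
  have q01 : 0 <= q < 1 by rewrite q0.
  have e1 : 0 < e%:C%C / (B + 1) by rewrite divr_gt0 ?ltcR // ltr_wpDl.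
  have [N _ HN] := (cvgrPdist_le _ _).1 (complex_geometric_null q01) _ e1.
  exists N => M NM.
  apply: le_trans (box_sum_tail (ltW r0) dom _ hq NM) _; first by rewrite q0 ltW.
  have := HN N (leqnn N); rewrite /= sub0r normrN ger0_norm ?exprn_ge0 //.
  rewrite ler_pdivlMr ?ltr_wpDl // mulrC; apply: le_trans.
  by rewrite ler_wpM2r ?lerDl // exprn_ge0.
exists (fun h => lim (box_sum a h N @[N --> \oo])); split=> //.
move=> q h N q0 q1 hq; rewrite add0r.
have [l Hl] := H q h q0 q1 hq.
have /cvgP Hc := Hl.
apply: (@cvg_dist_le _ (box_sum a h) _ _ _ N); first exact: Hc.
move=> M NM; apply: (box_sum_tail (ltW r0) dom _ hq NM).
by rewrite q0 ltW.
Qed.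

End Analytic.

(** * The ring of analytic germs *)

Section NearBox.
Variables (K : numFieldType) (n : nat).

(** [K] may be only partially ordered, so there is no minimum of [r] and [s];
    their harmonic sum is below both. *)
Lemma common_radius (r s : K) : 0 < r -> 0 < s ->
  exists t, [/\ 0 < t, t <= r & t <= s].
Proof.
move=> r0 s0; have rs0 : 0 < r + s by rewrite addr_gt0.
exists (r * s / (r + s)); rewrite divr_gt0 ?mulr_gt0 //; split=> //.
  by rewrite ler_pdivrMr // ler_wpM2l ?(ltW r0) // lerDr ltW.
by rewrite ler_pdivrMr // mulrC ler_wpM2l ?(ltW s0) // lerDl ltW.
Qed.

Lemma near0S2 (P Q S : 'rV[K]_n -> Prop) : (forall t, P t -> Q t -> S t) ->
  (\forall t \near (0 : 'rV[K]_n), P t) -> (\forall t \near (0 : 'rV[K]_n), Q t) ->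
  \forall t \near (0 : 'rV[K]_n), S t.
Proof.
by move=> H hP hQ; near=> t; apply: H; near: t.
Unshelve. all: by end_near. Qed.

Lemma near0W (P : 'rV[K]_n -> Prop) : (forall t, P t) -> \forall t \near (0 : 'rV[K]_n), P t.
Proof. by move=> H; near=> t. Unshelve. all: by end_near. Qed.

Lemma near_boxP (P : 'rV[K]_n -> Prop) :
  (\forall z \near (0 : 'rV[K]_n), P z) <->
  exists2 r : K, 0 < r & forall z : 'rV[K]_n, (forall i, `|z 0 i| < r) -> P z.
Proof.
split=> [/nbhs_ballP[r /= r0 H]|[r r0 H]].
  exists r => // z zr; apply: H; split=> // i j; rewrite !mxE ord1.
  by rewrite /ball /= sub0r normrN.
apply/nbhs_ballP; exists r => //= z bz; apply: H => i.
by have := bz.2 0 i; rewrite !mxE /ball /= sub0r normrN.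
Qed.

End NearBox.

Section AnalyticAlgebra.
Variables (R : realType) (n : nat).
Local Notation C := R[i].
Local Notation Cn := 'rV[C]_n.
Implicit Types (al be ga : multiindex n) (a b : multiindex n -> C).
Implicit Types (h z : Cn) (f g : Cn -> C) (r A B q c : C).

Lemma box1 : box n 1 = [:: zerom n].
Proof.
have : perm_eq (box n 1) [:: zerom n].
  apply: uniq_perm; rewrite ?box_uniq // => al; rewrite mem_box inE.
  apply/forallP/eqP => [H|-> i]; last by rewrite ffunE.
  by apply/ffunP => i; rewrite ffunE; have := H i; rewrite ltnS leqn0 => /eqP.
by move=> /perm_small_eq -> //.
Qed.

Lemma box_sum1 a h : box_sum a h 1 = a (zerom n).
Proof. by rewrite box_sumE box1 big_seq1 monomial_zerom mulr1. Qed.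

Lemma expansion0 f a : has_expansion f 0 a -> f 0 = a (zerom n).
Proof.
move=> /expansionP[r [B r0 [_ H]]].
have := H 0 0 1%N (lexx 0) ltr01; rewrite box_sum1 expr1 mulr0 addr0.
move=> le; apply/eqP; rewrite -subr_eq0 -normr_le0; apply: le => i.
by rewrite mxE normr0 mul0r.
Qed.

Lemma expansion_unique f g a : has_expansion f 0 a -> has_expansion g 0 a ->
  \forall z \near (0 : Cn), f z = g z.
Proof.
move=> [r r0 [_ H]] [s s0 [_ H']]; apply/near_boxP.
have [t [t0 tr ts]] := common_radius r0 s0.
exists t => // z zt.
have zlr i : `|z 0 i| < r by exact: lt_le_trans (zt i) tr.
have zls i : `|z 0 i| < s by exact: lt_le_trans (zt i) ts.
have := H _ zlr; have := H' _ zls; rewrite !add0r => u v.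
exact: (cvg_unique (@norm_hausdorff _ _) v u).
Qed.

Lemma expansion_mono ga c f : (forall z, f z = c * monomial z ga) ->
  has_expansion f 0 (mono_coef ga c).
Proof.
move=> fE; apply/expansionP; exists 1; eexists => //.
by apply: expands_mono => // h; rewrite add0r.
Qed.

Lemma expansion_common f g a b : has_expansion f 0 a -> has_expansion g 0 b ->
  exists r B, [/\ 0 < r, expands 0 f a r B & expands 0 g b r B].
Proof.
move=> /expansionP[r [B r0 H]] /expansionP[s [A s0 H']].
have B0 := dominated_ge0 H.1; have A0 := dominated_ge0 H'.1.
have [t [t0 tr ts]] := common_radius r0 s0.
exists t, (B + A); split=> //.
  by apply: expands_le H => //; rewrite lerDl.
by apply: expands_le H' => //; rewrite lerDr.
Qed.

Lemma expansionD f g a b : has_expansion f 0 a -> has_expansion g 0 b ->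
  has_expansion (fun z => f z + g z) 0 (fun al => a al + b al).
Proof.
move=> fa gb; have [r [B [r0 Hf Hg]]] := expansion_common fa gb.
by apply/expansionP; exists r; eexists => //; apply: expandsD Hf Hg; exact: ltW.
Qed.

Lemma expansionM f g a b : has_expansion f 0 a -> has_expansion g 0 b ->
  has_expansion (fun z => f z * g z) 0 (cprod a b).
Proof.
move=> fa gb; have [r [B [r0 Hf Hg]]] := expansion_common fa gb.
by apply/expansionP; exists r; eexists => //; apply: expandsM Hf Hg; exact: ltW.
Qed.

Lemma expansion_cst c : has_expansion (fun _ : Cn => c) 0 (mono_coef (zerom n) c).
Proof. by apply: expansion_mono => z; rewrite monomial_zerom mulr1. Qed.

Lemma eq_expansion f g a b : f =1 g -> a =1 b -> has_expansion f 0 a ->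
  has_expansion g 0 b.
Proof. by move=> /funext -> /funext ->. Qed.

Lemma expansion_sum (I : Type) (s : seq I) (F : I -> Cn -> C)
    (A : I -> multiindex n -> C) :
  (forall i, has_expansion (F i) 0 (A i)) ->
  has_expansion (fun z => \sum_(i <- s) F i z) 0
                (fun al => \sum_(i <- s) A i al).
Proof.
move=> H; elim: s => [|i s IH].
  apply: eq_expansion (expansion_cst 0) => [z|al]; rewrite big_nil //.
  by rewrite /mono_coef; case: ifP.
by apply: eq_expansion (expansionD (H i) IH) => [z|al]; rewrite big_cons.
Qed.

Definition analytic0 f := analytic_at f 0.

Lemma eq_analytic f g : f =1 g -> analytic0 f -> analytic0 g.
Proof. by move=> /funext ->. Qed.

Lemma analytic_cst c : analytic0 (fun=> c).
Proof. by eexists; exact: expansion_cst. Qed.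

Lemma analytic_mono ga : analytic0 (fun z => monomial z ga).
Proof.
by exists (mono_coef ga 1); apply: expansion_mono => z; rewrite mul1r.
Qed.

Lemma analytic_coord i : analytic0 (fun z => z 0 i).
Proof.
apply: eq_analytic (analytic_mono (powm i 1)) => z.
by rewrite monomial_powm expr1.
Qed.

Lemma analyticD f g : analytic0 f -> analytic0 g ->
  analytic0 (fun z => f z + g z).
Proof. by move=> [a Ha] [b Hb]; eexists; exact: expansionD Ha Hb. Qed.

Lemma analyticM f g : analytic0 f -> analytic0 g ->
  analytic0 (fun z => f z * g z).
Proof. by move=> [a Ha] [b Hb]; eexists; exact: expansionM Ha Hb. Qed.

Lemma analyticZ c f : analytic0 f -> analytic0 (fun z => c * f z).
Proof. exact/analyticM/analytic_cst. Qed.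

Lemma analyticB f g : analytic0 f -> analytic0 g ->
  analytic0 (fun z => f z - g z).
Proof.
move=> Hf /(analyticZ (-1)) /(analyticD Hf).
by apply: eq_analytic => z; rewrite mulN1r.
Qed.

Lemma analytic_sum (I : Type) (s : seq I) (P : pred I) (F : I -> Cn -> C) :
  (forall i, P i -> analytic0 (F i)) ->
  analytic0 (fun z => \sum_(i <- s | P i) F i z).
Proof.
move=> H; elim: s => [|i s IH].
  by apply: eq_analytic (analytic_cst 0) => z; rewrite big_nil.
case Pi: (P i).
  by apply: eq_analytic (analyticD (H i Pi) IH) => z; rewrite big_cons Pi.
by apply: eq_analytic IH => z; rewrite big_cons Pi.
Qed.

Lemma analytic_prod (I : Type) (s : seq I) (P : pred I) (F : I -> Cn -> C) :
  (forall i, P i -> analytic0 (F i)) ->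
  analytic0 (fun z => \prod_(i <- s | P i) F i z).
Proof.
move=> H; elim: s => [|i s IH].
  by apply: eq_analytic (analytic_cst 1) => z; rewrite big_nil.
case Pi: (P i).
  by apply: eq_analytic (analyticM (H i Pi) IH) => z; rewrite big_cons Pi.
by apply: eq_analytic IH => z; rewrite big_cons Pi.
Qed.

Lemma analyticX f k : analytic0 f -> analytic0 (fun z => f z ^+ k).
Proof.
move=> Hf; elim: k => [|k IH]; first exact: analytic_cst.
by apply: eq_analytic (analyticM Hf IH) => z; rewrite exprS.
Qed.

End AnalyticAlgebra.

(** * Inverses of units *)

Section Inverse.
Variables (R : realType) (n : nat).
Local Notation C := R[i].
Local Notation Cn := 'rV[C]_n.
Implicit Types (al be ga : multiindex n) (a b v : multiindex n -> C).
Implicit Types (h z : Cn) (f g : Cn -> C) (r A B q c : C).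

Lemma cprodDl a v b al :
  cprod (fun ga => a ga + v ga) b al = cprod a b al + cprod v b al.
Proof.
by rewrite /cprod -big_split; apply: eq_bigr => be _; rewrite mulrDl.
Qed.

Lemma cprod_mono ga c b al :
  cprod (mono_coef ga c) b al = if mle ga al then c * b (subm al ga) else 0.
Proof.
rewrite /cprod (sum_supp1 (x0 := ga)) ?lower_uniq //; last first.
  by move=> be /negbTE e; rewrite /mono_coef e mul0r.
by rewrite mem_lower /mono_coef eqxx.
Qed.

Lemma zerom_le al : mle (zerom n) al.
Proof. by apply/forallP => i; rewrite ffunE. Qed.

Lemma subm0 al : subm al (zerom n) = al.
Proof. by apply/ffunP => i; rewrite !ffunE subn0. Qed.

Lemma cprod_ext v b b' al : v (zerom n) = 0 ->
  (forall be, (deg be < deg al)%N -> b be = b' be) ->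
  cprod v b al = cprod v b' al.
Proof.
move=> v0 bb; rewrite /cprod big_seq [RHS]big_seq; apply: eq_bigr => be.
rewrite mem_lower => le; have [->|be0] := eqVneq be (zerom n).
  by rewrite v0 !mul0r.
rewrite bb // -[in ltnRHS](submKC le) degD -{1}[deg (subm _ _)]add0n ltn_add2r.
by rewrite lt0n deg_eq0.
Qed.

Section Recursion.
Variables (c : C) (v : multiindex n -> C).
Hypothesis v0 : v (zerom n) = 0.

(** The equation [(c + v) b = 1] reads [b = c^-1 (1 - v b)].  Since [v] has no
    constant term, the coefficient of [b] at [al] depends only on those of smaller
    degree, and iteration from [0] stabilises degree by degree. *)
Definition inv_step b al := c^-1 * (mono_coef (zerom n) 1 al - cprod v b al).

Definition inv_iter d := iter d inv_step (fun=> 0).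

Definition inv_coef al := inv_iter (deg al).+1 al.

Lemma inv_iter_stable d e al : (deg al < d)%N -> (deg al < e)%N ->
  inv_iter d al = inv_iter e al.
Proof.
elim: d e al => [|d IH] [|e] al //=; rewrite !ltnS => ld le.
rewrite /inv_step; congr (_ * (_ - _)); apply: cprod_ext => // be lt.
by apply: IH; exact: leq_trans lt _.
Qed.

Lemma inv_coefE d al : (deg al < d)%N -> inv_coef al = inv_iter d al.
Proof. by move=> lt; apply: inv_iter_stable. Qed.

Lemma inv_coef_step al : inv_coef al = inv_step inv_coef al.
Proof.
rewrite (@inv_coefE (deg al).+1) //= /inv_step; congr (_ * (_ - _)).
by apply: cprod_ext => // be lt; rewrite (inv_coefE lt).
Qed.

(** The bound survives each iteration because
    [`|c|^-1 (1 + (`|c| / 2) (2 / `|c|)) = 2 / `|c|]. *)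
Lemma dominated_inv r : 0 <= r -> c != 0 -> dominated r (`|c| / 2) v ->
  dominated r (2 / `|c|) inv_coef.
Proof.
move=> r0 cN0 domv; have c0 : 0 < `|c| by rewrite normr_gt0.
have dom_iter d : dominated r (2 / `|c|) (inv_iter d).
  elim: d => [|d IH].
    move=> s us; rewrite big1 ?divr_ge0 // => al _; by rewrite normr0 mul0r.
  have dd : dominated r (1 + `|c| / 2 * (2 / `|c|))
      (fun al => mono_coef (zerom n) 1 al + (- cprod v (inv_iter d) al)).
    apply: dominatedD => //.
      have := @dominated_mono C n (zerom n) 1 r r0.
      by rewrite deg_zerom normr1 mulr1.
    move=> s us; apply: le_trans (dominated_cprod r0 domv IH us).
    by apply: ler_sum => al _; rewrite normrN.
  move=> s us; rewrite /= /inv_step.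
  rewrite (eq_bigr (fun al => `|c|^-1 * (`|mono_coef (zerom n) 1 al -
     cprod v (inv_iter d) al| * r ^+ deg al))); last first.
    by move=> al _; rewrite normrM normfV mulrA.
  rewrite -mulr_sumr mulrC ler_pdivrMr // divfK ?gt_eqF //.
  apply: le_trans (dd s us) _.
  by rewrite mulrA divfK ?pnatr_eq0 // mulfV ?gt_eqF.
move=> s us; have [N sN] := sub_box s.
set d := (\max_(al <- s) deg al).+1.
rewrite big_seq (eq_bigr (fun al => `|inv_iter d al| * r ^+ deg al)).
  rewrite -big_seq; exact: dom_iter.
move=> al als; rewrite (@inv_coefE d) // ltnS.
exact: (leq_bigmax_seq (F := @deg n)).
Qed.

End Recursion.

(** Shrinking the polydisc by a factor of at most [1] multiplies the bound on
    the part without constant term by at most that factor; this reduces the inverse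
    to the case of a small perturbation of a constant. *)
Lemma expansion_inv f a : has_expansion f 0 a -> f 0 != 0 ->
  analytic0 (fun z => (f z)^-1).
Proof.
move=> fa f0; have a0E := expansion0 fa.
set c := a (zerom n); have cN0 : c != 0 by rewrite /c -a0E.
have c0 : 0 < `|c| by rewrite normr_gt0.
have [r [B r0 H]] := (expansionP _ _).1 fa.
have B0 := dominated_ge0 H.1.
pose k := `|c| / (2 * (B + `|c|)).
have Bc : 0 < B + `|c| by rewrite ltr_wpDl.
have k0 : 0 < k by rewrite divr_gt0 // mulr_gt0.
have kB : k * B <= `|c| / 2.
  rewrite /k mulrAC ler_pdivrMr ?mulr_gt0 // mulrA divfK ?pnatr_eq0 //.
  by rewrite ler_wpM2l ?(ltW c0) // lerDl ltW.
have k1 : k <= 1.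
  rewrite ler_pdivrMr ?mulr_gt0 // mul1r.
  apply: (@le_trans _ _ (B + `|c|)); first by rewrite lerDr.
  by rewrite ler_peMl ?(ltW Bc) // ler1n.
clearbody k; set r' := k * r; have r'0 : 0 < r' by rewrite mulr_gt0.
pose v al := if al == zerom n then 0 else a al.
have domv : dominated r' (`|c| / 2) v.
  move=> s us; apply: le_trans kB.
  apply: (@le_trans _ _ (k * \sum_(al <- s) `|a al| * r ^+ deg al)).
    rewrite mulr_sumr; apply: ler_sum => al _; rewrite /v.
    case: eqVneq => [_|al0] /=.
      by rewrite normr0 mul0r !mulr_ge0 ?exprn_ge0 ?(ltW k0) ?(ltW r0).
    rewrite mulrCA ler_wpM2l // exprMn ler_wpM2r ?exprn_ge0 ?(ltW r0) //.
    rewrite -[leRHS]expr1 ler_wiXn2l ?(ltW k0) //.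
    by rewrite lt0n deg_eq0.
  rewrite ler_wpM2l ?(ltW k0) //; exact: H.1.
have v0 : v (zerom n) = 0 by rewrite /v eqxx.
pose b := inv_coef c v.
have domb : dominated r' (2 / `|c|) b by apply: dominated_inv => //; exact: ltW.
have abE : cprod a b =1 mono_coef (zerom n) 1.
  move=> al.
  have -> : a = fun al => mono_coef (zerom n) c al + v al.
    apply/funext => ga; rewrite /mono_coef /v.
    by case: eqVneq => [->|_]; rewrite ?addr0 ?add0r.
  rewrite cprodDl cprod_mono zerom_le subm0 {1}/b inv_coef_step // /inv_step.
  by rewrite mulrA mulfV // mul1r subrK.
have H' : expands 0 f a r' B.
  by apply: expands_le H => //; rewrite ler_piMl // ltW.
exists b; apply/expansionP; exists r'.
exists (2 / `|c| + (B * (2 / `|c|) *+ 2 + 1) * (2 / `|c|)) => //.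
have c20 : 0 <= 2 / `|c| by rewrite divr_ge0.
have Bc20 : 0 <= B * (2 / `|c|) *+ 2 + 1 by rewrite addr_ge0 // mulrn_wge0 ?mulr_ge0.
split.
  by apply: dominated_le domb; rewrite ?(ltW r'0) // lerDl mulr_ge0.
move=> q h N q0 q1 hq; rewrite add0r.
have q01 : 0 <= q <= 1 by rewrite q0 ltW.
have fc : `|f h - c| <= `|c| / 2.
  apply: le_trans kB; have := H.2 (q * k) h 1%N.
  rewrite add0r box_sum1 expr1 => le; apply: le_trans (le _ _ _) _.
  - by rewrite mulr_ge0 // ltW.
  - by apply: le_lt_trans q1; rewrite ler_piMr.
  - by move=> i; rewrite -mulrA; exact: hq.
  by rewrite mulrC ler_wpM2r // ler_piMl ?ltW.
have fge : `|c| / 2 <= `|f h|.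
  have : `|c| <= `|f h| + `|f h - c|.
    by rewrite -{1}(subKr (f h) c) ler_normB.
  move=> le; rewrite -(lerD2r (`|c| / 2)) -splitr; apply: le_trans le _.
  by rewrite lerD2l.
have fN0 : f h != 0.
  by rewrite -normr_gt0; apply: lt_le_trans fge; rewrite divr_gt0.
have E1 : `|1 - box_sum (cprod a b) h N| <= q ^+ N.
  have Hm : expands (0 : Cn) (fun=> 1) (mono_coef (zerom n) 1) r'
      (`|1 : C| * r' ^+ deg (zerom n)).
    by apply: expands_mono; rewrite ?(ltW r'0) // => h';
       rewrite monomial_zerom mulr1.
  rewrite deg_zerom normr1 mulr1 in Hm.
  by rewrite (funext abE) -[leRHS]mul1r; exact: Hm.2.
have E2 := cprod_box_sum N (ltW r'0) H'.1 domb q01 hq.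
have E3 := H'.2 q h N q0 q1 hq; rewrite add0r in E3.
have E4 := box_sum_le N (ltW r'0) domb q01 hq.
have key : `|1 - f h * box_sum b h N| <= (B * (2 / `|c|) *+ 2 + 1) * q ^+ N.
  rewrite (_ : 1 - _ = (1 - box_sum (cprod a b) h N)
    - (box_sum a h N * box_sum b h N - box_sum (cprod a b) h N)
    - (f h - box_sum a h N) * box_sum b h N); last first.
    by rewrite mulrBl opprB addrA subrK opprB addrA subrK.
  rewrite (_ : _ * q ^+ N = q ^+ N + B * (2 / `|c|) * q ^+ N +
     B * (2 / `|c|) * q ^+ N); last first.
    by rewrite mulrDl mul1r addrC mulr2n mulrDl addrA.
  apply: le_trans (ler_normB _ _) _; apply: lerD.
    by apply: le_trans (ler_normB _ _) _; exact: lerD.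
  by rewrite normrM mulrAC ler_pM.
rewrite -[X in `|X|](mulKf fN0) mulrBr mulfV // normrM normfV mulrC.
rewrite ler_pdivrMr ?normr_gt0 //; apply: le_trans key _.
apply: (@le_trans _ _ ((2 / `|c| + (B * (2 / `|c|) *+ 2 + 1) * (2 / `|c|))
  * q ^+ N * (`|c| / 2))); last by rewrite ler_wpM2l // mulr_ge0 ?exprn_ge0 ?addr_ge0 ?mulr_ge0.
rewrite [leRHS]mulrAC ler_wpM2r ?exprn_ge0 // [leRHS]mulrDl -[leLHS]add0r.
apply: lerD.
  by rewrite mulr_ge0 // divr_ge0.
by rewrite -[leRHS]mulrA -(invf_div 2) mulfV ?mulr1 // gt_eqF // divr_gt0.
Qed.

End Inverse.

(** * Division by powers of the coordinates *)

Section Division.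
Variables (R : realType) (n : nat).
Local Notation C := R[i].
Local Notation Cn := 'rV[C]_n.
Implicit Types (al be ga : multiindex n) (a b v : multiindex n -> C).
Implicit Types (h z : Cn) (f g : Cn -> C) (r A B q c : C).
Variable kap : 'I_n -> nat.

Definition below : seq (multiindex n) :=
  [seq al : multiindex n <- box n (\max_i kap i) | [forall i, al i < kap i]%N].

Lemma mem_below al : (al \in below) = [forall i, al i < kap i]%N.
Proof.
rewrite mem_filter; case H: [forall i, _] => //=; rewrite mem_box.
apply/forallP => i; apply: leq_trans (forallP H i) _.
exact: leq_bigmax.
Qed.

Lemma below_uniq : uniq below.
Proof. by rewrite filter_uniq ?box_uniq. Qed.

Definition divisor al : option 'I_n := [pick i | kap i <= al i]%N.

Lemma divisor_le al i : divisor al = Some i -> (kap i <= al i)%N.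
Proof. by rewrite /divisor; case: pickP => // j ? [<-]. Qed.

Lemma divisorN al : (divisor al == None) = (al \in below).
Proof.
rewrite mem_below /divisor; case: pickP => [i le|H].
  by apply/esym/negbTE/forallPn; exists i; rewrite -leqNgt.
by rewrite eqxx; apply/esym/forallP => i; rewrite ltnNge H.
Qed.

Definition quot_coef a i al : C :=
  let be := addm al (powm i (kap i)) in
  if divisor be == Some i then a be else 0.

Lemma dominated_quot r B a i : 0 < r -> dominated r B a ->
  dominated r (B / r ^+ kap i) (quot_coef a i).
Proof.
move=> r0 dom s us; rewrite ler_pdivlMr ?exprn_gt0 // mulr_suml.
pose t := [seq addm al (powm i (kap i)) | al : multiindex n <- s].
have ut : uniq t.
  rewrite map_inj_in_uniq // => al be _ _ e; apply/ffunP => j.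
  by move: e => /ffunP/(_ j); rewrite !ffunE => /addIn.
apply: le_trans (dom t ut); rewrite big_map; apply: ler_sum => al _.
rewrite degD deg_powm exprD -mulrA.
apply: ler_wpM2r; first by rewrite mulr_ge0 ?exprn_ge0 ?(ltW r0).
by rewrite /quot_coef /=; case: ifP => // _; rewrite normr0.
Qed.

Lemma powm_le i k al : mle (powm i k) al = (k <= al i)%N.
Proof.
apply/forallP/idP => [/(_ i)|le j]; first by rewrite ffunE eqxx.
by rewrite ffunE; case: eqP => // ->.
Qed.

Lemma cprod_quot a i al :
  cprod (mono_coef (powm i (kap i)) 1) (quot_coef a i) al =
  if divisor al == Some i then a al else 0.
Proof.
rewrite cprod_mono powm_le; case: leqP => [le|lt].
  rewrite mul1r /quot_coef.
  have -> // : addm (subm al (powm i (kap i))) (powm i (kap i)) = al.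
  by apply/ffunP => j; rewrite !ffunE subnK //; case: eqP => // ->.
case: eqP => // /divisor_le; by rewrite leqNgt lt.
Qed.

(** Send each term divisible by some [z_i ^ kap i] to the quotient of one such
    [i], chosen by [divisor]; the quotients converge because their coefficients are
    among those of [f], and the finitely many other terms form the remainder. *)
Lemma expansion_division f a : has_expansion f 0 a ->
  exists h : 'I_n -> Cn -> C,
    [/\ forall i, analytic0 (h i),
        (forall i, 0 < kap i)%N -> forall i, h i 0 = a (powm i (kap i)) &
        \forall z \near (0 : Cn), f z = \sum_i h i z * z 0 i ^+ kap i +
           \sum_(al <- below) a al * monomial z al].
Proof.
move=> fa; have [r [B r0 [dom _]]] := (expansionP _ _).1 fa.
have /(@choice _ _ _)[h Hh] : forall i, exists g : Cn -> C, has_expansion g 0 (quot_coef a i).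
  move=> i; have [g Hg] := dominated_sum r0 (dominated_quot i r0 dom).
  by exists g; apply/expansionP; exists r; eexists => //; exact: Hg.
exists h; split.
- by move=> i; exists (quot_coef a i); exact: Hh i.
- move=> kap0 i; rewrite (expansion0 (Hh i)) /quot_coef.
  have -> : addm (zerom n) (powm i (kap i)) = powm i (kap i).
    by apply/ffunP => j; rewrite !ffunE.
  rewrite /divisor; case: pickP => [j|/(_ i)]; rewrite ffunE; last first.
    by rewrite eqxx leqnn.
  case: eqP => [-> _|_]; first by rewrite eqxx.
  by rewrite leqNgt kap0.
suff ga : has_expansion (fun z => \sum_i h i z * z 0 i ^+ kap i +
    \sum_(al <- below) a al * monomial z al) 0 a.
  exact: expansion_unique fa ga.
have h1 i : has_expansion (fun z => h i z * z 0 i ^+ kap i) 0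
    (fun al => if divisor al == Some i then a al else 0).
  have Hm : has_expansion (fun z : Cn => z 0 i ^+ kap i) 0
      (mono_coef (powm i (kap i)) 1).
    by apply: expansion_mono => z; rewrite monomial_powm mul1r.
  apply: eq_expansion (expansionM Hm (Hh i)) => [z|al]; first exact: mulrC.
  exact: cprod_quot.
have h2 be : has_expansion (fun z => a be * monomial z be) 0 (mono_coef be (a be)).
  exact: expansion_mono.
have := expansionD (expansion_sum (index_enum 'I_n) h1) (expansion_sum below h2).
apply: eq_expansion => [//|al].
case E: (divisor al) => [i|].
  rewrite (bigD1 i) //= eqxx big1 ?addr0; last first.
    by move=> j ji; rewrite (inj_eq Some_inj) eq_sym (negbTE ji).
  rewrite big_seq big1 ?addr0 // => be bel; rewrite /mono_coef.
  by case: eqP => // e; move: bel; rewrite -e -divisorN E.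
rewrite big1 // add0r (sum_supp1 (x0 := al)) ?below_uniq //.
  by rewrite -divisorN E /mono_coef !eqxx.
by move=> be ne; rewrite /mono_coef eq_sym (negbTE ne).
Qed.

End Division.

(** * Flat functions and jets on real space *)

Section Flat.
Variables (R : realType) (n : nat).
Local Notation C := R[i].
Local Notation V := 'rV[R]_n.
Implicit Types (phi psi : V -> C) (al be : multiindex n).

Definition flat (D : nat) phi : Prop :=
  exists B : R, \forall t \near (0 : V), `|phi t| <= (B * `|t| ^+ D)%:C%C.

Lemma flat_pos D phi : flat D phi -> exists2 B : R, 0 <= B &
  \forall t \near (0 : V), `|phi t| <= (B * `|t| ^+ D)%:C%C.
Proof.
move=> [B H]; exists `|B| => //; apply: filterS H => t le.
by apply: le_trans le _; rewrite lecR ler_wpM2r ?exprn_ge0 // ler_norm.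
Qed.

Lemma near0_norm (r : R) : 0 < r -> \forall t \near (0 : V), `|t| < r.
Proof.
move=> r0; apply/nbhs_ballP; exists r => //= t.
by rewrite mx_norm_ball /ball_ /= sub0r normrN.
Qed.

Lemma flatW D E phi : (E <= D)%N -> flat D phi -> flat E phi.
Proof.
move=> le /flat_pos[B B0 H]; exists B.
apply: near0S2 (near0_norm ltr01) H => t t1 H; apply: le_trans H _.
by rewrite lecR ler_wpM2l // ler_wiXn2l // ltW.
Qed.

Lemma flatD D phi psi : flat D phi -> flat D psi ->
  flat D (fun t => phi t + psi t).
Proof.
move=> [A HA] [B HB]; exists (A + B); apply: near0S2 HA HB => t a b.
by rewrite mulrDl rmorphD; apply: le_trans (ler_normD _ _) _; exact: lerD.
Qed.

Lemma flatM D E phi psi : flat D phi -> flat E psi ->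
  flat (D + E) (fun t => phi t * psi t).
Proof.
move=> [A HA] [B HB]; exists (A * B); apply: near0S2 HA HB => t a b.
by rewrite normrM exprD mulrACA rmorphM ler_pM.
Qed.

Lemma flat_cst (c : C) : flat 0 (fun=> c).
Proof.
exists (complex.Re `|c|); apply: near0W => t.
by rewrite expr0 mulr1 -ge0_complexE.
Qed.

Lemma flat_zero D : flat D (fun=> 0).
Proof. by exists 0; apply: near0W => t; rewrite normr0 mul0r. Qed.

Lemma flatZ D c phi : flat D phi -> flat D (fun t => c * phi t).
Proof. by move=> H; exact: (flatM (flat_cst c) H). Qed.

Lemma eq_flat D phi psi : phi =1 psi -> flat D phi -> flat D psi.
Proof. by move=> /funext ->. Qed.

Lemma flat_near_eq D phi psi : (\forall t \near (0 : V), phi t = psi t) ->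
  flat D phi -> flat D psi.
Proof. by move=> e [B H]; exists B; apply: near0S2 e H => t <-. Qed.

Lemma flatB D phi psi : flat D phi -> flat D psi ->
  flat D (fun t => phi t - psi t).
Proof.
move=> a /(flatZ (-1)) /(flatD a); apply: eq_flat => t.
by rewrite mulN1r.
Qed.

Lemma norm_real_complex (y : R) : `|y%:C%C| = `|y|%:C%C :> C.
Proof. by rewrite normc_def /= expr0n addr0 sqrtr_sqr. Qed.

Lemma coord_le_norm (t : V) i : `|t 0 i| <= `|t|.
Proof.
rewrite [leRHS]mx_normrE.
exact: (@le_bigmax _ _ _ 0 (fun ij : 'I_1 * 'I_n => `|t ij.1 ij.2|) (0, i)).
Qed.

Definition cvec (t : V) : 'rV[C]_n := map_mx (real_complex R) t.

Lemma norm_cvec (t : V) i : `|cvec t 0 i| <= `|t|%:C%C.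
Proof. by rewrite mxE norm_real_complex lecR coord_le_norm. Qed.

Lemma flat_mono al : flat (deg al) (fun t => monomial (cvec t) al).
Proof.
exists 1; apply: near0W => t; rewrite mul1r rmorphXn.
by apply: monomial_le => i; exact: norm_cvec.
Qed.

End Flat.

Section Jets.
Variables (R : realType) (n : nat).
Local Notation C := R[i].
Local Notation V := 'rV[R]_n.
Variable D : nat.
Implicit Types (phi psi : V -> C) (al be : multiindex n).

(** The functions that are, modulo [O(|t| ^ D)], complex polynomials in [t]
    whose monomials all have degree at least [d].  Being closed under these three
    rules replaces a list of coefficients, so that the operations on jets are
    inductions on the derivation. *)
Inductive jet : nat -> (V -> C) -> Prop :=
| jet_flat d phi : flat D phi -> jet d phi
| jet_mono d al : (d <= deg al)%N -> jet d (fun t => monomial (cvec t) al)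
| jet_lin d c phi psi : jet d phi -> jet d psi ->
    jet d (fun t => c * phi t + psi t).

Lemma eq_jet d phi psi : phi =1 psi -> jet d phi -> jet d psi.
Proof. by move=> /funext ->. Qed.

Lemma jetW d e phi : (d <= e)%N -> jet e phi -> jet d phi.
Proof.
move=> de H; elim: H de => {e phi} [e phi H|e al le|e c phi psi _ IH1 _ IH2] de.
- exact: jet_flat.
- by apply: jet_mono; exact: leq_trans le.
- by apply: jet_lin; [exact: IH1|exact: IH2].
Qed.

Lemma jet_zero d : jet d (fun=> 0).
Proof. exact/jet_flat/flat_zero. Qed.

Lemma jetZ d c phi : jet d phi -> jet d (fun t => c * phi t).
Proof.
move=> H; apply: eq_jet (jet_lin c H (jet_zero d)) => t.
by rewrite addr0.
Qed.

Lemma jetD d phi psi : jet d phi -> jet d psi ->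
  jet d (fun t => phi t + psi t).
Proof.
by move=> H H'; apply: eq_jet (jet_lin 1 H H') => t; rewrite mul1r.
Qed.

Lemma jetB d phi psi : jet d phi -> jet d psi ->
  jet d (fun t => phi t - psi t).
Proof.
move=> H H'; apply: eq_jet (jet_lin (-1) H' H) => t.
by rewrite mulN1r addrC.
Qed.

Lemma jet_sum d (I : Type) (s : seq I) (P : pred I) (F : I -> V -> C) :
  (forall i, P i -> jet d (F i)) -> jet d (fun t => \sum_(i <- s | P i) F i t).
Proof.
move=> H; elim: s => [|i s IH].
  by apply: eq_jet (jet_zero d) => t; rewrite big_nil.
case Pi: (P i).
  by apply: eq_jet (jetD (H i Pi) IH) => t; rewrite big_cons Pi.
by apply: eq_jet IH => t; rewrite big_cons Pi.
Qed.

Lemma jet_cst c : jet 0 (fun=> c).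
Proof.
have := jetZ c (@jet_mono 0 (zerom n) (leq0n _)).
by apply: eq_jet => t; rewrite monomial_zerom mulr1.
Qed.

Lemma jet_coord i : jet 1 (fun t => (t 0 i)%:C%C).
Proof.
have := @jet_mono 1 (powm i 1); rewrite deg_powm => /(_ (leqnn _)).
by apply: eq_jet => t; rewrite monomial_powm mxE expr1.
Qed.

Lemma jet_order d phi : jet d phi -> flat (minn d D) phi.
Proof.
elim=> {d phi} [d phi H|d al le|d c phi psi _ IH1 _ IH2].
- by apply: flatW H; exact: geq_minr.
- by apply: flatW (flat_mono R al); rewrite geq_min le.
- exact/flatD/IH2/flatZ.
Qed.

Lemma jet_flat0 d phi : jet d phi -> flat 0 phi.
Proof. by move=> /jet_order; exact: flatW. Qed.

Lemma jetM d e phi psi : jet d phi -> jet e psi ->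
  jet (d + e) (fun t => phi t * psi t).
Proof.
move=> Hphi Hpsi; have b := jet_flat0 Hpsi.
elim: Hphi => {d phi} [d phi H|d al le|d c phi phi' _ IH1 _ IH2].
- by apply: jet_flat; have := flatM H b; rewrite addn0.
- elim: Hpsi {b} => {e psi} [e psi H|e be le'|e c psi psi' _ IH1 _ IH2].
  + apply: jet_flat; rewrite -[D]add0n; apply: flatM H.
    exact: flatW (flat_mono R al).
  + have := @jet_mono (d + e) (addm al be); rewrite degD.
    move=> /(_ (leq_add le le')); apply: eq_jet => t.
    by rewrite monomialD.
  + apply: eq_jet (jet_lin c IH1 IH2) => t.
    by rewrite mulrDr mulrCA.
- apply: eq_jet (jet_lin c IH1 IH2) => t.
  by rewrite mulrDl mulrA.
Qed.

Definition same_leading d phi psi : Prop :=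
  [/\ jet d phi, jet d psi & jet d.+1 (fun t => phi t - psi t)].

Lemma same_leading_refl d phi : jet d phi -> same_leading d phi phi.
Proof.
move=> H; split=> //; apply: eq_jet (jet_zero d.+1) => t.
by rewrite subrr.
Qed.

Lemma same_leadingM d e f g f' g' : same_leading d f g ->
  same_leading e f' g' ->
  same_leading (d + e) (fun t => f t * f' t) (fun t => g t * g' t).
Proof.
move=> [a b c] [a' b' c']; split; [exact: jetM|exact: jetM|].
have h1 := jetM c a'; have h2 := jetM b c'.
rewrite addSn in h1; rewrite addnS in h2.
by apply: eq_jet (jetD h1 h2) => t; rewrite mulrBl mulrBr addrA subrK.
Qed.

Lemma eq_same_leading d f g f' g' : f =1 f' -> g =1 g' ->
  same_leading d f g -> same_leading d f' g'.
Proof. by move=> /funext -> /funext ->. Qed.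

Lemma same_leadingX d f g k : same_leading d f g ->
  same_leading (d * k) (fun t => f t ^+ k) (fun t => g t ^+ k).
Proof.
move=> H; elim: k => [|k IH].
  by rewrite muln0; exact/same_leading_refl/jet_cst.
rewrite mulnS; apply: eq_same_leading (same_leadingM H IH) => t;
by rewrite exprS.
Qed.

(** Changing the factors by terms of order [2] changes the product only beyond
    its leading degree. *)
Lemma same_leading_monomial (p : nat) (u v : 'I_p -> V -> C)
    (al : multiindex p) :
  (forall i, same_leading 1 (u i) (v i)) ->
  same_leading (deg al) (fun t => \prod_i u i t ^+ al i)
                        (fun t => \prod_i v i t ^+ al i).
Proof.
move=> H; rewrite /deg; elim: (index_enum _) => [|i s IH].
  rewrite big_nil.
  apply: eq_same_leading (same_leading_refl (jet_cst 1)) => t;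
  by rewrite big_nil.
rewrite big_cons -[X in (X + _)%N]mul1n.
apply: eq_same_leading (same_leadingM (same_leadingX (al i) (H i)) IH) => t;
by rewrite big_cons.
Qed.

(** Extraction of the value and the differential at [0] from a jet of which no
    coefficients are given. *)
Lemma jet_affine_part d phi : jet d phi -> exists c0 (A : 'I_n -> C),
  jet 2 (fun t => phi t - (c0 + \sum_i (t 0 i)%:C%C * A i)).
Proof.
elim=> {d phi} [d phi H|d al le|d c phi psi _ [c1 [A1 H1]] _ [c2 [A2 H2]]].
- exists 0, (fun=> 0); apply: jet_flat; apply: eq_flat H => t.
  by rewrite big1 ?addr0 ?subr0 // => i _; rewrite mulr0.
- have [lt|] := leqP 2 (deg al).
    exists 0, (fun=> 0); have := jet_mono lt; apply: eq_jet => t.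
    by rewrite big1 ?addr0 ?subr0 // => i _; rewrite mulr0.
  rewrite ltnS leq_eqVlt ltnS leqn0 => /orP[/eqP d1|]; last first.
    rewrite deg_eq0 => /eqP ->; exists 1, (fun=> 0).
    apply: eq_jet (jet_zero 2) => t; rewrite monomial_zerom.
    by rewrite big1 ?addr0 ?subrr // => i _; rewrite mulr0.
  exists 0, (fun i => (al i)%:R); apply: eq_jet (jet_zero 2) => t.
  rewrite add0r.
  have [i ali] : exists i, al i = 1%N /\ forall j, j != i -> al j = 0%N.
    have [i ai0] : exists i, al i != 0%N.
      apply/existsP; rewrite -negb_forall; apply/negP => /forallP H.
      by move: d1; rewrite /deg big1 // => i _; exact/eqP/H.
    have := d1; rewrite /deg (bigD1 i) //=; exists i.
    case: (al i) ai0 H => // k _; rewrite addSn => -[] /eqP.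
    rewrite addn_eq0 => /andP[/eqP -> ]; rewrite sum_nat_eq0 => /forallP H.
    by split=> // j ji; apply/eqP; exact: (implyP (H j)).
  case: ali => a1 a0; rewrite (bigD1 i) //= a1 mulr1 big1 => [|j ji].
    rewrite addr0 /monomial (bigD1 i) //= a1 expr1 big1 ?mulr1 ?mxE ?subrr //.
    by move=> j ji; rewrite a0 // expr0.
  by rewrite a0 // mulr0.
- exists (c * c1 + c2), (fun i => c * A1 i + A2 i).
  apply: eq_jet (jet_lin c H1 H2) => t.
  under [in RHS]eq_bigr do rewrite mulrDr mulrCA.
  rewrite big_split /= -mulr_sumr.
  move: (\sum_i _) (\sum_i _) => s1 s2; ring.
Qed.

End Jets.

(** * Jets of composites *)

Section Composition.
Variables (R : realType) (n : nat).
Local Notation C := R[i].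
Local Notation V := 'rV[R]_n.
Implicit Types (phi psi : V -> C) (al be : multiindex n).

Lemma near0_forall (I : finType) (P : I -> V -> Prop) :
  (forall i, \forall t \near (0 : V), P i t) ->
  \forall t \near (0 : V), forall i, P i t.
Proof. by move=> H; exact: (@filter_forall _ _ _ (nbhs (0 : V)) _ H). Qed.

Lemma flat_uniform p d (u : 'I_p -> V -> C) : (forall i, flat d (u i)) ->
  exists2 B : R, 0 <= B &
  \forall t \near (0 : V), forall i, `|u i t| <= (B * `|t| ^+ d)%:C%C.
Proof.
move=> H; have /(@choice _ _ _)[B HB] : forall i, exists B : R, 0 <= B /\
    \forall t \near (0 : V), `|u i t| <= (B * `|t| ^+ d)%:C%C.
  by move=> i; have [B B0 HB] := flat_pos (H i); exists B.
exists (\sum_i B i); first by apply: sumr_ge0 => i _; case: (HB i).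
apply: near0S2 (near0_forall (fun i => (HB i).2)) (near0W (fun=> I)).
move=> t le _ i; apply: le_trans (le i) _.
rewrite lecR ler_wpM2r ?exprn_ge0 // (bigD1 i) //= lerDl sumr_ge0 // => j _.
by case: (HB j).
Qed.

Lemma norm_le_coord p (y : 'rV[R]_p) (c : R) : 0 <= c ->
  (forall i, `|y 0 i| <= c) -> `|y| <= c.
Proof.
move=> c0 H; rewrite [leLHS]mx_normrE; apply: bigmax_le => // -[i j] _ /=.
by rewrite ord1.
Qed.

Lemma flat_comp p d (phi : 'rV[R]_p -> C) (y : V -> 'rV[R]_p) :
  (forall i, flat 1 (fun t => (y t 0 i)%:C%C)) -> flat d phi ->
  flat d (fun t => phi (y t)).
Proof.
move=> Hy /flat_pos[A A0 HA].
have [B B0 HB] := flat_uniform Hy.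
have {}HB : \forall t \near (0 : V), `|y t| <= B * `|t|.
  apply: near0S2 HB (near0W (fun=> I)) => t le _.
  apply: norm_le_coord; first by rewrite mulr_ge0.
  by move=> i; have := le i; rewrite norm_real_complex lecR expr1.
have /nbhs_ballP[e /= e0 He] := HA.
have eB : 0 < e / (B + 1) by rewrite divr_gt0 // ltr_wpDl.
exists (A * B ^+ d); apply: near0S2 HB (near0_norm n eB) => t le te.
have ye : `|y t| < e.
  apply: le_lt_trans le _; move: te; rewrite ltr_pdivlMr ?ltr_wpDl // mulrC.
  by apply: le_lt_trans; rewrite ler_wpM2r // lerDl.
have := He (y t); rewrite mx_norm_ball /ball_ /= sub0r normrN => /(_ ye) H.
apply: le_trans H _; rewrite lecR -mulrA ler_wpM2l // -exprMn.
by rewrite lerXn2r // nnegrE // mulr_ge0.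
Qed.

Lemma jet_comp p D d (phi : 'rV[R]_p -> C) (y : V -> 'rV[R]_p) : (0 < D)%N ->
  (forall i, jet D 1 (fun t => (y t 0 i)%:C%C)) -> jet D d phi ->
  jet D d (fun t => phi (y t)).
Proof.
move=> D0 Hy; elim=> {d phi} [d phi H|d al le|d c phi psi _ IH1 _ IH2].
- apply/jet_flat/flat_comp => // i; have := jet_order (Hy i).
  by apply: flatW; rewrite leq_min D0.
- have close : forall i, same_leading D 1 (fun t => (y t 0 i)%:C%C)
                                  (fun t => (y t 0 i)%:C%C).
    by move=> i; exact: same_leading_refl.
  have [H _ _] := same_leading_monomial al close.
  apply: (jetW le); apply: eq_jet H => t; rewrite /monomial.
  by apply: eq_bigr => i _; rewrite mxE.
- exact: jet_lin.
Qed.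

(** In the box of size [D], the expansion of [f] at [u t] is off by a power
    [q ^ D] with [q] proportional to [|t|]. *)
Lemma flat_analytic p D (f : 'rV[C]_p -> C) a (u : V -> 'rV[C]_p) :
  has_expansion f 0 a -> (forall i, flat 1 (fun t => u t 0 i)) ->
  flat D (fun t => f (u t) - box_sum a (u t) D).
Proof.
move=> /expansionP[r [B r0 [dom H]]] Hu.
have [A A0 HA] := flat_uniform Hu.
have rE := ge0_complexE (ltW r0); have BE := ge0_complexE (dominated_ge0 dom).
have r'0 : 0 < complex.Re r by rewrite -ltcR -rE.
have eA : 0 < complex.Re r / (A + 1) by rewrite divr_gt0 // ltr_wpDl.
exists (complex.Re B * (A / complex.Re r) ^+ D).
apply: near0S2 HA (near0_norm n eA) => t le te.
pose q := A * `|t| / complex.Re r.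
have q0 : 0 <= q by rewrite /q !mulr_ge0 // invr_ge0 ltW.
have q1 : q < 1.
  rewrite /q ltr_pdivrMr // mul1r; move: te.
  rewrite ltr_pdivlMr ?ltr_wpDl // mulrC; apply: le_lt_trans.
  by rewrite ler_wpM2r // lerDl.
have := H q%:C%C (u t) D; rewrite add0r; set X := `|_|.
rewrite -ltcR in q1; rewrite ler0c.
move=> /(_ q0 q1) le'; apply: le_trans (le' _) _.
  move=> i; apply: le_trans (le i) _; rewrite expr1 [X in _ <= _ * X]rE -rmorphM lecR.
  by rewrite /q divfK // gt_eqF.
rewrite {1}BE -rmorphXn -rmorphM lecR -mulrA -exprMn ler_wpM2l //.
  by rewrite -ler0c -BE (dominated_ge0 dom).
by rewrite /q mulrAC.
Qed.

Lemma jet_analytic p D d (f : 'rV[C]_p -> C) a (u : V -> 'rV[C]_p) :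
  (0 < D)%N -> has_expansion f 0 a -> (forall i, jet D 1 (fun t => u t 0 i)) ->
  (forall al : multiindex p, (deg al < d)%N -> a al = 0) ->
  jet D d (fun t => f (u t)).
Proof.
move=> D0 fa Hu a0.
have close : forall i, same_leading D 1 (fun t => u t 0 i) (fun t => u t 0 i).
  by move=> i; exact: same_leading_refl.
have Hflat : flat D (fun t => f (u t) - box_sum a (u t) D).
  apply: flat_analytic => // i; have := jet_order (Hu i).
  by apply: flatW; rewrite leq_min D0.
have Hbox : jet D d (fun t => box_sum a (u t) D).
  suff : jet D d (fun t => \sum_(al <- box p D) a al * monomial (u t) al).
    by apply: eq_jet => t; rewrite box_sumE.
  apply: jet_sum => al _; have [/a0 ->|le] := ltnP (deg al) d.
    by apply: eq_jet (jet_zero _ _ _ _) => t; rewrite mul0r.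
  by apply/jetZ/(jetW le); have [] := same_leading_monomial al close.
apply: eq_jet (jetD (jet_flat d Hflat) Hbox) => t.
by rewrite subrK.
Qed.

Lemma jet_real_analytic D (f : V -> R) : (0 < D)%N -> analytic_at f 0 ->
  jet D 0 (fun t => (f t)%:C%C).
Proof.
move=> D0 [a /has_expansion_expands[r [B r0 [dom H]]]].
have Hflat : flat D (fun t => (f t - box_sum a t D)%:C%C).
  exists (B * (r^-1) ^+ D); apply: near0S2 (near0_norm n r0) (near0W (fun=> I)).
  move=> t tr _; rewrite norm_real_complex lecR.
  have q1 : `|t| / r < 1 by rewrite ltr_pdivrMr // mul1r.
  have := H (`|t| / r) t D; rewrite add0r => le; apply: le_trans (le _ _ _) _.
  - by rewrite divr_ge0 // ltW.
  - by [].
  - by move=> i; rewrite divfK ?gt_eqF // coord_le_norm.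
  by rewrite exprMn mulrA mulrAC.
have Hbox : jet D 0 (fun t => (box_sum a t D)%:C%C).
  suff : jet D 0 (fun t => \sum_(al <- box n D) (a al)%:C%C * monomial (cvec t) al).
    apply: eq_jet => t; rewrite box_sumE rmorph_sum /=.
    apply: eq_bigr => al _; rewrite rmorphM /= /monomial rmorph_prod.
    by congr (_ * _); apply: eq_bigr => i _; rewrite mxE rmorphXn.
  by apply: jet_sum => al _; apply/jetZ/jet_mono.
apply: eq_jet (jetD (jet_flat 0 Hflat) Hbox) => t.
by rewrite rmorphB subrK.
Qed.

End Composition.

(** * Polynomial identities *)

Section PolynomialIdentities.
Variable R : realType.
Local Notation C := R[i].

Lemma poly_nat_roots (p : {poly C}) : (forall k : nat, p.[k%:R] = 0) -> p = 0.
Proof.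
move=> H; apply/eqP; apply/negPn/negP => p0.
have := @max_poly_roots C p [seq k%:R | k <- iota 0 (size p)] p0.
rewrite size_map size_iota ltnn => F; apply/notF/F.
  by apply/allP => _ /mapP[k _ ->]; apply/eqP/H.
rewrite map_inj_uniq ?iota_uniq // => i j /eqP.
by rewrite eqr_nat => /eqP.
Qed.

Lemma digits_inj N n (f g : 'I_n -> nat) : (forall i, f i < N)%N ->
  (forall i, g i < N)%N ->
  (\sum_i f i * N ^ i = \sum_i g i * N ^ i)%N -> f =1 g.
Proof.
elim: n f g => [|n IH] f g Hf Hg; first by move=> _ [].
have N0 : (0 < N)%N by apply: leq_ltn_trans (Hf ord0).
have E (h : 'I_n.+1 -> nat) : (\sum_i h i * N ^ i =
    h ord0 + N * \sum_(i < n) h (lift ord0 i) * N ^ i)%N.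
  rewrite big_ord_recl expn0 muln1; congr (_ + _)%N.
  rewrite big_distrr; apply: eq_bigr => i _ /=.
  by rewrite /bump /= add1n expnS mulnCA.
rewrite !E => e.
have e0 : f ord0 = g ord0.
  have := congr1 (modn^~ N) e.
  by rewrite ![(_ + N * _)%N]addnC ![(N * _)%N]mulnC !modnMDl !modn_small.
move: e; rewrite e0 => /addnI /eqP; rewrite eqn_pmul2l // => /eqP.
move=> /IH -/(_ (fun i => Hf _) (fun i => Hg _)) e i.
by case: (unliftP ord0 i) => [j ->|->].
Qed.

(** Kronecker's substitution [z_i := x ^ (N ^ i)] sends the monomials with
    exponents below [N] to distinct powers of [x]. *)
Lemma monomials_free n (s : seq (multiindex n)) (c : multiindex n -> C) :
  uniq s -> (forall z : 'rV[C]_n, \sum_(al <- s) c al * monomial z al = 0) ->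
  forall al, al \in s -> c al = 0.
Proof.
move=> us H al als; have [N sN] := sub_box s.
pose code (be : multiindex n) := (\sum_i be i * N ^ i)%N.
have code_inj be : be \in s -> code be = code al -> be = al.
  move=> bes /digits_inj e; apply/ffunP; apply: e => i.
    by move: (sN _ bes); rewrite mem_box => /forallP.
  by move: (sN _ als); rewrite mem_box => /forallP.
pose p : {poly C} := \sum_(be <- s) c be *: 'X^(code be).
have p0 : p = 0.
  apply: poly_nat_roots => k.
  have := H (\row_i (k%:R ^+ (N ^ i))); rewrite /p horner_sum => e.
  rewrite -[RHS]e; apply: eq_bigr => be _; rewrite hornerZ hornerXn.
  congr (_ * _); rewrite /code /monomial -prodrXr; apply: eq_bigr => i _.
  by rewrite mxE -exprM mulnC.
have := congr1 (fun q : {poly C} => q`_(code al)) p0.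
rewrite coef0 /p coef_sum (bigD1_seq al) //= big_seq_cond big1.
  by rewrite coefZ coefXn eqxx mulr1 addr0.
move=> be /andP[bes ne]; rewrite coefZ coefXn.
case: eqP => [e|_]; last by rewrite mulr0.
by rewrite (code_inj be) ?eqxx // in ne.
Qed.

(** A polynomial vanishing on the real points of some linear coordinate system
    vanishes everywhere: along a complex line joining two real directions it is a
    one-variable polynomial with too many roots. *)
Lemma monomials_free_real n (A : 'M[C]_n) (s : seq (multiindex n))
    (c : multiindex n -> C) : A \in unitmx -> uniq s ->
  (forall t : 'rV[R]_n,
     \sum_(al <- s) c al * monomial (cvec t *m A) al = 0) ->
  forall al, al \in s -> c al = 0.
Proof.
move=> uA us H; apply: monomials_free => // z.
pose w := z *m invmx A.
pose x : 'rV[R]_n := map_mx (@complex.Re R) w.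
pose y : 'rV[R]_n := map_mx (@complex.Im R) w.
pose u := cvec x *m A; pose v := cvec y *m A.
have zE : z = u + 'i%C *: v.
  rewrite -[LHS]mulmx1 -(mulVmx uA) mulmxA -/w /u /v scalemxAl -mulmxDl.
  congr (_ *m _); apply/matrixP => i j; rewrite !mxE.
  by rewrite [LHS]complexE.
pose p : {poly C} := \sum_(al <- s)
   (c al)%:P * \prod_j ((u 0 j)%:P + (v 0 j)%:P * 'X) ^+ al j.
have pE (a : C) : p.[a] = \sum_(al <- s) c al * monomial (u + a *: v) al.
  rewrite /p horner_sum; apply: eq_bigr => al _.
  rewrite hornerM hornerC horner_prod; congr (_ * _); apply: eq_bigr => j _.
  by rewrite horner_exp !hornerE !mxE [a * _]mulrC.
rewrite zE -pE (_ : p = 0) ?horner0 //; apply: poly_nat_roots => k.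
rewrite pE -[RHS](H (x + k%:R *: y)); apply: eq_bigr => al _.
congr (_ * monomial _ _); rewrite /u /v scalemxAl -mulmxDl; congr (_ *m _).
apply/matrixP => i j; rewrite !mxE rmorphD rmorphM.
by rewrite rmorph_nat.
Qed.

(** At [s *: t] the bound is of order [s ^ d.+1] while [Q] scales as
    [s ^ d]. *)
Lemma homogeneous_flat n d (Q : 'rV[R]_n -> C) :
  (forall (s : R) t, Q (s *: t) = s%:C%C ^+ d * Q t) ->
  flat d.+1 Q -> forall t, Q t = 0.
Proof.
move=> hom /flat_pos[B B0 HB] t.
have /nbhs_ballP[e /= e0 He] := HB.
apply/eqP/negPn/negP => Qt0.
have qE := ge0_complexE (normr_ge0 (Q t)); set q := complex.Re `|Q t| in qE.
have q0 : 0 < q by rewrite -ltcR -qE normr_gt0.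
pose K := B * `|t| ^+ d.+1.
have K0 : 0 <= K by rewrite mulr_ge0 ?exprn_ge0.
have t1 : 0 < `|t| + 1 by rewrite ltr_wpDl.
have K1 : 0 < K + 1 by rewrite ltr_wpDl.
pose s := Num.min (e / (`|t| + 1)) (q / (K + 1)).
have s0 : 0 < s by rewrite lt_min !divr_gt0.
have bst : `|s *: t| < e.
  rewrite normrZ gtr0_norm // (@lt_le_trans _ _ (s * (`|t| + 1))) //.
    by rewrite ltr_pM2l // ltrDl.
  by rewrite -ler_pdivlMr // ge_min lexx.
have := He (s *: t); rewrite mx_norm_ball /ball_ /= sub0r normrN => /(_ bst).
rewrite hom normrM normrX norm_real_complex (gtr0_norm s0) qE -rmorphXn -rmorphM.
rewrite lecR normrZ (gtr0_norm s0) exprMn mulrCA -/K.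
rewrite [X in _ <= X * _]exprS mulrAC [leRHS]mulrC ler_pM2l ?exprn_gt0 //.
apply/negP; rewrite -ltNge; apply: lt_le_trans (_ : s * (K + 1) <= _).
  by rewrite ltr_pM2l // ltrDl.
by rewrite -ler_pdivlMr // ge_min lexx orbT.
Qed.

End PolynomialIdentities.

(** * Holomorphic germs along a totally real jet *)

Section FormalCoordinates.
Variables (R : realType) (n : nat).
Local Notation C := R[i].
Local Notation V := 'rV[R]_n.
Local Notation Cn := 'rV[C]_n.
Variables (D : nat) (H : V -> Cn) (A : 'M[C]_n).
Implicit Types (phi psi : V -> C) (f g : Cn -> C).

(** [H] parametrises, to order [D], an [n]-dimensional set with complex linear
    part [A].  That [A] is invertible over the complex numbers is total reality of
    the image at [0]; it makes the pullback of holomorphic germs by [H] bijective on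
    jets. *)
Definition formal_coordinates : Prop :=
  A \in unitmx /\
  forall j, same_leading D 1 (fun t => H t 0 j) (fun t => (cvec t *m A) 0 j).

Hypothesis D0 : (0 < D)%N.
Hypothesis HA : formal_coordinates.

Lemma coordinate_jet j : jet D 1 (fun t => H t 0 j).
Proof. by have [] := HA.2 j. Qed.

Lemma coordinate_flat j : flat 1 (fun t => H t 0 j).
Proof. by have := jet_order (coordinate_jet j); apply: flatW; rewrite leq_min D0. Qed.

(** Invertibility of [A] recovers the real coordinates from holomorphic
    ones. *)
Lemma inverse_leading i : same_leading D 1
  (fun t => (H t *m invmx A) 0 i) (fun t => (t 0 i)%:C%C).
Proof.
have tE (t : V) : (t 0 i)%:C%C = \sum_j (cvec t *m A) 0 j * invmx A j i :> C.
  by have := mulmxK HA.1 (cvec t); move=> /matrixP /(_ 0 i); rewrite !mxE.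
split; [|exact: jet_coord|].
  suff : jet D 1 (fun t => \sum_j invmx A j i * H t 0 j).
    by apply: eq_jet => t; rewrite mxE; apply: eq_bigr => j _; exact: mulrC.
  by apply: jet_sum => j _; apply/jetZ/coordinate_jet.
suff : jet D 2 (fun t => \sum_j invmx A j i * (H t 0 j - (cvec t *m A) 0 j)).
  apply: eq_jet => t; rewrite tE mxE -sumrB; apply: eq_bigr => j _.
  by rewrite mulrC mulrBl.
by apply: jet_sum => j _; apply/jetZ; have [] := HA.2 j.
Qed.

Definition liftable phi : Prop :=
  exists2 g, analytic0 g & flat D (fun t => g (H t) - phi t).

Lemma liftable_lin c phi psi : liftable phi -> liftable psi ->
  liftable (fun t => c * phi t + psi t).
Proof.
move=> [g Hg Fg] [h Hh Fh]; exists (fun z => c * g z + h z).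
  exact/analyticD/Hh/analyticZ.
by apply: eq_flat (flatD (flatZ c Fg) Fh) => t; rewrite mulrBr opprD addrACA.
Qed.

Lemma analytic_linear_monomial (al : multiindex n) :
  analytic0 (fun z : Cn => \prod_i (z *m invmx A) 0 i ^+ al i).
Proof.
apply: analytic_prod => i _; apply: analyticX.
have : analytic0 (fun z : Cn => \sum_j invmx A j i * z 0 j).
  by apply: analytic_sum => j _; apply/analyticZ/analytic_coord.
apply: eq_analytic => z; rewrite mxE; apply: eq_bigr => j _; exact: mulrC.
Qed.

(** Descending induction on the order: a monomial of degree [d] is lifted to
    the same monomial in linear coordinates, up to an error of order [d + 1]. *)
Lemma jet_liftable_order d k phi : (d + k = D)%N -> jet D d phi -> liftable phi.
Proof.
elim: k d phi => [|k IH] d phi dk Hphi.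
  exists (fun=> 0); first exact: analytic_cst.
  have := flatZ (-1) (jet_order Hphi); rewrite -dk addn0 minnn.
  by apply: eq_flat => t; rewrite mulN1r add0r.
have {}IH := IH d.+1 _ _; rewrite addSnnS in IH.
have main : forall e psi, jet D e psi -> (d <= e)%N -> liftable psi.
  move=> e psi; elim=> {e psi} [e psi Hpsi|e al le|e c f g _ IH1 _ IH2] de.
  - exists (fun=> 0); first exact: analytic_cst.
    by apply: eq_flat (flatZ (-1) Hpsi) => t; rewrite mulN1r add0r.
  - have [lt|] := ltnP d (deg al); first by apply: IH => //; exact: jet_mono.
    move=> ged; have dE : deg al = d.
      by apply/eqP; rewrite eqn_leq ged (leq_trans de le).
    have [_ _ Hj] := same_leading_monomial al inverse_leading.
    rewrite dE in Hj; have [h Hh Fh] := IH _ dk Hj.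
    exists (fun z => \prod_i (z *m invmx A) 0 i ^+ al i - h z).
      exact: (analyticB (analytic_linear_monomial al) Hh).
    have mE (t : V) : monomial (cvec t) al = \prod_i (t 0 i)%:C%C ^+ al i.
      by apply: eq_bigr => i _; rewrite mxE.
    apply: eq_flat (flatZ (-1) Fh) => t; rewrite mE; ring.
  - by apply: liftable_lin; [exact: IH1|exact: IH2].
exact: main Hphi (leqnn d).
Qed.

(** Surjectivity of the pullback on jets.  For [H] the parametrisation of a
    totally real submanifold, even antiholomorphic functions agree along it with
    holomorphic germs to any finite order. *)
Lemma jet_liftable phi : jet D 0 phi -> liftable phi.
Proof. exact: (@jet_liftable_order 0 D). Qed.

(** Injectivity of the pullback on jets: the lowest homogeneous part of [f]
    is seen unchanged, in the coordinates [A], through [H]. *)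
Lemma flat_pullback_coef f a : has_expansion f 0 a ->
  flat D (fun t => f (H t)) ->
  forall al : multiindex n, (deg al < D)%N -> a al = 0.
Proof.
move=> fa Ff.
have Fbox : flat D (fun t => box_sum a (H t) D).
  have := flatB Ff (flat_analytic D fa coordinate_flat).
  by apply: eq_flat => t; rewrite subKr.
have main d : (d <= D)%N -> forall al : multiindex n, (deg al < d)%N -> a al = 0.
  elim: d => // d IH ltd al; rewrite ltnS leq_eqVlt => /orP[/eqP ald|]; last first.
    by apply: IH; exact: ltnW.
  pose s := [seq be : multiindex n <- box n D | deg be == d].
  pose Q (t : V) := \sum_(be <- s) a be * monomial (cvec t *m A) be.
  have FQ : flat d.+1 Q.
    have J1 : jet D d.+1 (fun t =>
        \sum_(be <- s) a be * monomial (H t) be - Q t).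
      suff : jet D d.+1 (fun t => \sum_(be <- box n D | deg be == d) a be *
          (monomial (H t) be - monomial (cvec t *m A) be)).
        apply: eq_jet => t; rewrite /Q /s !big_filter -sumrB.
        by apply: eq_bigr => be _; rewrite mulrBr.
      apply: jet_sum => be /eqP dbe; apply: jetZ.
      by have [_ _] := same_leading_monomial be HA.2; rewrite dbe.
    have J2 : jet D d.+1 (fun t => \sum_(be <- box n D | deg be != d)
        a be * monomial (H t) be).
      apply: jet_sum => be ne.
      have [/(IH (ltnW ltd)) ->|gt] := ltnP (deg be) d.
        by apply: eq_jet (jet_zero R n D d.+1) => t; rewrite mul0r.
      have [J _ _] := same_leading_monomial be HA.2.
      by apply: jetZ; apply: jetW J; rewrite ltn_neqAle eq_sym ne.
    have F1 : flat d.+1 (fun t =>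
        (\sum_(be <- s) a be * monomial (H t) be - Q t) +
        \sum_(be <- box n D | deg be != d) a be * monomial (H t) be).
      by have := jet_order (jetD J1 J2); apply: flatW; rewrite leq_min leqnn ltd.
    apply: eq_flat (flatB (flatW ltd Fbox) F1) => t.
    rewrite box_sumE (bigID (fun be => deg be == d)) /= /s big_filter.
    ring.
  have homQ (x : R) t : Q (x *: t) = x%:C%C ^+ d * Q t.
    rewrite /Q mulr_sumr big_seq [RHS]big_seq; apply: eq_bigr => be.
    rewrite mem_filter => /andP[/eqP <- _]; rewrite mulrCA; congr (_ * _).
    rewrite /deg -prodrXr -big_split; apply: eq_bigr => i _ /=.
    rewrite -exprMn (_ : cvec (x *: t) = x%:C%C *: cvec t) -?scalemxAl ?mxE //.
    by apply/matrixP => j k; rewrite !mxE rmorphM.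
  have Q0 := homogeneous_flat homQ FQ.
  apply: (@monomials_free_real _ _ A s) => //; first exact: HA.1.
    by rewrite filter_uniq ?box_uniq.
  by rewrite mem_filter ald eqxx mem_box_deg ?ald.
exact: main.
Qed.

End FormalCoordinates.

(** * Units and restriction to a coordinate axis *)

Section LocalRing.
Variables (R : realType) (n : nat).
Local Notation C := R[i].
Local Notation Cn := 'rV[C]_n.
Implicit Types (f g : Cn -> C) (F : Cn -> Cn).

Lemma analytic_near_dist f (e : C) : analytic0 f -> 0 < e ->
  \forall z \near (0 : Cn), `|f z - f 0| < e.
Proof.
move=> [a fa] e0; rewrite (expansion0 fa).
have [r [B r0 [dom H]]] := (expansionP _ _).1 fa.
have B0 := dominated_ge0 dom.
have Be : 0 < B + e by rewrite ltr_wpDl.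
pose q := e / (2 * (B + e)).
have q0 : 0 < q by rewrite divr_gt0 // mulr_gt0.
have q1 : q < 1.
  rewrite ltr_pdivrMr ?mulr_gt0 // mul1r.
  apply: (@le_lt_trans _ _ (B + e)); first by rewrite lerDr.
  by rewrite ltr_pMl // ltr1n.
have Bq : B * q < e.
  rewrite /q mulrA ltr_pdivrMr ?mulr_gt0 // mulrC ltr_pM2l //.
  apply: (@lt_le_trans _ _ (B + e)); first by rewrite ltrDl.
  by rewrite ler_peMl ?(ltW Be) // ler1n.
apply/near_boxP; exists (q * r); first by rewrite mulr_gt0.
move=> z zr; apply: le_lt_trans Bq.
have := H q z 1%N (ltW q0) q1; rewrite add0r box_sum1 expr1; apply=> i.
exact: ltW.
Qed.

Lemma analytic_near_neq0 f : analytic0 f -> f 0 != 0 ->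
  \forall z \near (0 : Cn), f z != 0.
Proof.
move=> Hf f0; have f0' : 0 < `|f 0| by rewrite normr_gt0.
apply: near0S2 (analytic_near_dist Hf f0') (near0W (fun=> I)) => z lt _.
by apply: contraTneq lt => ->; rewrite sub0r normrN ltxx.
Qed.

Lemma analytic_inv f : analytic0 f -> f 0 != 0 -> analytic0 (fun z => (f z)^-1).
Proof. by move=> [a fa]; exact: expansion_inv fa. Qed.

Lemma analytic_poly (p : {poly C}) i : analytic0 (fun z : Cn => p.[z 0 i]).
Proof.
have : analytic0 (fun z : Cn => \sum_(j < size p) p`_j * z 0 i ^+ j).
  by apply: analytic_sum => j _; apply/analyticZ/analyticX/analytic_coord.
by apply: eq_analytic => z; rewrite horner_coef.
Qed.

Lemma analytic_det p (B : Cn -> 'M[C]_p) :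
  (forall i j, analytic0 (fun z => B z i j)) -> analytic0 (fun z => \det (B z)).
Proof.
move=> HB; rewrite /determinant; apply: analytic_sum => s _.
by apply: analyticZ; apply: analytic_prod => i _; exact: HB.
Qed.

(** The adjugate is used instead of the inverse matrix because its entries are
    polynomials in those of [B]. *)
Lemma analytic_adj p (B : Cn -> 'M[C]_p) :
  (forall i j, analytic0 (fun z => B z i j)) ->
  forall i j, analytic0 (fun z => (\adj (B z)) i j).
Proof.
move=> HB i j.
have : analytic0 (fun z => (-1) ^+ (j + i) * \det (row' j (col' i (B z)))).
  apply: analyticZ; apply: analytic_det => k l.
  by apply: eq_analytic (HB (lift j k) (lift i l)) => z; rewrite !mxE.
by apply: eq_analytic => z; rewrite mxE.
Qed.

Definition axis (i : 'I_n) (x : C) : Cn := \row_j (if j == i then x else 0).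

Lemma monomial_axis i x (al : multiindex n) :
  monomial (axis i x) al = if al == powm i (al i) then x ^+ al i else 0.
Proof.
case: eqP => [e|ne].
  rewrite /monomial (bigD1 i) //= mxE eqxx big1 ?mulr1 // => j ji.
  by rewrite e ffunE (negbTE ji) expr0.
have [j ji alj] : exists2 j, j != i & al j != 0%N.
  apply/exists_inP; rewrite -negb_forall_in; apply/negP => /forall_inP H.
  apply: ne; apply/ffunP => j; rewrite ffunE; case: eqP => [-> //|/eqP ji].
  exact/eqP/(H j ji).
rewrite /monomial (bigD1 j) //= mxE (negbTE ji) expr0n (negbTE alj).
by rewrite mul0r.
Qed.

Lemma powm_inj (i : 'I_n) : injective (powm i).
Proof. by move=> c d /ffunP /(_ i); rewrite !ffunE eqxx. Qed.

Lemma powm_in_box (i : 'I_n) c N : (c < N)%N -> powm i c \in box n N.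
Proof. by move=> lt; apply: mem_box_deg; rewrite deg_powm. Qed.

Lemma box_sum_axis i (a : multiindex n -> C) x N :
  box_sum a (axis i x) N = \sum_(c < N) a (powm i c) * x ^+ c.
Proof.
rewrite box_sumE; under eq_bigr do rewrite monomial_axis.
pose s := [seq powm i c | c <- iota 0 N].
have us : uniq s by rewrite map_inj_uniq ?iota_uniq //; exact: powm_inj.
have ps : perm_eq s [seq al <- box n N | al \in s].
  apply: uniq_perm; rewrite ?filter_uniq ?box_uniq // => al.
  rewrite mem_filter; case als: (al \in s) => //=.
  case/mapP: als => c; rewrite mem_iota add0n => /andP[_ ?] ->.
  by rewrite powm_in_box.
rewrite (bigID [in s]) /= [X in _ + X]big_seq_cond [X in _ + X]big1 => [|al].
  rewrite addr0 -big_filter -(perm_big _ ps) big_map /= -{1}(subn0 N).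
  rewrite -/(index_iota 0 N) big_mkord; apply: eq_bigr => c _.
  by rewrite ffunE eqxx eqxx.
move=> /andP[alN als]; case: eqP => [e|_]; last by rewrite mulr0.
case/negP: als; rewrite e; apply: map_f; rewrite mem_iota add0n /=.
by move: alN; rewrite mem_box => /forallP.
Qed.

Lemma axis_remainder f a i : has_expansion f 0 a ->
  exists r B, [/\ 0 < r, 0 <= B & forall x N, `|x| < r ->
  `|f (axis i x) - \sum_(c < N) a (powm i c) * x ^+ c| <= B * `|x| ^+ N / r ^+ N].
Proof.
move=> /expansionP[r [B r0 [dom H]]]; exists r, B; split=> //.
  exact: dominated_ge0 dom.
move=> x N xr.
have := H (`|x| / r) (axis i x) N; rewrite add0r box_sum_axis => le.
rewrite -mulrA -expr_div_n; apply: le.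
- by rewrite divr_ge0 // ltW.
- by rewrite ltr_pdivrMr // mul1r.
- move=> j; rewrite divfK ?gt_eqF // mxE; case: ifP => // _.
  by rewrite normr0.
Qed.

Definition flat1 (e : nat) (phi : C -> C) : Prop :=
  exists r B : C, [/\ 0 < r, 0 <= B &
    forall x, `|x| < r -> `|phi x| <= B * `|x| ^+ e].

Lemma axis_flat f a i e : has_expansion f 0 a ->
  (forall c, (c < e)%N -> a (powm i c) = 0) -> flat1 e (fun x => f (axis i x)).
Proof.
move=> fa a0; have [r [B [r0 B0 H]]] := axis_remainder i fa.
exists r, (B / r ^+ e); split=> //.
  by rewrite divr_ge0 // exprn_ge0 // ltW.
move=> x xr; have := H x e xr.
rewrite big1 => [|c _]; last by rewrite a0 // mul0r.
by rewrite subr0 mulrAC.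
Qed.

Lemma axis_near (P : Cn -> Prop) i : (\forall z \near (0 : Cn), P z) ->
  exists2 r, 0 < r & forall x, `|x| < r -> P (axis i x).
Proof.
move=> /near_boxP[r r0 H]; exists r => // x xr; apply: H => j.
by rewrite mxE; case: ifP => // _; rewrite normr0.
Qed.

Lemma flat1_0 f i : analytic0 f -> flat1 0 (fun x => f (axis i x)).
Proof. by move=> [a fa]; apply: axis_flat fa _. Qed.

Lemma flat1D e phi psi : flat1 e phi -> flat1 e psi ->
  flat1 e (fun x => phi x + psi x).
Proof.
move=> [r [A [r0 A0 HA]]] [s [B [s0 B0 HB]]].
have [t [t0 tr ts]] := common_radius r0 s0.
exists t, (A + B); split; rewrite ?addr_ge0 // => x xt.
apply: le_trans (ler_normD _ _) _; rewrite mulrDl.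
by apply: lerD; [apply: HA; exact: lt_le_trans tr|
                 apply: HB; exact: lt_le_trans ts].
Qed.

Lemma flat1M d e phi psi : flat1 d phi -> flat1 e psi ->
  flat1 (d + e) (fun x => phi x * psi x).
Proof.
move=> [r [A [r0 A0 HA]]] [s [B [s0 B0 HB]]].
have [t [t0 tr ts]] := common_radius r0 s0.
exists t, (A * B); split; rewrite ?mulr_ge0 // => x xt.
rewrite normrM exprD mulrACA.
by apply: ler_pM => //; [apply: HA; exact: lt_le_trans tr|
                 apply: HB; exact: lt_le_trans ts].
Qed.

Lemma flat1_zero e : flat1 e (fun=> 0).
Proof. by exists 1, 0; split=> // x _; rewrite normr0 mul0r. Qed.

Lemma eq_flat1 e phi psi : phi =1 psi -> flat1 e phi -> flat1 e psi.
Proof. by move=> /funext ->. Qed.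

Lemma flat1_sum e (I : Type) (s : seq I) (phi : I -> C -> C) :
  (forall i, flat1 e (phi i)) -> flat1 e (fun x => \sum_(i <- s) phi i x).
Proof.
move=> H; elim: s => [|i s IH].
  by apply: eq_flat1 (flat1_zero e) => x; rewrite big_nil.
by apply: eq_flat1 (flat1D (H i) IH) => x; rewrite big_cons.
Qed.

Lemma flat1_near_eq e phi psi (r : C) : 0 < r ->
  (forall x, `|x| < r -> phi x = psi x) -> flat1 e phi -> flat1 e psi.
Proof.
move=> r0 E [s [B [s0 B0 H]]]; have [t [t0 tr ts]] := common_radius r0 s0.
exists t, B; split=> // x xt; rewrite -E; last exact: lt_le_trans tr.
by apply: H; exact: lt_le_trans ts.
Qed.

Lemma poly_root_factor (p : {poly C}) : p != 0 ->
  exists m (q : {poly C}),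
    [/\ p = q * 'X^m, q.[0] != 0 & (m < size p)%N].
Proof.
move=> p0; have [m [q]] := multiplicity_XsubC p 0.
rewrite p0 /= => nr pE; exists m, q; rewrite subr0 in pE; split=> //.
have q0 : q != 0 by apply: contraNneq nr => ->; rewrite root0.
rewrite pE size_mulXn // -[ltnLHS]addn0 ltn_add2l.
by rewrite lt0n size_poly_eq0.
Qed.

(** Factor out the largest power of the variable; what remains is nonzero at
    [0], so [p] cannot be smaller than its lowest term. *)
Lemma flat1_poly e (p : {poly C}) : (size p <= e)%N ->
  flat1 e (fun x => p.[x]) -> p = 0.
Proof.
move=> sp [r [B [r0 B0 H]]]; apply/eqP/negPn/negP => p0.
have [m [q [pE q0 ltm]]] := poly_root_factor p0.
have [q1 q1E] : exists q1, q - q.[0]%:P = q1 * ('X - 0%:P).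
  by apply/factor_theorem; rewrite /root !hornerE subrr.
pose K := \sum_(i < size q1) `|q1`_i|.
have K0 : 0 <= K by rewrite sumr_ge0.
have qK x : `|x| <= 1 -> `|q.[0]| <= `|q.[x]| + K * `|x|.
  move=> x1; have : q.[0] = q.[x] - q1.[x] * x.
    have := congr1 (horner^~ x) q1E; rewrite !hornerE subr0 => <-.
    by rewrite opprB addrCA subrr addr0.
  move=> ->; apply: le_trans (ler_normB _ _) _; rewrite lerD2l normrM.
  rewrite ler_wpM2r // horner_coef; apply: le_trans (ler_norm_sum _ _ _) _.
  apply: ler_sum => j _; rewrite normrM ler_piMr // normrX exprn_ile1 //.
have BK : 0 < B + K + 1 by rewrite ltr_wpDl // addr_ge0.
have e0 : 0 < `|q.[0]| / (B + K + 1) by rewrite divr_gt0 ?normr_gt0.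
have [t [t0 tr t1]] := common_radius r0 ltr01.
have [u [u0 ut ue]] := common_radius t0 e0.
have u2 : 0 < u / 2 by rewrite divr_gt0.
have uu : u / 2 < u by rewrite ltr_pdivrMr // ltr_pMr // ltr1n.
have nu : `|u / 2| = u / 2 by rewrite gtr0_norm.
have qu : `|q.[u / 2]| <= B * (u / 2).
  have := H (u / 2); rewrite nu => /(_ (lt_le_trans uu (le_trans ut tr))).
  rewrite pE hornerM hornerXn normrM normrX nu.
  rewrite -(subnK sp) => le.
  have u21 : u / 2 <= 1 by exact: le_trans (ltW uu) (le_trans ut t1).
  have : `|q.[u / 2]| * (u / 2) ^+ m <= B * (u / 2) ^+ m.+1.
    apply: le_trans le _; rewrite ler_wpM2l // ler_wiXn2l // ?(ltW u2) //.
    by rewrite (leq_trans ltm) // subnK.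
  by rewrite exprS mulrA ler_pM2r // exprn_gt0.
have := qK (u / 2); rewrite nu => /(_ (le_trans (ltW uu) (le_trans ut t1))).
move=> le; suff: `|q.[0]| < `|q.[0]| by rewrite ltxx.
apply: le_lt_trans le _.
have lt : (B + K + 1) * (u / 2) < `|q.[0]|.
  rewrite mulrC -ltr_pdivlMr //; exact: lt_le_trans uu ue.
apply: le_lt_trans lt; rewrite !mulrDl -addrA; apply: lerD => //.
by rewrite lerDl mul1r ltW.
Qed.

End LocalRing.

(** * Germ ideals of finite multiplicity *)

Section GermIdeal.
Variables (R : realType) (n : nat).
Local Notation C := R[i].
Local Notation Cn := 'rV[C]_n.
Variable F : Cn -> Cn.
Implicit Types (f g u : Cn -> C).

Local Notation ideal := (in_germ_ideal F).

Lemma ideal_near_eq f g : (\forall z \near (0 : Cn), f z = g z) ->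
  ideal f -> ideal g.
Proof.
move=> fg [h Hh E]; exists h => //; apply: near0S2 fg E => z <-; exact.
Qed.

Lemma eq_ideal f g : f =1 g -> ideal f -> ideal g.
Proof. by move=> /funext ->. Qed.

Lemma ideal_gen j : ideal (fun z => F z 0 j).
Proof.
exists (fun i _ => (i == j)%:R); first by move=> i; exact: analytic_cst.
apply: near0W => z; rewrite (bigD1 j) //= eqxx mul1r big1 ?addr0 //.
by move=> i /negbTE ->; rewrite mul0r.
Qed.

Lemma ideal_zero : ideal (fun=> 0).
Proof.
exists (fun _ _ => 0); first by move=> i; exact: analytic_cst.
by apply: near0W => z; rewrite big1 // => i _; rewrite mul0r.
Qed.

Lemma idealD f g : ideal f -> ideal g -> ideal (fun z => f z + g z).
Proof.
move=> [h Hh E] [h' Hh' E']; exists (fun j z => h j z + h' j z).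
  by move=> j; exact: analyticD (Hh j) (Hh' j).
apply: near0S2 E E' => z -> ->; rewrite -big_split.
by apply: eq_bigr => j _; rewrite mulrDl.
Qed.

Lemma idealM u f : analytic0 u -> ideal f -> ideal (fun z => u z * f z).
Proof.
move=> Hu [h Hh E]; exists (fun j z => u z * h j z).
  by move=> j; exact: analyticM Hu (Hh j).
apply: near0S2 E (near0W (fun=> I)) => z -> _; rewrite mulr_sumr.
by apply: eq_bigr => j _; rewrite mulrA.
Qed.

Lemma idealZ c f : ideal f -> ideal (fun z => c * f z).
Proof. exact/idealM/analytic_cst. Qed.

Lemma idealB f g : ideal f -> ideal g -> ideal (fun z => f z - g z).
Proof.
move=> Hf /(idealZ (-1)) /(idealD Hf); apply: eq_ideal => z.
by rewrite mulN1r.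
Qed.

Lemma ideal_sum (I : Type) (s : seq I) (f : I -> Cn -> C) :
  (forall i, ideal (f i)) -> ideal (fun z => \sum_(i <- s) f i z).
Proof.
move=> H; elim: s => [|i s IH].
  by apply: eq_ideal ideal_zero => z; rewrite big_nil.
by apply: eq_ideal (idealD (H i) IH) => z; rewrite big_cons.
Qed.

Lemma multiplicity_coordinates k : multiplicity F k ->
  exists (b : 'I_k -> Cn -> C) (cd : (Cn -> C) -> 'rV[C]_k),
    [/\ forall i, analytic0 (b i),
        forall f, analytic0 f -> ideal (fun z => f z - \sum_i cd f 0 i * b i z) &
        forall c : 'rV[C]_k, ideal (fun z => \sum_i c 0 i * b i z) -> c = 0].
Proof.
move=> [b Hb H].
have /(@choice _ _ _)[cd Hcd] : forall f, exists c : 'rV[C]_k, analytic0 f ->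
    ideal (fun z => f z - \sum_i c 0 i * b i z).
  move=> f; have [/H[c [Hc _]]|nf] := pselect (analytic0 f); first by exists c.
  by exists 0.
exists b, cd; split=> // c Hc.
have [c0 [_ uniq0]] := H _ (analytic_cst n (0 : C)).
have E1 : c0 = 0.
  apply: uniq0; apply: eq_ideal ideal_zero => z.
  by rewrite big1 ?subrr // => i _; rewrite mxE mul0r.
have E2 : c0 = - c.
  apply: uniq0; apply: eq_ideal Hc => z.
  rewrite sub0r -sumrN; apply: eq_bigr => i _.
  by rewrite mxE mulNr opprK.
by rewrite -[c]opprK -E2 E1 oppr0.
Qed.

(** The coordinates of [k.+1] germs form a matrix with more rows than
    columns. *)
Lemma multiplicity_dependent k (g : 'I_k.+1 -> Cn -> C) : multiplicity F k ->
  (forall i, analytic0 (g i)) ->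
  exists2 c : 'rV[C]_k.+1, c != 0 & ideal (fun z => \sum_i c 0 i * g i z).
Proof.
move=> /multiplicity_coordinates[b [cd [Hb Hcd _]]] Hg.
pose M := \matrix_(i < k.+1, l < k) cd (g i) 0 l.
have kN0 : kermx M != 0.
  rewrite kermx_eq0 /row_free; apply: contraTneq (rank_leq_col M) => ->.
  by rewrite ltnn.
pose c := nz_row (kermx M).
have c0 : c != 0 by rewrite nz_row_eq0.
have cM : c *m M = 0 by apply/sub_kermxP; exact: nz_row_sub.
exists c => //.
have S : ideal (fun z => \sum_i c 0 i *
    (g i z - \sum_l cd (g i) 0 l * b l z)).
  by apply: ideal_sum => i; apply/idealZ/Hcd.
apply: eq_ideal S => z.
under eq_bigr do rewrite mulrBr; rewrite sumrB -[RHS]subr0; congr (_ - _).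
under eq_bigr do rewrite mulr_sumr.
rewrite exchange_big big1 //= => l _.
have e : \sum_i c 0 i * cd (g i) 0 l = 0.
  have := congr1 (fun v : 'rV[C]_k => v 0 l) cM; rewrite !mxE => e.
  by rewrite -[RHS]e; apply: eq_bigr => i _; rewrite mxE.
by under eq_bigr do rewrite mulrA; rewrite -mulr_suml e mul0r.
Qed.

(** Expressing the basis in the [g j] and the [g j] in the basis factors the
    identity of size [k] through size [e]. *)
Lemma multiplicity_span k e (g : 'I_e -> Cn -> C) : multiplicity F k ->
  (forall i, analytic0 (g i)) ->
  (forall f, analytic0 f -> exists c : 'I_e -> C,
     ideal (fun z => f z - \sum_j c j * g j z)) ->
  (k <= e)%N.
Proof.
move=> /multiplicity_coordinates[b [cd [Hb Hcd cd0]]] Hg span.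
have /(@choice _ _ _)[c Hc] : forall i, exists c : 'I_e -> C,
    ideal (fun z => b i z - \sum_j c j * g j z) by move=> i; exact: span.
pose X := \matrix_(i < k, j < e) c i j.
pose Y := \matrix_(j < e, l < k) cd (g j) 0 l.
have XY : X *m Y = 1%:M.
  apply/row_matrixP => i; apply/eqP; rewrite -subr_eq0; apply/eqP; apply: cd0.
  have S : ideal (fun z => \sum_j (- c i j) * (g j z - \sum_l cd (g j) 0 l * b l z)).
    by apply: ideal_sum => j; apply/idealZ/Hcd.
  apply: eq_ideal (idealB S (Hc i)) => z.
  have T : \sum_l (X *m Y) i l * b l z =
      \sum_j c i j * \sum_l cd (g j) 0 l * b l z.
    under [RHS]eq_bigr do rewrite mulr_sumr.
    rewrite exchange_big; apply: eq_bigr => l _ /=; rewrite mxE mulr_suml.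
    by apply: eq_bigr => j _; rewrite !mxE mulrA.
  have U : \sum_l (1%:M : 'M[C]_k) i l * b l z = b i z.
    rewrite (bigD1 i) //= mxE eqxx mul1r big1 ?addr0 // => l li.
    by rewrite mxE eq_sym (negbTE li) mul0r.
  have W : \sum_j (- c i j) * (g j z - \sum_l cd (g j) 0 l * b l z) =
      \sum_l (X *m Y) i l * b l z - \sum_j c i j * g j z.
    by rewrite T -sumrB; apply: eq_bigr => j _; rewrite mulNr mulrBr opprB.
  transitivity (\sum_l (X *m Y) i l * b l z -
                \sum_l (1%:M : 'M[C]_k) i l * b l z).
    by rewrite W U opprB addrA subrK.
  by rewrite -sumrB; apply: eq_bigr => l _; rewrite !mxE mulrBl.
have := mxrankM_maxl X Y; rewrite XY mxrank1 => /leq_trans; apply.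
exact: rank_leq_col.
Qed.

(** The powers [1, z_i, ..., z_i ^ k] are dependent modulo the ideal.  The
    relation is a polynomial in [z_i], that is, a power of [z_i] at most the [k]-th
    times a unit of the local ring. *)
Lemma coordinate_power_ideal k i : multiplicity F k ->
  ideal (fun z => z 0 i ^+ k).
Proof.
move=> Fk.
have [c c0 Hc] := multiplicity_dependent (g := fun j z => z 0 i ^+ j) Fk
  (fun j => analyticX j (analytic_coord R i)).
pose p : {poly C} := \poly_(j < k.+1) (if insub j is Some l then c 0 l else 0).
have pj (j : 'I_k.+1) : p`_j = c 0 j.
  by rewrite coef_poly ltn_ord valK.
have p0 : p != 0.
  apply: contra c0 => /eqP p0; apply/eqP/rowP => j.
  by rewrite -pj p0 coef0 mxE.
have Hp : ideal (fun z => p.[z 0 i]).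
  apply: eq_ideal Hc => z; rewrite (horner_coef_wide _ (size_poly _ _)).
  by apply: eq_bigr => j _; rewrite pj.
have [m [q [pE q0 ltm]]] := poly_root_factor p0.
have Hq := analytic_poly q i.
have q0' : (fun z : Cn => q.[z 0 i]) 0 != 0 by rewrite mxE.
have Hm : ideal (fun z => z 0 i ^+ m).
  apply: ideal_near_eq (idealM (analytic_inv Hq q0') Hp).
  apply: near0S2 (analytic_near_neq0 Hq q0') (near0W (fun=> I)) => z qz _.
  by rewrite pE hornerM hornerXn mulrA mulVf // mul1r.
have mk : (m <= k)%N by rewrite -ltnS (leq_trans ltm) // size_poly.
apply: eq_ideal (idealM (analyticX (k - m) (analytic_coord R i)) Hm) => z.
by rewrite -exprD subnK.
Qed.

(** A monomial of degree at least [n * k] is divisible by some [z_i ^ k], and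
    division treats all terms of [f] at once.  This makes a jet of finite order
    sufficient to decide membership in the ideal. *)
Lemma high_order_ideal k f a : (0 < n)%N -> multiplicity F k ->
  has_expansion f 0 a ->
  (forall al : multiindex n, (deg al < n * k)%N -> a al = 0) -> ideal f.
Proof.
move=> n0 Fk fa a0.
have [h [Hh _ E]] := expansion_division (fun=> k) fa.
have S : ideal (fun z => \sum_i h i z * z 0 i ^+ k).
  apply: ideal_sum => i; apply: idealM (Hh i) _.
  exact: coordinate_power_ideal.
apply: ideal_near_eq S; apply: near0S2 E (near0W (fun=> I)) => z -> _.
rewrite [X in _ + X]big_seq [X in _ + X]big1 ?addr0 // => al.
rewrite mem_below => /forallP lt; rewrite a0 ?mul0r //.
have : (\sum_(i < n) (al i).+1 <= n * k)%N.
  rewrite -[n in (n * k)%N]card_ord -sum_nat_const.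
  by apply: leq_sum => i _.
apply: leq_trans; under eq_bigr do rewrite -addn1.
by rewrite big_split /= sum1_card card_ord -/(deg al) -[ltnLHS]addn0 ltn_add2l.
Qed.

End GermIdeal.

(** * Ideals generated by powers of the coordinates up to units *)

Section AxisOrder.
Variables (R : realType) (n : nat).
Local Notation C := R[i].
Local Notation Cn := 'rV[C]_n.
Implicit Types (f g u : Cn -> C).

Lemma ideal_axis (F : Cn -> Cn) w e f :
  (forall i, flat1 e (fun x => F (axis w x) 0 i)) -> in_germ_ideal F f ->
  flat1 e (fun x => f (axis w x)).
Proof.
move=> HF [h Hh /(axis_near w)[r r0 E]].
have S : flat1 e (fun x => \sum_i h i (axis w x) * F (axis w x) 0 i).
  by apply: flat1_sum => i; apply: (flat1M (d := 0)) (flat1_0 w (Hh i)) (HF i).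
by apply: flat1_near_eq r0 _ S => x /E ->.
Qed.

Variables (F : Cn -> Cn) (w : 'I_n) (e : nat).
Variable a : 'I_n -> multiindex n -> C.
Hypothesis e0 : (0 < e)%N.
Hypothesis Fa : forall i, has_expansion (fun z => F z 0 i) 0 (a i).
Hypothesis a0 : forall i c, (c < e)%N -> a i (powm w c) = 0.

Let kap (j : 'I_n) : nat := if j == w then e else 1%N.

Hypothesis leading_unit : \matrix_(i, j) a i (powm j (kap j)) \in unitmx.

(** Here [kap] is [1] off [w] and [e] at [w], so the remainder of the division
    is a polynomial of degree below [e] in the single variable [z_w]. *)
Lemma below_axis : perm_eq (below kap) [seq powm w c | c <- iota 0 e].
Proof.
apply: uniq_perm; first exact: below_uniq.
  by rewrite map_inj_uniq ?iota_uniq //; exact: powm_inj.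
move=> al; rewrite mem_below; apply/forallP/mapP => [H|[c]].
  exists (al w); last first.
    apply/ffunP => j; rewrite ffunE; case: eqP => [-> //|/eqP /negbTE jw].
    by have := H j; rewrite /kap jw ltnS leqn0 => /eqP.
  by rewrite mem_iota add0n; have := H w; rewrite /kap eqxx.
rewrite mem_iota add0n => /andP[_ lt] -> j; rewrite ffunE /kap.
by case: eqP.
Qed.

Lemma sum_below_axis (b : multiindex n -> C) z :
  \sum_(al <- below kap) b al * monomial z al =
  \sum_(c < e) b (powm w c) * z 0 w ^+ c.
Proof.
rewrite (perm_big _ below_axis) big_map -{1}(subn0 e) -/(index_iota 0 e).
by rewrite big_mkord; apply: eq_bigr => c _; rewrite monomial_powm.
Qed.

(** Dividing the components by the [z_j ^ kap j] leaves no remainder, because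
    they have order [e] on the axis.  So [F = B Y] with [Y] the vector of the
    [z_j ^ kap j] and [B 0] invertible, and [Y = B^-1 F] near [0]. *)
Lemma leading_power_ideal j : in_germ_ideal F (fun z => z 0 j ^+ kap j).
Proof.
have kap0 i : (0 < kap i)%N by rewrite /kap; case: ifP.
have /(@choice _ _ _)[h Hh] : forall i, exists h : 'I_n -> Cn -> C,
    [/\ forall j, analytic0 (h j),
        forall j, h j 0 = a i (powm j (kap j)) &
        \forall z \near (0 : Cn), F z 0 i = \sum_j h j z * z 0 j ^+ kap j].
  move=> i; have [h [Hh h0 E]] := expansion_division kap (Fa i).
  exists h; split=> //; first exact: h0.
  apply: near0S2 E (near0W (fun=> I)) => z -> _.
  rewrite sum_below_axis [X in _ + X]big1 ?addr0 // => c _.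
  by rewrite a0 ?mul0r.
pose B z : 'M[C]_n := \matrix_(i, l) h i l z.
have HB i l : analytic0 (fun z => B z i l).
  have [Ha _ _] := Hh i.
  by apply: eq_analytic (Ha l) => z; rewrite mxE.
have B0 : \det (B 0) != 0.
  rewrite -unitfE -[_ \is a _]/(B 0 \in unitmx).
  rewrite (_ : B 0 = \matrix_(i, l) a i (powm l (kap l))) //.
  by apply/matrixP => i l; rewrite !mxE; have [_ -> _] := Hh i.
have HdB := analytic_det HB.
have HadjB := analytic_adj HB.
exists (fun i z => (\det (B z))^-1 * (\adj (B z)) j i).
  move=> i; exact: analyticM (analytic_inv HdB B0) (HadjB j i).
have near_all : \forall z \near (0 : Cn), forall i,
    F z 0 i = \sum_l h i l z * z 0 l ^+ kap l.
  apply: (@filter_forall _ _ _ (nbhs (0 : Cn)) _) => i.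
  by have [_ _ E] := Hh i.
apply: near0S2 near_all (analytic_near_neq0 HdB B0) => z FE dB.
under eq_bigr do rewrite FE -mulrA.
rewrite -mulr_sumr; apply: (mulfI dB); rewrite mulrA mulfV // mul1r.
under [RHS]eq_bigr do rewrite mulr_sumr.
rewrite exchange_big /=.
have := mul_adj_mx (B z) => adjE.
have E l : \sum_i (\adj (B z)) j i * h i l z = (\det (B z)) *+ (j == l).
  have := congr1 (fun X : 'M[C]_n => X j l) adjE; rewrite !mxE => <-.
  by apply: eq_bigr => i _; congr (_ * _); rewrite [RHS]mxE.
rewrite (eq_bigr (fun l => \det (B z) *+ (j == l) * z 0 l ^+ kap l)).
  rewrite (bigD1 j) //= eqxx mulr1n big1 ?addr0 // => l lj.
  by rewrite eq_sym (negbTE lj) mulr0n mul0r.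
by move=> l _; rewrite -E mulr_suml; apply: eq_bigr => i _; rewrite mulrA.
Qed.

Lemma ideal_axis_remainder f b : has_expansion f 0 b ->
  in_germ_ideal F (fun z => f z - \sum_(c < e) b (powm w c) * z 0 w ^+ c).
Proof.
move=> fb; have [h [Hh _ E]] := expansion_division kap fb.
have S : in_germ_ideal F (fun z => \sum_i h i z * z 0 i ^+ kap i).
  by apply: ideal_sum => i; exact: idealM (Hh i) (leading_power_ideal i).
apply: ideal_near_eq S; apply: near0S2 E (near0W (fun=> I)) => z -> _.
by rewrite sum_below_axis addrK.
Qed.

(** On the axis every element of the ideal is [O(x ^ e)], like the generators,
    whereas the combination restricts to a polynomial of degree below [e]. *)
Lemma axis_powers_independent (c : 'rV[C]_e) :
  in_germ_ideal F (fun z => \sum_i c 0 i * z 0 w ^+ i) -> c = 0.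
Proof.
move=> Hc.
have HF i : flat1 e (fun x => F (axis w x) 0 i).
  by apply: axis_flat (Fa i) _; exact: a0.
pose p : {poly C} := \poly_(j < e) (if insub j is Some l then c 0 l else 0).
have pj (j : 'I_e) : p`_j = c 0 j by rewrite coef_poly ltn_ord valK.
suff p0 : p = 0 by apply/rowP => j; rewrite -pj p0 coef0 mxE.
apply: (flat1_poly (size_poly _ _)); apply: eq_flat1 (ideal_axis HF Hc) => x.
rewrite (horner_coef_wide _ (size_poly _ _)).
by apply: eq_bigr => j _; rewrite pj mxE eqxx.
Qed.

Lemma multiplicity_axis : multiplicity F e.
Proof.
exists (fun i z => z 0 w ^+ i) => [i|g [b gb]].
  exact/analyticX/analytic_coord.
have E := ideal_axis_remainder gb.
exists (\row_i b (powm w i)); split.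
  apply: eq_ideal E => z; congr (_ - _).
  by apply: eq_bigr => i _; rewrite mxE.
move=> c Hc; apply/esym/eqP; rewrite -subr_eq0; apply/eqP.
apply: axis_powers_independent; apply: eq_ideal (idealB E Hc) => z.
rewrite opprB [LHS]addrC addrA subrK -sumrB.
by apply: eq_bigr => i _; rewrite !mxE mulrBl.
Qed.

End AxisOrder.

(** * Two maps with a common jet *)

Section Comparison.
Variables (R : realType) (n : nat).
Local Notation C := R[i].
Local Notation V := 'rV[R]_n.
Local Notation Cn := 'rV[C]_n.

Lemma near_flat_pullback p (u : V -> 'rV[C]_p) (P : 'rV[C]_p -> Prop) :
  (forall j, flat 1 (fun t => u t 0 j)) ->
  (\forall z \near (0 : 'rV[C]_p), P z) -> \forall t \near (0 : V), P (u t).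
Proof.
move=> Hu /near_boxP[r r0 HP]; have [B B0 HB] := flat_uniform Hu.
have rE := ge0_complexE (ltW r0).
have r'0 : 0 < complex.Re r by rewrite -ltcR -rE.
have rB : 0 < complex.Re r / (B + 1) by rewrite divr_gt0 // ltr_wpDl.
apply: near0S2 HB (near0_norm n rB) => t le lt; apply: HP => j.
apply: le_lt_trans (le j) _; rewrite rE ltcR expr1.
move: lt; rewrite ltr_pdivlMr ?ltr_wpDl // mulrC; apply: le_lt_trans.
by rewrite ler_wpM2r // lerDl.
Qed.

Variables (D k : nat) (H G : V -> Cn) (A A' : 'M[C]_n) (F F0 : Cn -> Cn).
Variables (w : 'I_n) (a : 'I_n -> multiindex n -> C).
Hypothesis Dk : (n * k < D)%N.
Hypothesis kD : (k < D)%N.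
Hypothesis FH : formal_coordinates D H A.
Hypothesis FG : formal_coordinates D G A'.
Hypothesis analyticF : forall i, analytic0 (fun z => F z 0 i).
Hypothesis Fk : multiplicity F k.
Hypothesis F0a : forall i, has_expansion (fun z => F0 z 0 i) 0 (a i).
Hypothesis FHG : \forall t \near (0 : V), F (H t) = F0 (G t).

Let D0 : (0 < D)%N. Proof. exact: leq_ltn_trans kD. Qed.

Let analyticF0 i : analytic0 (fun z => F0 z 0 i). Proof. by exists (a i). Qed.

Lemma jet_pullback (K : V -> Cn) B f : formal_coordinates D K B ->
  analytic0 f -> jet D 0 (fun t => f (K t)).
Proof.
move=> HK [b fb]; apply: jet_analytic D0 fb _ _ => //.
exact: (coordinate_jet HK).
Qed.

(** Holomorphic germs correspond to each other when they have the same jet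
    along [K] and [L]; this transports the quotient of the local ring by one ideal
    to the quotient by the other. *)
Lemma lift_germ (K L : V -> Cn) B B' f : formal_coordinates D K B ->
  formal_coordinates D L B' -> analytic0 f ->
  exists2 g, analytic0 g & flat D (fun t => g (L t) - f (K t)).
Proof.
move=> HK HL Hf; exact: (jet_liftable HL (jet_pullback HK Hf)).
Qed.

Lemma lift_germs (I : Type) (K L : V -> Cn) B B' (f : I -> Cn -> C) :
  formal_coordinates D K B -> formal_coordinates D L B' ->
  (forall i, analytic0 (f i)) ->
  exists g : I -> Cn -> C, (forall i, analytic0 (g i)) /\
    forall i, flat D (fun t => g i (L t) - f i (K t)).
Proof.
move=> HK HL Hf; have /(@choice _ _ _)[g Hg] : forall i, exists g,
    analytic0 g /\ flat D (fun t => g (L t) - f i (K t)).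
  by move=> i; have [g Hg Fg] := lift_germ HK HL (Hf i); exists g.
by exists g; split=> i; have [] := Hg i.
Qed.

Lemma flat_sum d (I : Type) (s : seq I) (phi : I -> V -> C) :
  (forall i, flat d (phi i)) -> flat d (fun t => \sum_(i <- s) phi i t).
Proof.
move=> Hphi; elim: s => [|i s IH].
  by apply: eq_flat (flat_zero _ _ d) => t; rewrite big_nil.
by apply: eq_flat (flatD (Hphi i) IH) => t; rewrite big_cons.
Qed.

(** The lifts of [1, z_w, ..., z_w ^ k] are dependent modulo the ideal of [F],
    which has codimension [k].  The relation, transported from [H] to [G], puts a
    nonzero polynomial in [z_w] of degree at most [k] into the ideal of [F0], up to
    terms of order [D].  If [F0] were [O(x ^ k.+1)] on the axis, so would be this
    polynomial. *)
Lemma axis_order_le : ~ forall i c, (c <= k)%N -> a i (powm w c) = 0.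
Proof.
move=> a0.
have [g [Hg Fg]] := lift_germs FG FH
  (fun j : 'I_k.+1 => analyticX j (analytic_coord R w)).
have [c cN0 [h Hh E]] := multiplicity_dependent Fk Hg.
have [h' [Hh' Fh']] := lift_germs FH FG Hh.
pose u (z : Cn) := \sum_j c 0 j * z 0 w ^+ j - \sum_i h' i z * F0 z 0 i.
have Hsum : analytic0 (fun z : Cn => \sum_j c 0 j * z 0 w ^+ j).
  by apply: analytic_sum => j _; apply/analyticZ/analyticX/analytic_coord.
have Hsum' : analytic0 (fun z : Cn => \sum_i h' i z * F0 z 0 i).
  by apply: analytic_sum => i _; exact: analyticM (Hh' i) (analyticF0 i).
have [b ub] := analyticB Hsum Hsum'.
have Fu : flat D (fun t => u (G t)).
  have S1 : flat D (fun t =>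
      \sum_j - c 0 j * (g j (H t) - G t 0 w ^+ j)).
    by apply: flat_sum => j; exact: flatZ (Fg j).
  have S2 : flat D (fun t =>
      \sum_i (h' i (G t) - h i (H t)) * F0 (G t) 0 i).
    apply: flat_sum => i; rewrite -[D]addn0; apply: flatM (Fh' i) _.
    exact: jet_flat0 (jet_pullback FG (analyticF0 i)).
  have E' := near_flat_pullback (coordinate_flat D0 FH) E.
  apply: flat_near_eq (flatB S1 S2); apply: near0S2 E' FHG => t Et FHGt.
  rewrite /u; rewrite FHGt in Et.
  have -> : \sum_j - c 0 j * (g j (H t) - G t 0 w ^+ j) =
     \sum_j c 0 j * G t 0 w ^+ j - \sum_j c 0 j * g j (H t).
    by rewrite -sumrB; apply: eq_bigr => j _; ring.
  have -> : \sum_i (h' i (G t) - h i (H t)) * F0 (G t) 0 i =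
     \sum_i h' i (G t) * F0 (G t) 0 i - \sum_i h i (H t) * F0 (G t) 0 i.
    by rewrite -sumrB; apply: eq_bigr => j _; ring.
  by rewrite Et; ring.
have b0 := flat_pullback_coef D0 FG ub Fu.
have Fu1 : flat1 k.+1 (fun x => u (axis w x)).
  by apply: axis_flat ub _ => l lt; apply: b0; rewrite deg_powm (leq_trans lt).
have Fs : flat1 k.+1 (fun x => \sum_i h' i (axis w x) * F0 (axis w x) 0 i).
  apply: flat1_sum => i; apply: (flat1M (d := 0)) (flat1_0 w (Hh' i)) _.
  by apply: axis_flat (F0a i) _ => l lt; exact: a0.
pose p : {poly C} := \poly_(j < k.+1) (if insub j is Some l then c 0 l else 0).
have pj (j : 'I_k.+1) : p`_j = c 0 j by rewrite coef_poly ltn_ord valK.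
suff p0 : p = 0.
  by move: cN0; rewrite (_ : c = 0) ?eqxx //; apply/rowP => j; rewrite -pj p0 coef0 mxE.
apply: (flat1_poly (size_poly _ _)); apply: eq_flat1 (flat1D Fu1 Fs) => x.
rewrite /u subrK (horner_coef_wide _ (size_poly _ _)).
by apply: eq_bigr => j _; rewrite pj mxE eqxx.
Qed.

Section LeadingPowers.
Variable e : nat.
Let kap (j : 'I_n) : nat := if j == w then e else 1%N.
Hypothesis e0 : (0 < e)%N.
Hypothesis a0 : forall i c, (c < e)%N -> a i (powm w c) = 0.
Hypothesis leading_unit : \matrix_(i, j) a i (powm j (kap j)) \in unitmx.

(** The lifts of [1, z_w, ..., z_w ^ e.-1] span the quotient by the ideal of
    [F]: a germ is transported to [G], reduced there modulo the ideal of [F0] and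
    transported back.  The error has order [D], hence lies in the ideal of [F] by
    [high_order_ideal]. *)
Lemma axis_order_ge : (k <= e)%N.
Proof.
have [g [Hg Fg]] := lift_germs FG FH
  (fun j : 'I_e => analyticX j (analytic_coord R w)).
apply: (multiplicity_span Fk Hg) => f Hf.
have [f' [b fb] Ff] := lift_germ FH FG Hf.
have [h' Hh' E] := ideal_axis_remainder e0 F0a a0 leading_unit fb.
have [h [Hh Fh]] := lift_germs FG FH Hh'.
exists (fun c => b (powm w c)).
have Hb1 : analytic0 (fun z : Cn => \sum_(c < e) b (powm w c) * g c z).
  by apply: analytic_sum => j _; exact: analyticZ (Hg j).
have Hb2 : analytic0 (fun z : Cn => \sum_i h i z * F z 0 i).
  by apply: analytic_sum => i _; exact: analyticM (Hh i) (analyticF i).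
pose v (z : Cn) := f z - \sum_(c < e) b (powm w c) * g c z - \sum_i h i z * F z 0 i.
have Hv : analytic0 v := analyticB (analyticB Hf Hb1) Hb2.
have Fv : flat D (fun t => v (H t)).
  have S1 : flat D (fun t =>
      \sum_(c < e) b (powm w c) * (g c (H t) - G t 0 w ^+ c)).
    by apply: flat_sum => j; exact: flatZ (Fg j).
  have S2 : flat D (fun t =>
      \sum_i (h i (H t) - h' i (G t)) * F0 (G t) 0 i).
    apply: flat_sum => i; rewrite -[D]addn0; apply: flatM (Fh i) _.
    exact: jet_flat0 (jet_pullback FG (analyticF0 i)).
  have E' := near_flat_pullback (coordinate_flat D0 FG) E.
  apply: flat_near_eq (flatZ (-1) (flatD (flatD S1 S2) Ff)).
  apply: near0S2 E' FHG => t Et FHGt.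
  rewrite /v FHGt.
  have -> : \sum_(c < e) b (powm w c) * (g c (H t) - G t 0 w ^+ c) =
     \sum_(c < e) b (powm w c) * g c (H t) -
     \sum_(c < e) b (powm w c) * G t 0 w ^+ c.
    by rewrite -sumrB; apply: eq_bigr => j _; ring.
  have -> : \sum_i (h i (H t) - h' i (G t)) * F0 (G t) 0 i =
     \sum_i h i (H t) * F0 (G t) 0 i - \sum_i h' i (G t) * F0 (G t) 0 i.
    by rewrite -sumrB; apply: eq_bigr => j _; ring.
  by rewrite -Et; ring.
have [bv vb] := Hv.
have bv0 := flat_pullback_coef D0 FH vb Fv.
have n0 : (0 < n)%N by apply: leq_ltn_trans (ltn_ord w).
have Iv : in_germ_ideal F v.
  apply: (high_order_ideal n0 Fk vb) => al lt; apply: bv0.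
  exact: ltn_trans Dk.
have Ih : in_germ_ideal F (fun z => \sum_i h i z * F z 0 i).
  by apply: ideal_sum => i; exact: idealM (Hh i) (ideal_gen F i).
by apply: eq_ideal (idealD Iv Ih) => z; rewrite /v subrK.
Qed.

Lemma axis_order_eq : e = k.
Proof.
apply/eqP; rewrite eqn_leq axis_order_ge andbT leqNgt; apply/negP => ke.
apply: axis_order_le => i c ck; apply: a0; exact: leq_ltn_trans ke.
Qed.

End LeadingPowers.
End Comparison.

(** * Taylor expansion of regular maps *)

Section Taylor.
Variables (R : realType) (n q : nat).
Local Notation C := R[i].
Local Notation V := 'rV[R]_n.
Local Notation W := 'rV[R]_q.
Implicit Types (f : V -> W) (phi : V -> R).

Definition real_poly (l : seq (R * multiindex n)) (x : V) : R :=
  \sum_(ca <- l) ca.1 * monomial x ca.2.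

(** The inductive step of Taylor's formula integrates partial derivatives, for
    which explicit real coefficients are needed. *)
Lemma jet_real_part D d (psi : V -> C) : jet D d psi ->
  exists l, flat D (fun t => (complex.Re (psi t) - real_poly l t)%:C%C).
Proof.
move=> Hpsi; suff [l Hl] : exists l : seq (C * multiindex n),
    flat D (fun t => psi t - \sum_(ca <- l) ca.1 * monomial (cvec t) ca.2).
  exists [seq (complex.Re ca.1, ca.2) | ca <- l].
  have [B HB] := Hl; exists B; apply: near0S2 HB (near0W (fun=> I)) => t le _.
  apply: le_trans le; rewrite norm_real_complex.
  suff <- : complex.Re (psi t - \sum_(ca <- l) ca.1 * monomial (cvec t) ca.2)
      = complex.Re (psi t) - real_poly [seq (complex.Re ca.1, ca.2) | ca <- l] t.
    exact: normc_ge_Re.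
  rewrite raddfB /=; congr (_ - _); rewrite /real_poly big_map.
  elim: (l) => [|ca l' IH]; first by rewrite !big_nil.
  rewrite !big_cons raddfD /= IH; congr (_ + _).
  rewrite (_ : monomial (cvec t) ca.2 = (monomial t ca.2)%:C%C).
    by case: ca.1 => x y /=; rewrite mulr0 subr0.
  rewrite /monomial rmorph_prod; apply: eq_bigr => i _.
  by rewrite mxE rmorphXn.
elim: Hpsi => {d psi} [d psi H|d al _|d c f g _ [l1 H1] _ [l2 H2]].
- by exists [::]; apply: eq_flat H => t; rewrite big_nil subr0.
- exists [:: (1, al)]; apply: eq_flat (flat_zero _ _ D) => t.
  by rewrite big_seq1 mul1r subrr.
- exists ([seq (c * ca.1, ca.2) | ca <- l1] ++ l2).
  apply: eq_flat (flatD (flatZ c H1) H2) => t.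
  rewrite big_cat big_map /= mulrBr mulr_sumr opprD addrACA.
  by congr (_ + (- _ - _)); apply: eq_bigr => ca _; rewrite mulrA.
Qed.

Lemma jet_real_poly D l : jet D 0 (fun t : V => (real_poly l t)%:C%C).
Proof.
suff : jet D 0 (fun t : V => \sum_(ca <- l) (ca.1)%:C%C * monomial (cvec t) ca.2).
  apply: eq_jet => t; rewrite /real_poly rmorph_sum /=.
  apply: eq_bigr => ca _; rewrite rmorphM /= /monomial rmorph_prod.
  by congr (_ * _); apply: eq_bigr => i _; rewrite mxE rmorphXn.
by apply: jet_sum => ca _; exact/jetZ/jet_mono.
Qed.

Lemma directional_derive f (j : 'I_q) (p v : V) : differentiable f p ->
  ('D_v f p) 0 j = \sum_i v 0 i * ('D_(delta_mx 0 i) f p) 0 j.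
Proof.
move=> df; rewrite deriveE // {1}(row_sum_delta v) linear_sum summxE.
by apply: eq_bigr => i _; rewrite linearZ mxE -deriveE.
Qed.

Lemma line_derive f (j : 'I_q) (x : V) (s : R) : differentiable f (s *: x) ->
  is_derive s (1 : R) (fun s => f (s *: x) 0 j)
    (\sum_i x 0 i * ('D_(delta_mx 0 i) f (s *: x)) 0 j).
Proof.
move=> df.
have E : (fun h : R => h^-1 *: (((fun s => f (s *: x) 0 j) \o shift s) (h *: 1)
             - f (s *: x) 0 j)) =
         (fun h : R => h^-1 *: (((fun y => f y 0 j) \o shift (s *: x)) (h *: x)
             - f (s *: x) 0 j)).
  apply/funext => h /=; congr (_ *: (f _ 0 j - _)).
  by rewrite scalerDl /GRing.scale /= mulr1.
have dfx : derivable f (s *: x) x by exact: diff_derivable.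
split; first by rewrite /derivable E; apply: (derivable_mxP _ _ _).1 dfx 0 j.
rewrite /derive E -/(derive (fun y => f y 0 j) (s *: x) x).
have := congr1 (fun M : W => M 0 j) (derive_mx dfx); rewrite mxE => <-.
exact: directional_derive.
Qed.

(** The primitive, zero at [s = 0], of [s |-> \sum_i x_i l_i (s x)]: if the
    polynomials [l_i] approximate the partial derivatives of a function, its value at
    [s = 1] approximates the increment of the function from [0] to [x]. *)
Definition radial_poly (l : 'I_n -> seq (R * multiindex n)) (x : V) : {poly R} :=
  \sum_i \sum_(ca <- l i)
    (ca.1 * x 0 i * monomial x ca.2 / (deg ca.2).+1%:R) *: 'X^((deg ca.2).+1).

Lemma radial_poly_deriv l x s :
  (radial_poly l x)^`().[s] = \sum_i x 0 i * real_poly (l i) (s *: x).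
Proof.
rewrite /radial_poly raddf_sum /= horner_sum; apply: eq_bigr => i _.
rewrite raddf_sum /= horner_sum /real_poly mulr_sumr; apply: eq_bigr => ca _.
rewrite derivZ derivXn hornerZ hornerMn hornerXn /= -[X in _ * X = _]mulr_natr.
have -> : monomial (s *: x) ca.2 = s ^+ deg ca.2 * monomial x ca.2.
  rewrite /deg -prodrXr -big_split; apply: eq_bigr => k _ /=.
  by rewrite mxE exprMn.
have : (deg ca.2).+1%:R != 0 :> R by rewrite pnatr_eq0.
move: (_.+1%:R) => N N0; field.
exact: N0.
Qed.

Lemma radial_poly1 l x : (radial_poly l x).[1] =
  \sum_i real_poly [seq (ca.1 / (deg ca.2).+1%:R, addm (powm i 1) ca.2) | ca <- l i] x.
Proof.
rewrite /radial_poly horner_sum; apply: eq_bigr => i _.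
rewrite horner_sum /real_poly big_map; apply: eq_bigr => ca _ /=.
rewrite hornerZ hornerXn expr1n mulr1 monomialD monomial_powm expr1.
by rewrite -!mulrA; congr (_ * _); rewrite mulrA mulrC.
Qed.

Lemma radial_poly0 l x : (radial_poly l x).[0] = 0.
Proof.
rewrite /radial_poly horner_sum big1 // => i _.
by rewrite horner_sum big1 // => ca _; rewrite hornerZ hornerXn expr0n mulr0.
Qed.

(** Taylor's formula by induction on [d]: along the ray [s |-> s x] the
    function minus [radial_poly] of the expansions of its first partial derivatives
    has derivative [O(|x| ^ d.+1)], and the mean value theorem applies. *)
Lemma Ck_jet d (U : set V) f : (\forall x \near (0 : V), U x) ->
  Ck d U f -> forall j, jet d 0 (fun x => (f x 0 j)%:C%C).
Proof.
move=> U0; elim: d f => [|d IH] f /=.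
  move=> Hf j; apply: jet_flat; exists (`|f 0 0 j| + 1).
  have /Hf/cvgrPdist_lt/(_ 1 ltr01) := nbhs_singleton U0.
  move=> H; apply: near0S2 H (near0W (fun=> I)) => x lt _.
  rewrite norm_real_complex expr0 mulr1 lecR.
  rewrite -[f x 0 j](subKr (f 0 0 j)); apply: le_trans (ler_normB _ _) _.
  rewrite lerD2l; apply: le_trans (ltW lt).
  by have := coord_le_norm (f 0 - f x) j; rewrite !mxE.
move=> [df Hf] j.
have /(@choice _ _ _)[l Hl] : forall i, exists l : seq (R * multiindex n),
    flat d (fun t => (('D_(delta_mx 0 i) f t) 0 j - real_poly l t)%:C%C).
  move=> i; have [l Hl] := jet_real_part (IH _ (Hf (delta_mx 0 i)) j).
  by exists l.
have [B B0 HB] := flat_uniform Hl.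
pose Q x := f 0 0 j + (radial_poly l x).[1].
have Fl : flat d.+1 (fun t => (f t 0 j - Q t)%:C%C).
  exists (B *+ n).
  have /nbhs_ballP[e /= e0 He] : \forall t \near (0 : V), U t /\
      forall i, `|('D_(delta_mx 0 i) f t) 0 j - real_poly (l i) t| <= B * `|t| ^+ d.
    apply: near0S2 U0 HB => t Ut le; split=> // i.
    by have := le i; rewrite norm_real_complex lecR.
  apply: near0S2 (near0_norm n e0) (near0W (fun=> I)) => x xe _.
  rewrite norm_real_complex lecR.
  have sxe (s : R) : 0 <= s <= 1 -> U (s *: x) /\ forall i,
      `|('D_(delta_mx 0 i) f (s *: x)) 0 j - real_poly (l i) (s *: x)|
         <= B * `|x| ^+ d.
    move=> /andP[s0 s1].
    have nsx : `|s *: x| <= `|x| by rewrite normrZ ger0_norm // ler_piMl.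
    have : ball (0 : V) e (s *: x).
      by rewrite mx_norm_ball /ball_ /= sub0r normrN (le_lt_trans nsx).
    move=> /He[Us H]; split=> // i; apply: le_trans (H i) _.
    by rewrite ler_wpM2l // lerXn2r // nnegrE.
  pose h s := f (s *: x) 0 j - (radial_poly l x).[s].
  pose dh s := \sum_i x 0 i * (('D_(delta_mx 0 i) f (s *: x)) 0 j -
                 real_poly (l i) (s *: x)).
  have hd (s : R) : 0 <= s <= 1 -> is_derive s (1 : R) h (dh s).
    move=> /sxe[Us _]; have D1 := line_derive j (df _ Us).
    have D2 := is_derive_poly (radial_poly l x) s.
    rewrite radial_poly_deriv in D2.
    have -> : dh s = \sum_i x 0 i * ('D_(delta_mx 0 i) f (s *: x)) 0 j -
        \sum_i x 0 i * real_poly (l i) (s *: x).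
      by rewrite -sumrB; apply: eq_bigr => i _; rewrite mulrBr.
    exact: (is_deriveB D1 D2).
  have [c] : exists2 c, c \in `]0, 1[%R & h 1 - h 0 = dh c * (1 - 0).
    apply: MVT => // [s|].
      by rewrite in_itv /= => /andP[s0 s1]; apply: hd; rewrite !ltW.
    apply: derivable_within_continuous => s; rewrite in_itv /= => s01.
    by have [] := hd s s01.
  rewrite in_itv /= => /andP[c0 c1].
  rewrite subr0 mulr1 /h scale1r scale0r radial_poly0 subr0 => E.
  rewrite /Q opprD addrA addrAC E.
  apply: le_trans (ler_norm_sum _ _ _) _.
  have -> : B *+ n * `|x| ^+ d.+1 = \sum_(i < n) `|x| * (B * `|x| ^+ d).
    by rewrite sumr_const card_ord mulrnAl exprS mulrCA.
  apply: ler_sum => i _; rewrite normrM ler_pM ?coord_le_norm //.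
  have c01 : 0 <= c <= 1 by rewrite !ltW.
  by have [_] := sxe c c01.
have JQ : jet d.+1 0 (fun t => (Q t)%:C%C).
  suff : jet d.+1 0 (fun t => (f 0 0 j)%:C%C + \sum_i (real_poly
      [seq (ca.1 / (deg ca.2).+1%:R, addm (powm i 1) ca.2) | ca <- l i] t)%:C%C).
    by apply: eq_jet => t; rewrite /Q radial_poly1 rmorphD rmorph_sum.
  apply: jetD; first exact: jet_cst.
  by apply: jet_sum => i _; exact: jet_real_poly.
apply: eq_jet (jetD (jet_flat 0 Fl) JQ) => t.
by rewrite rmorphB subrK.
Qed.

Lemma regular_jet (reg : regularity) D (U : set V) f : (0 < D)%N ->
  (\forall x \near (0 : V), U x) -> regular_on reg U f ->
  forall j, jet D 0 (fun x => (f x 0 j)%:C%C).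
Proof.
move=> D0 U0; case: reg => /= Hf j; first exact: Ck_jet U0 (Hf D) j.
by apply: jet_real_analytic D0 _; apply: Hf; exact: nbhs_singleton.
Qed.

End Taylor.

(** * The model map *)

Section Indices.
Variable m : nat.

(** The source of the model has the coordinates [(z, w, x)], in this order,
    with [w] standing for the conjugate of [z_1]; in the target the coordinate [z_n]
    comes last.  Vectors of the two kinds are built by [scase] and [tcase]. *)
Definition iw : 'I_m.+2 := lift ord0 ord0.
Definition ix (al : 'I_m) : 'I_m.+2 := lift ord0 (lift ord0 al).

Definition scase T (z w : T) (x : 'I_m -> T) (k : 'I_m.+2) : T :=
  if unlift ord0 k is Some k' then
    if unlift ord0 k' is Some al then x al else w
  else z.

Definition tcase T (z : T) (x : 'I_m -> T) (p : T) (k : 'I_m.+2) : T :=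
  if unlift ord0 k is Some k' then
    if unlift ord_max k' is Some al then x al else p
  else z.

Lemma midE al : mid al = lift ord0 (lift (ord_max : 'I_m.+1) al).
Proof. by apply: val_inj; rewrite /= /bump [(m <= al)%N]leqNgt ltn_ord. Qed.

Lemma ord_maxE : (ord_max : 'I_m.+2) = lift ord0 (ord_max : 'I_m.+1).
Proof. exact: val_inj. Qed.

Lemma source_ind (P : 'I_m.+2 -> Prop) : P ord0 -> P iw ->
  (forall al, P (ix al)) -> forall k, P k.
Proof.
move=> P0 Pw Px k; have [k' ->|-> //] := unliftP ord0 k.
by have [al ->|->] := unliftP ord0 k'; [exact: Px|exact: Pw].
Qed.

Lemma target_ind (P : 'I_m.+2 -> Prop) : P ord0 -> (forall al, P (mid al)) ->
  P ord_max -> forall k, P k.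
Proof.
move=> P0 Px Pp k; have [k' ->|-> //] := unliftP ord0 k.
have [al ->|->] := unliftP ord_max k'; last by rewrite -ord_maxE.
by rewrite -midE.
Qed.

Variables (T : Type) (z w p : T) (x : 'I_m -> T).

Lemma scase0 : scase z w x ord0 = z.
Proof. by rewrite /scase unlift_none. Qed.

Lemma scasew : scase z w x iw = w.
Proof. by rewrite /scase liftK unlift_none. Qed.

Lemma scasex al : scase z w x (ix al) = x al.
Proof. by rewrite /scase !liftK. Qed.

Lemma tcase0 : tcase z x p ord0 = z.
Proof. by rewrite /tcase unlift_none. Qed.

Lemma tcase_mid al : tcase z x p (mid al) = x al.
Proof. by rewrite midE /tcase !liftK. Qed.

Lemma tcase_max : tcase z x p ord_max = p.
Proof. by rewrite ord_maxE /tcase liftK unlift_none. Qed.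

Definition scaseE := (scase0, scasew, scasex).
Definition tcaseE := (tcase0, tcase_mid, tcase_max).

End Indices.

Lemma mid_neq_max m (al : 'I_m) : (mid al == ord_max) = false.
Proof.
by rewrite midE ord_maxE (inj_eq lift_inj) eq_sym (negbTE (neq_lift _ _)).
Qed.

Lemma iw_neq0 m : (iw m == ord0) = false. Proof. by []. Qed.
Lemma ix_neq0 m (al : 'I_m) : (ix al == ord0) = false. Proof. by []. Qed.
Lemma ix_neqw m (al : 'I_m) : (ix al == iw m) = false.
Proof. by rewrite /ix /iw (inj_eq lift_inj). Qed.
Lemma ix_eq m (al be : 'I_m) : (ix al == ix be) = (al == be).
Proof. by rewrite /ix !(inj_eq lift_inj). Qed.

Definition source_eqE := (iw_neq0, ix_neq0, ix_neqw, ix_eq).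

(** The source coordinate that leads each component of the model: [z] for
    [z_1], [x] for [z'], and [w] for [z_n], through the first nonzero power of [w] in
    [rho (0, w, 0)]. *)
Definition src m : 'I_m.+2 -> 'I_m.+2 := tcase ord0 (@ix m) (iw m).

Lemma src_inj m : injective (@src m).
Proof.
move=> i j; elim/target_ind: i => [|al|]; elim/target_ind: j => [|be|];
rewrite /src !tcaseE // => /eqP; rewrite ?source_eqE // ?[_ == ix _]eq_sym ?[_ == iw _]eq_sym ?source_eqE //.
by move=> /eqP ->.
Qed.

Lemma unitmx_kernel (K : fieldType) n (A : 'M[K]_n) :
  (forall v : 'rV[K]_n, v *m A = 0 -> v = 0) -> A \in unitmx.
Proof.
move=> H; rewrite -row_free_unit -kermx_eq0; apply/eqP/row_matrixP => i.
by rewrite row0; apply: H; rewrite -row_mul mulmx_ker row0.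
Qed.

Section Model.
Variables (R : realType) (m : nat).
Local Notation C := R[i].
Local Notation Cn := 'rV[R[i]]_m.+2.
Local Notation V := 'rV[R]_m.+2.
Implicit Types (f : C -> C -> 'rV[C]_m -> C).

Definition complexified f (v : Cn) : C :=
  f (v 0 ord0) (v 0 (iw m)) (\row_al v 0 (ix al)).

Lemma jointE f : joint f = complexified f.
Proof.
apply/funext => v; rewrite /joint /complexified !mxE.
congr (f (v _ _) (v _ _) _); try exact: val_inj.
by apply/rowP => al; rewrite !mxE; congr (v _ _); exact: val_inj.
Qed.

Lemma complexified_axis f x : complexified f (axis (iw m) x) = f 0 x 0.
Proof.
rewrite /complexified !mxE eqxx /=; congr (f _ _ _).
by apply/rowP => al; rewrite !mxE source_eqE.
Qed.

(** This map is defined and real linear on the whole space; on [M] it inverts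
    the model, so the inverse of the diffeomorphism is regular. *)
Definition to_source (z : Cn) : Cn :=
  \row_k scase (z 0 ord0) (z 0 ord0)^* (fun al => (complex.Re (z 0 (mid al)))%:C%C) k.

Lemma restrE f z : restr f z = complexified f (to_source z).
Proof.
rewrite /restr /complexified !mxE !scaseE; congr (f _ _ _).
by apply/rowP => al; rewrite !mxE scaseE.
Qed.

Definition real_source (v : Cn) : Prop :=
  v 0 (iw m) = (v 0 ord0)^* /\ forall al, complex.Im (v 0 (ix al)) = 0.

Lemma to_source_real z : real_source (to_source z).
Proof. by split=> [|al]; rewrite !mxE !scaseE. Qed.

(** Real coordinates on [real_source]: real and imaginary part of [z], and
    [x]. *)
Definition param (t : V) : Cn :=
  \row_k scase ((t 0 ord0)%:C%C + 'i * (t 0 (iw m))%:C%C)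
               ((t 0 ord0)%:C%C - 'i * (t 0 (iw m))%:C%C)
               (fun al => (t 0 (ix al))%:C%C) k.

Definition param_mx : 'M[C]_m.+2 :=
  \matrix_(j, k) scase ((j == ord0)%:R + 'i * (j == iw m)%:R)
               ((j == ord0)%:R - 'i * (j == iw m)%:R)
               (fun al => (j == ix al)%:R) k.

Lemma sum_delta (v : Cn) k : \sum_j v 0 j * (j == k)%:R = v 0 k.
Proof.
rewrite (bigD1 k) //= eqxx mulr1 big1 ?addr0 // => j /negbTE ->.
by rewrite mulr0.
Qed.

Lemma param_mxE (v : Cn) k : (v *m param_mx) 0 k =
  scase (v 0 ord0 + 'i * v 0 (iw m)) (v 0 ord0 - 'i * v 0 (iw m))
        (fun al => v 0 (ix al)) k.
Proof.
rewrite mxE; elim/source_ind: k => [||al]; under eq_bigr do rewrite mxE scaseE;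
rewrite scaseE.
- under eq_bigr do rewrite mulrDr mulrCA.
  by rewrite big_split /= -mulr_sumr !sum_delta.
- under eq_bigr do rewrite mulrBr mulrCA.
  by rewrite sumrB -mulr_sumr !sum_delta.
- exact: sum_delta.
Qed.

Lemma paramE t : param t = cvec t *m param_mx.
Proof.
apply/rowP => k; rewrite param_mxE mxE.
by elim/source_ind: k => [||al]; rewrite !scaseE !mxE.
Qed.

Lemma i_neq0 : 'i != 0 :> C. Proof. exact: neq0Ci. Qed.

Lemma param_mx_unit : param_mx \in unitmx.
Proof.
apply: unitmx_kernel => v /rowP H.
have H0 := H ord0; have Hw := H (iw m).
rewrite param_mxE scaseE mxE in H0; rewrite param_mxE scaseE mxE in Hw.
have v0 : v 0 ord0 = 0.
  apply: (@mulfI _ 2); first by rewrite pnatr_eq0.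
  rewrite mulr0 mulr_natl mulr2n -[RHS](addr0 0) -{1}H0 -Hw.
  by rewrite addrACA subrr addr0.
have vw : v 0 (iw m) = 0.
  by move: H0; rewrite v0 add0r => /eqP; rewrite mulf_eq0 (negbTE i_neq0) => /eqP.
apply/rowP => k; rewrite [RHS]mxE; elim/source_ind: k => [//|//|al].
by have := H (ix al); rewrite param_mxE scaseE mxE.
Qed.

Lemma conj_real (x : R) : (x%:C%C : C)^* = x%:C%C.
Proof. by apply: conj_Creal; apply/complex_realP; exists x. Qed.

Lemma param_real t : real_source (param t).
Proof.
split=> [|al]; rewrite !mxE !scaseE //.
by rewrite rmorphD rmorphM /= !conj_real conjCi mulNr.
Qed.

Lemma jet_linear D (n p : nat) (A : 'M[C]_(n, p)) j :
  jet D 1 (fun t : 'rV[R]_n => (cvec t *m A) 0 j).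
Proof.
suff : jet D 1 (fun t : 'rV[R]_n => \sum_i A i j * (t 0 i)%:C%C).
  by apply: eq_jet => t; rewrite mxE; apply: eq_bigr => i _; rewrite mxE mulrC.
by apply: jet_sum => i _; apply/jetZ/jet_coord.
Qed.

Lemma param_coordinates D : formal_coordinates D param param_mx.
Proof.
split=> [|j]; first exact: param_mx_unit.
have := same_leading_refl (jet_linear D param_mx j).
by apply: eq_same_leading => t; rewrite ?paramE.
Qed.

Variables (rho : C -> C -> 'rV[C]_m -> C).
Variables (r : 'I_m -> C -> C -> 'rV[C]_m -> C).

(** The defining functions of [M] with the conjugate of [z_1] made an
    independent variable: a holomorphic map that sends [real_source] to [M]. *)
Definition model (v : Cn) : Cn :=
  \row_j tcase (v 0 ord0)
    (fun al => v 0 (ix al) + 'i * complexified (r al) v)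
    (complexified rho v) j.

Variables (arho : multiindex m.+2 -> C) (ar : 'I_m -> multiindex m.+2 -> C).
Hypothesis rhoE : has_expansion (complexified rho) 0 arho.
Hypothesis rE : forall al, has_expansion (complexified (r al)) 0 (ar al).
Hypothesis arho1 : forall be : multiindex m.+2, (deg be <= 1)%N -> arho be = 0.
Hypothesis ar1 : forall al (be : multiindex m.+2),
  (deg be <= 1)%N -> ar al be = 0.
Hypothesis ar_axis : forall al c, ar al (powm (iw m) c) = 0.

Definition model_coef (j : 'I_m.+2) (be : multiindex m.+2) : C :=
  tcase (mono_coef (powm ord0 1) 1 be)
    (fun al => mono_coef (powm (ix al) 1) 1 be + 'i * ar al be)
    (arho be) j.

Lemma expansion_coord n (i : 'I_n) :
  has_expansion (fun z : 'rV[C]_n => z 0 i) 0 (mono_coef (powm i 1) 1).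
Proof.
by apply: expansion_mono => z; rewrite monomial_powm expr1 mul1r.
Qed.

Lemma expansionZ n (c : C) (g : 'rV[C]_n -> C) a : has_expansion g 0 a ->
  has_expansion (fun z => c * g z) 0 (fun al => c * a al).
Proof.
move=> ga; apply: eq_expansion (expansionM (expansion_cst n c) ga) => [//|al].
by rewrite cprod_mono zerom_le subm0.
Qed.

Lemma model_expansion j :
  has_expansion (fun v => model v 0 j) 0 (model_coef j).
Proof.
elim/target_ind: j => [|al|].
- apply: eq_expansion (expansion_coord ord0) => [v|be]; first by rewrite mxE tcaseE.
  by rewrite /model_coef tcaseE.
- apply: eq_expansion (expansionD (expansion_coord (ix al)) (expansionZ 'i (rE al))) => [v|be].
    by rewrite mxE tcaseE.
  by rewrite /model_coef tcaseE.
- apply: eq_expansion rhoE => [v|be]; first by rewrite mxE tcaseE.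
  by rewrite /model_coef tcaseE.
Qed.

Lemma model_coef0 j : model_coef j (zerom _) = 0.
Proof.
have mono0 k : mono_coef (powm k 1) 1 (zerom m.+2) = 0 :> C.
  rewrite /mono_coef; case: eqP => // /(congr1 (@deg _)).
  by rewrite deg_zerom deg_powm.
rewrite /model_coef; elim/target_ind: j => [|al|]; rewrite !tcaseE ?mono0 //.
  by rewrite ar1 ?deg_zerom // mulr0 addr0.
by rewrite arho1 // deg_zerom.
Qed.

Lemma powm_eq n (i k : 'I_n) c d : (0 < c)%N ->
  (powm i c == powm k d) = (i == k) && (c == d).
Proof.
move=> c0; apply/eqP/andP => [e|[/eqP -> /eqP -> //]].
have := congr1 (fun f : multiindex n => f i) e; rewrite !ffunE eqxx.
case: (eqVneq i k) => [_ -> //|_ c00]; by rewrite c00 in c0.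
Qed.

Lemma model_coef_axis j c : model_coef j (powm (iw m) c) =
  if j == ord_max then arho (powm (iw m) c) else 0.
Proof.
have mono0 k : k != iw m -> mono_coef (powm k 1) 1 (powm (iw m) c) = 0 :> C.
  move=> kw; rewrite /mono_coef [_ == _]eq_sym powm_eq //.
  by rewrite (negbTE kw).
rewrite /model_coef; elim/target_ind: j => [|al|]; rewrite !tcaseE.
- by rewrite mono0.
- rewrite mono0 ?source_eqE // ar_axis mulr0 addr0 mid_neq_max //.
- by rewrite eqxx.
Qed.

(** Without affine terms in [r] and [rho], these leading coefficients form a
    permutation matrix up to one nonzero factor. *)
Lemma model_leading_unit e : (0 < e)%N -> arho (powm (iw m) e) != 0 ->
  \matrix_(i, j) model_coef i (powm j (if j == iw m then e else 1%N)) \in unitmx.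
Proof.
move=> e0 ae.
pose d : 'rV[C]_m.+2 := \row_i (if i == ord_max then arho (powm (iw m) e) else 1).
have -> : \matrix_(i, j) model_coef i (powm j (if j == iw m then e else 1%N)) =
    diag_mx d *m perm_mx (perm (@src_inj m)).
  apply/matrixP => i j; rewrite mul_diag_mx !mxE permE.
  have [->|jw] := eqVneq j (iw m).
    rewrite model_coef_axis; case: (eqVneq i ord_max) => [->|ne].
      by rewrite /src tcaseE eqxx mulr1.
    rewrite mul1r (_ : src i == iw m = false) //; apply/negbTE.
    have <- : src ord_max = iw m by rewrite /src tcaseE.
    by rewrite (inj_eq (@src_inj m)).
  have mono1 k : mono_coef (powm k 1) 1 (powm j 1) = (k == j)%:R :> C.
    rewrite /mono_coef powm_eq // andbT eq_sym; by case: eqP.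
  rewrite /model_coef /src; elim/target_ind: i => [|al|]; rewrite !tcaseE.
  - by rewrite mono1 mul1r.
  - rewrite mono1 ar1 ?deg_powm // mulr0 addr0 mid_neq_max mul1r //.
  - by rewrite arho1 ?deg_powm // eq_sym (negbTE jw) mulr0.
rewrite unitmx_mul unitmx_perm andbT unitmxE det_diag unitfE.
apply/prodf_neq0 => i _; rewrite mxE; case: ifP => // _; exact: oner_neq0.
Qed.

End Model.

(** * Real and imaginary parts of jets *)

Section JetTools.
Variables (R : realType) (n : nat).
Local Notation C := R[i].
Local Notation V := 'rV[R]_n.
Implicit Types (phi psi : V -> C).

Lemma flat_at0 d phi : (0 < d)%N -> flat d phi -> phi 0 = 0.
Proof.
move=> d0 [B /nbhs_singleton]; rewrite normr0 expr0n gtn_eqF // mulr0.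
by rewrite normr_le0 => /eqP.
Qed.

Lemma norm_conj (x : C) : `|x^*| = `|x|.
Proof. exact: norm_conjC. Qed.

Lemma jet_conj D d phi : jet D d phi -> jet D d (fun t => (phi t)^*).
Proof.
elim=> {d phi} [d phi [B HB]|d al le|d c phi psi _ IH1 _ IH2].
- apply: jet_flat; exists B; apply: near0S2 HB (near0W (fun=> I)) => t le _.
  by rewrite norm_conj.
- apply: eq_jet (jet_mono R D le) => t; rewrite /monomial rmorph_prod.
  by apply: eq_bigr => i _; rewrite rmorphXn mxE /= conj_real.
- by apply: eq_jet (jet_lin (c^*) IH1 IH2) => t; rewrite rmorphD rmorphM.
Qed.

Lemma ReE (x : C) : (complex.Re x)%:C%C = 2^-1 * (x + x^*).
Proof. by rewrite ReJ_add mulrC. Qed.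

Lemma ImE (x : C) : (complex.Im x)%:C%C = 2^-1 * (- 'i * (x - x^*)).
Proof.
rewrite ImJ_sub complexiE -[(x^*)%C]/(x^*).
by move: x^* 'i => y i; ring.
Qed.

Lemma jet_Re D d phi : jet D d phi -> jet D d (fun t => (complex.Re (phi t))%:C%C).
Proof.
move=> H; apply: eq_jet (jetZ 2^-1 (jetD H (jet_conj H))) => t.
by rewrite ReE.
Qed.

Lemma jet_Im D d phi : jet D d phi -> jet D d (fun t => (complex.Im (phi t))%:C%C).
Proof.
move=> H; apply: eq_jet (jetZ 2^-1 (jetZ (- 'i) (jetB H (jet_conj H)))) => t.
by rewrite ImE.
Qed.

Lemma complex_ReIm (x : C) : x = (complex.Re x)%:C%C + 'i * (complex.Im x)%:C%C.
Proof. by rewrite {1}[x]complexE complexiE. Qed.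

Lemma unrealifyK (z : 'rV[C]_n) : unrealify (realify z) = z.
Proof.
apply/rowP => j; rewrite mxE /realify row_mxKl row_mxKr !mxE.
by case: (z 0 j).
Qed.

Lemma realifyK (v : 'rV[R]_(n + n)) : realify (unrealify v) = v.
Proof.
rewrite /realify -[RHS]hsubmxK; congr row_mx;
by apply/rowP => j; rewrite !mxE.
Qed.

Lemma realify_nbhs (U : set 'rV[C]_n) : (\forall z \near (0 : 'rV[C]_n), U z) ->
  \forall v \near (0 : 'rV[R]_(n + n)), (@realify R n @` U) v.
Proof.
move=> /near_boxP[r r0 HU]; have rE := ge0_complexE (ltW r0).
have r2 : 0 < complex.Re r / 2 by rewrite divr_gt0 // -ltcR -rE.
apply: near0S2 (near0_norm _ r2) (near0W (fun=> I)) => v vr _.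
exists (unrealify v); last exact: realifyK.
apply: HU => j; apply: le_lt_trans (normc_le_ReIm _) _.
rewrite rE ltcR mxE /= [ltRHS]splitr !mxE; apply: ltrD.
  exact: le_lt_trans (coord_le_norm v _) vr.
exact: le_lt_trans (coord_le_norm v _) vr.
Qed.

Lemma near_line (P : V -> Prop) (a : V) : (\forall t \near (0 : V), P t) ->
  \forall s \near (0 : R), P (s *: a).
Proof.
move=> /nbhs_ballP[e /= e0 He].
have a1 : 0 < `|a| + 1 by rewrite ltr_wpDl.
apply/nbhs_ballP; exists (e / (`|a| + 1)); first by rewrite /= divr_gt0.
move=> s; rewrite /ball /= sub0r normrN => lt; apply: He.
rewrite mx_norm_ball /ball_ /= sub0r normrN normrZ.
apply: le_lt_trans (_ : `|s| * (`|a| + 1) < _).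
  by rewrite ler_wpM2l // lerDl.
by rewrite -ltr_pdivlMr.
Qed.

Lemma is_derive_quadratic (W : normedModType R) (g : R -> W) (u : W) (B : R) :
  g 0 = 0 -> (\forall s \near (0 : R), `|g s - s *: u| <= B * s ^+ 2) ->
  is_derive (0 : R) (1 : R) g u.
Proof.
move=> g0 H.
have L : (fun h : R => h^-1 *: ((g \o shift 0) (h *: 1) - g 0)) @ 0^' --> u.
  apply/cvgrPdist_le => e e0.
  have [B' B'0 {}H] : exists2 B' : R, 0 < B' &
      \forall s \near (0 : R), `|g s - s *: u| <= B' * s ^+ 2.
    exists (`|B| + 1); first by rewrite ltr_wpDl.
    near=> s; have : `|g s - s *: u| <= B * s ^+ 2 by near: s.
    move=> /le_trans; apply; rewrite ler_wpM2r ?sqr_ge0 //.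
    by apply: le_trans (ler_norm _) _; rewrite lerDl.
  near=> h.
  have h0 : h != 0 by near: h; exact: nbhs_dnbhs_neq.
  have hs : `|g h - h *: u| <= B' * h ^+ 2.
    by near: h; exact: nbhs_dnbhs H.
  have he : `|h| < e / B' by near: h; apply: dnbhs0_lt; rewrite divr_gt0.
  have -> : (g \o shift 0) (h *: 1) = g h by rewrite /= addr0 /GRing.scale /= mulr1.
  rewrite g0 subr0 -[u in u - _](scalerK h0) -scalerBr normrZ distrC normfV.
  rewrite ler_pdivrMl ?normr_gt0 //; apply: le_trans hs _.
  rewrite -[h ^+ 2]real_normK ?num_real // expr2 mulrCA ler_wpM2l //.
  by rewrite mulrC -ler_pdivlMr // ltW.
by split; [apply/cvg_ex; exists u|exact: cvg_lim L].
Unshelve. all: by end_near. Qed.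

End JetTools.

(** * Finite maps onto M and the order of rho *)

Section VanishFlat.
Variables (R : realType) (n p : nat).
Local Notation C := R[i].

Lemma near_analytic_pullback (g : 'rV[C]_n -> 'rV[C]_p) (P : 'rV[C]_p -> Prop) :
  (forall j, analytic0 (fun z => g z 0 j)) -> g 0 = 0 ->
  (\forall y \near (0 : 'rV[C]_p), P y) -> \forall z \near (0 : 'rV[C]_n), P (g z).
Proof.
move=> Hg g0 /near_boxP[r r0 HP].
have H : \forall z \near (0 : 'rV[C]_n), forall j, `|g z 0 j - g 0 0 j| < r.
  apply: (@filter_forall _ _ _ (nbhs (0 : 'rV[C]_n)) _) => j.
  exact: analytic_near_dist (Hg j) r0.
apply: near0S2 H (near0W (fun=> I)) => z lt _; apply: HP => j.
by have := lt j; rewrite g0 mxE subr0.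
Qed.

(** A germ vanishing at [0] is a combination of the coordinates with analytic
    coefficients. *)
Lemma flat_vanishing d (f : 'rV[C]_p -> C) (u : 'rV[R]_n -> 'rV[C]_p) :
  (0 < d)%N -> analytic0 f -> f 0 = 0 -> (forall j, flat d (fun t => u t 0 j)) ->
  flat d (fun t => f (u t)).
Proof.
move=> d0 [a fa] f0 Hu.
have [h [Hh _ E]] := expansion_division (fun=> 1%N) fa.
have Hu1 j : flat 1 (fun t => u t 0 j) := flatW d0 (Hu j).
have S : flat d (fun t => \sum_i h i (u t) * u t 0 i ^+ 1).
  apply: flat_sum => i; rewrite -[d]add0n; apply: flatM (Hu i).
  have [b hb] := Hh i.
  have F1 := flat_analytic 1 hb Hu1.
  apply: eq_flat (flatD (flatW (leq0n 1) F1) (flat_cst n (b (zerom p)))) => t.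
  by rewrite box_sum1 subrK.
apply: flat_near_eq S.
have E' := near_flat_pullback Hu1 E.
apply: near0S2 E' (near0W (fun=> I)) => t -> _.
rewrite [X in _ + X]big_seq [X in _ + X]big1 ?addr0 // => al.
rewrite mem_below => /forallP al0.
have -> : al = zerom p.
  by apply/ffunP => i; rewrite ffunE; have := al0 i; rewrite ltnS leqn0 => /eqP.
by rewrite -(expansion0 fa) f0 mul0r.
Qed.

End VanishFlat.

Lemma complex_eq0 (R : realType) (x y : R) :
  x%:C%C + 'i * y%:C%C = 0 :> R[i] -> x = 0 /\ y = 0.
Proof.
rewrite -complexiE => /eqP; rewrite eq_complex /=.
move=> /andP[/eqP h1 /eqP h2]; split; [rewrite -[RHS]h1|rewrite -[RHS]h2];
by rewrite !(mul0r, mulr0, mul1r, subr0, addr0, add0r).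
Qed.

Lemma nearR_S (R : realType) (P Q : R -> Prop) : (forall s, P s -> Q s) ->
  (\forall s \near (0 : R), P s) -> \forall s \near (0 : R), Q s.
Proof.
by move=> H hP; near=> s; apply: H; near: s.
Unshelve. all: by end_near. Qed.

Lemma near_line1 (R : realType) n (P : 'rV[R]_n -> Prop) (a : 'rV[R]_n) :
  (\forall t \near (0 : 'rV[R]_n), P t) ->
  \forall s \near (0 : 'rV[R]_1), P ((s : 'rV[R]_1) 0 0 *: a).
Proof.
move=> /(near_line a)/nbhs_ballP[e /= e0 He].
apply: near0S2 (near0_norm 1 e0) (near0W (fun=> I)) => s se _; apply: He.
by rewrite /ball /= sub0r normrN (le_lt_trans (coord_le_norm s 0)).
Qed.

Section RealifyLinear.
Variables (R : realType) (n : nat).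
Implicit Types z : 'rV[R[i]]_n.

Lemma realify_l z j : realify z 0 (lshift n j) = complex.Re (z 0 j).
Proof. by rewrite /realify row_mxEl mxE. Qed.

Lemma realify_r z j : realify z 0 (rshift n j) = complex.Im (z 0 j).
Proof. by rewrite /realify row_mxEr mxE. Qed.

Lemma realify0 : realify (0 : 'rV[R[i]]_n) = 0.
Proof.
by apply/rowP => i; case: (split_ordP i) => j ->;
rewrite ?realify_l ?realify_r !mxE.
Qed.

Lemma realifyZ (s : R) z : realify (s%:C%C *: z) = s *: realify z.
Proof.
apply/rowP => i; rewrite [RHS]mxE; case: (split_ordP i) => j ->.
  rewrite !realify_l mxE; case: (z 0 j) => x y /=.
  by rewrite mul0r subr0.
rewrite !realify_r mxE; case: (z 0 j) => x y /=.
by rewrite mul0r addr0.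
Qed.

End RealifyLinear.

Section Necessity.
Variables (R : realType) (m : nat).
Local Notation C := R[i].
Local Notation Cn := 'rV[R[i]]_m.+2.
Local Notation V := 'rV[R]_m.+2.
Variables (rho : C -> C -> 'rV[C]_m -> C).
Variables (r : 'I_m -> C -> C -> 'rV[C]_m -> C).
Variables (arho : multiindex m.+2 -> C) (ar : 'I_m -> multiindex m.+2 -> C).
Hypothesis rhoE : has_expansion (complexified rho) 0 arho.
Hypothesis rE : forall al, has_expansion (complexified (r al)) 0 (ar al).
Hypothesis arho1 : forall be : multiindex m.+2, (deg be <= 1)%N -> arho be = 0.
Hypothesis ar1 : forall al (be : multiindex m.+2),
  (deg be <= 1)%N -> ar al be = 0.
Hypothesis ar_axis : forall al c, ar al (powm (iw m) c) = 0.

Local Notation F0 := (model rho r).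
Local Notation G := (@param R m).

Lemma model_at0 : F0 0 = 0.
Proof.
apply/rowP => j; have := expansion0 (model_expansion rhoE rE j).
by rewrite model_coef0 // => e; rewrite [RHS]mxE; exact: e.
Qed.

Lemma param_flat j : flat 1 (fun t => G t 0 j).
Proof. exact: coordinate_flat (ltn0Sn 0) (param_coordinates R m 1) j. Qed.

Lemma model_param_jet D j : (0 < D)%N -> jet D 1 (fun t => F0 (G t) 0 j).
Proof.
move=> D0; apply: jet_analytic D0 (model_expansion rhoE rE j) _ _.
  exact: coordinate_jet (param_coordinates R m D).
move=> be; rewrite ltnS leqn0 deg_eq0 => /eqP ->.
exact: model_coef0.
Qed.

(** The components of the parametrised model are [t_0 + i t_1], the [t_al] up
    to second order, and [rho]; the first ones see every direction [a]. *)
Lemma model_param_immersion (a : V) :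
  (forall j, flat 2 (fun s : 'rV[R]_1 => F0 (G (s 0 0 *: a)) 0 j)) -> a = 0.
Proof.
move=> H.
have linear0 (c : C) : flat 2 (fun s : 'rV[R]_1 => (s 0 0)%:C%C * c) -> c = 0.
  move=> Hc; have hom (x : R) (s : 'rV[R]_1) :
      ((x *: s) 0 0)%:C%C * c = x%:C%C ^+ 1 * ((s 0 0)%:C%C * c).
    by rewrite mxE expr1 rmorphM mulrA.
  have := homogeneous_flat hom Hc (const_mx 1).
  by rewrite mxE mul1r.
have aE0 : (a 0 ord0)%:C%C + 'i * (a 0 (iw m))%:C%C = 0 :> C.
  apply: linear0; apply: eq_flat (H ord0) => s.
  by rewrite mxE tcaseE mxE scaseE !mxE !rmorphM /=; ring.
have [a0 aw] : a 0 ord0 = 0 /\ a 0 (iw m) = 0.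
  exact: complex_eq0 aE0.
apply/rowP => k; rewrite [RHS]mxE; elim/source_ind: k => [//|//|al].
suff : (a 0 (ix al))%:C%C = 0 :> C by case.
apply: linear0.
have Fr : flat 2 (fun t => complexified (r al) (G t)).
  have J : jet 2 2 (fun t => complexified (r al) (G t)).
    apply: jet_analytic (ltn0Sn 1) (rE al) _ _.
      exact: coordinate_jet (param_coordinates R m 2).
    by move=> be; rewrite ltnS; exact: ar1.
  exact: jet_order J.
have Fs : flat 2 (fun s : 'rV[R]_1 => complexified (r al) (G (s 0 0 *: a))).
  apply: (flat_comp (y := fun s : 'rV[R]_1 => s 0 0 *: a)) Fr => i.
  have := jet_order (jetZ (a 0 i)%:C%C (jet_coord R 1 (0 : 'I_1))).
  by apply: eq_flat => s; rewrite mxE rmorphM mulrC.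
apply: eq_flat (flatB (H (mid al)) (flatZ 'i Fs)) => s.
rewrite mxE tcaseE mxE scaseE mxE rmorphM /=; ring.
Qed.

Variables (M N : set Cn) (F : Cn -> Cn) (reg : regularity) (k : nat).
Hypothesis MF0 : \forall t \near (0 : V), M (F0 (G t)).
Hypothesis Himage : finite_image_of reg M N F.
Hypothesis Fk : multiplicity F k.

(** [Gam] is regular as a map of real coordinates only, so its jet is composed
    with the real and imaginary parts of the model. *)
Lemma inverse_model_jet (Gam : Cn -> Cn) (W : set Cn) D :
  (2 <= D)%N -> open W -> W 0 ->
  regular_on reg (@realify R m.+2 @` W) (fun v => realify (Gam (unrealify v))) ->
  forall j, jet D 0 (fun t => Gam (F0 (G t)) 0 j).
Proof.
move=> D2 oW W0 Hreg j.
have D0 : (0 < D)%N by exact: leq_trans D2.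
have nW : \forall v \near (0 : 'rV[R]_(m.+2 + m.+2)), (@realify R m.+2 @` W) v.
  by apply: realify_nbhs; exact: open_nbhs_nbhs.
have Hg := regular_jet D0 nW Hreg.
pose y t := realify (F0 (G t)).
have Hy i : jet D 1 (fun t => (y t 0 i)%:C%C).
  rewrite /y; case: (split_ordP i) => l ->.
    apply: eq_jet (jet_Re (model_param_jet l D0)) => t.
    by rewrite realify_l.
  apply: eq_jet (jet_Im (model_param_jet l D0)) => t.
  by rewrite realify_r.
have J i : jet D 0 (fun t => (realify (Gam (F0 (G t))) 0 i)%:C%C).
  have := jet_comp (y := y) D0 Hy (Hg i).
  by apply: eq_jet => t; rewrite /y unrealifyK.
apply: eq_jet (jetD (J (lshift _ j)) (jetZ 'i (J (rshift _ j)))) => t.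
by rewrite realify_l realify_r -complex_ReIm.
Qed.

(** [H], the inverse of [F] on [N] after the parametrised model, satisfies
    [F (H t) = F0 (G t)].  Its linear part is injective on complex vectors: it maps
    real vectors into the tangent space of [N], without kernel because the
    parametrised model is an immersion, and that tangent space is totally real.  So
    [H] and [G] are two systems of formal coordinates and the two ideals can be
    compared through jets of order [D]. *)
Lemma necessity :
  arho (powm (iw m) k) != 0 /\ forall c, (c < k)%N -> arho (powm (iw m) c) = 0.
Proof.
have [[_ Ntr] N0 [Fan F00 _] [U [W [Gam [[oU oW U0 W0] [Hreg HNU HMW]]]]]] := Himage.
(* The order [n k] is that of [high_order_ideal], order [k] is needed to see all
   powers [z_w ^ c] with [c <= k], and order [2] to see the linear part of [H]. *)
pose D := (m.+2 * k + k).+2.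
have D2 : (2 <= D)%N by [].
have D0 : (0 < D)%N by [].
have Gam0 : Gam 0 = 0 by have [_ _] := HNU 0 N0 U0; rewrite F00.
pose H t := Gam (F0 (G t)).
have G0 : G 0 = 0.
  by apply/rowP => j; rewrite paramE (_ : cvec 0 = 0) ?mul0mx //; apply/matrixP => i l; rewrite !mxE.
have H00 : H 0 = 0 by rewrite /H G0 model_at0.
have nW : \forall t \near (0 : V), W (F0 (G t)).
  apply: (near_flat_pullback (u := fun t => F0 (G t))).
    by move=> j; have := jet_order (model_param_jet j (ltn0Sn 0)).
  exact: open_nbhs_nbhs.
have nH : \forall t \near (0 : V), N (H t) /\ F (H t) = F0 (G t).
  by apply: near0S2 MF0 nW => t Mt Wt; have [] := HMW _ Mt Wt.
have nN : \forall t \near (0 : V), N (H t).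
  by apply: near0S2 nH (near0W (fun=> I)) => t [].
have HJ j := inverse_model_jet D2 oW W0 Hreg j.
have /(@choice _ _ _)[A1 HA1] : forall j, exists A : 'I_m.+2 -> C,
    jet D 2 (fun t => H t 0 j - \sum_i (t 0 i)%:C%C * A i).
  move=> j; have [c0 [A HA]] := jet_affine_part (HJ j); exists A.
  have := flat_at0 _ (jet_order HA); rewrite leq_min => /(_ isT).
  rewrite -/(H 0) H00 mxE big1 => [|i _]; last by rewrite mxE mul0r.
  rewrite addr0 sub0r => /eqP; rewrite oppr_eq0 => /eqP c00.
  by apply: eq_jet HA => t; rewrite c00 add0r.
pose A : 'M[C]_m.+2 := \matrix_(i, j) A1 j i.
have HA j : jet D 2 (fun t => H t 0 j - (cvec t *m A) 0 j).
  apply: eq_jet (HA1 j) => t; rewrite mxE; congr (_ - _).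
  by apply: eq_bigr => i _; rewrite !mxE.
have HA2 j : flat 2 (fun t => H t 0 j - (cvec t *m A) 0 j).
  by have := jet_order (HA j); apply: flatW; rewrite leq_min.
have cvecZ (s : R) (a : V) : cvec (s *: a) *m A = s%:C%C *: (cvec a *m A).
  by rewrite scalemxAl; congr (_ *m _); apply/matrixP => i j; rewrite !mxE rmorphM.
have Htan a : tangent N 0 (cvec a *m A).
  exists (fun s => H (s *: a)); split; first by rewrite scale0r.
    exact: (near_line a nN).
  have HRI i : flat 2 (fun t => ((realify (H t) - realify (cvec t *m A)) 0 i)%:C%C).
    case: (split_ordP i) => l ->; have [B HB] := HA2 l; exists B;
      apply: near0S2 HB (near0W (fun=> I)) => t le _;
      apply: le_trans le; rewrite mxE [(- realify _) _ _]mxE norm_real_complex.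
      by rewrite !realify_l -raddfB; exact: normc_ge_Re.
    by rewrite !realify_r -raddfB; exact: normc_ge_Im.
  have [B B0 HB] := flat_uniform HRI.
  apply: (@is_derive_quadratic _ _ _ _ (B * `|a| ^+ 2)).
    by rewrite scale0r H00 realify0.
  have HBl := near_line a HB.
  apply: nearR_S HBl => s le; apply: norm_le_coord.
    by rewrite mulr_ge0 ?sqr_ge0 // mulr_ge0 ?sqr_ge0.
  move=> i; have := le i; rewrite norm_real_complex lecR normrZ exprMn.
  rewrite real_normK ?num_real // mulrCA [_ * (s ^+ 2)]mulrC => {}le.
  by rewrite cvecZ realifyZ in le.
have Himm a : cvec a *m A = 0 -> a = 0.
  move=> aA; apply: model_param_immersion => j.
  have Hs i : flat 2 (fun s : 'rV[R]_1 => H (s 0 0 *: a) 0 i).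
    have Fs := flat_comp (y := fun s : 'rV[R]_1 => s 0 0 *: a) _ (HA2 i).
    apply: eq_flat (Fs _) => [s|l]; first by rewrite cvecZ aA scaler0 mxE subr0.
    have := jet_order (jetZ (a 0 l)%:C%C (jet_coord R 1 (0 : 'I_1))).
    by apply: eq_flat => s; rewrite mxE rmorphM mulrC.
  have F00j : (fun z => F z 0 j) 0 = 0 by rewrite F00 mxE.
  apply: flat_near_eq (flat_vanishing (ltn0Sn 1) (Fan j) F00j Hs).
  by apply: near0S2 (near_line1 a nH) (near0W (fun=> I)) => s [_ ->].
have Aunit : A \in unitmx.
  apply: unitmx_kernel => v vA.
  pose a : V := map_mx (@complex.Re R) v; pose b : V := map_mx (@complex.Im R) v.
  have vE : v = cvec a + 'i *: cvec b.
    by apply/rowP => i; rewrite !mxE [LHS]complex_ReIm.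
  have E : cvec a *m A = 'i *: (cvec (- b) *m A).
    move: vA; rewrite vE mulmxDl => /eqP; rewrite addr_eq0 => /eqP ->.
    rewrite -scalemxAl -scalerN -mulNmx; congr (_ *: (_ *m _)).
    by apply/matrixP => i j; rewrite !mxE rmorphN.
  have aA := Ntr 0 N0 _ _ (Htan a) (Htan (- b)) E.
  have bA : cvec (- b) *m A = 0.
    by move/eqP: E; rewrite aA eq_sym scaler_eq0 (negbTE (i_neq0 R)) => /eqP.
  have a0 := Himm _ aA; have b0 := Himm _ bA.
  rewrite vE a0; move/eqP: b0; rewrite oppr_eq0 => /eqP ->.
  by apply/rowP => i; rewrite !mxE mulr0 addr0.
have coordH : formal_coordinates D H A.
  split=> // j; split; [|exact: jet_linear|exact: HA].
  apply: eq_jet (jetD (jetW (leqnSn 1) (HA j)) (jet_linear D A j)) => t.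
  by rewrite subrK.
have coordG := param_coordinates R m D.
have nFHG : \forall t \near (0 : V), F (H t) = F0 (G t).
  by apply: near0S2 nH (near0W (fun=> I)) => t [].
have Dk : (m.+2 * k < D)%N by rewrite /D ltnS leqW // leq_addr.
have kD : (k < D)%N by rewrite /D ltnS leqW // leq_addl.
have modelE := model_expansion rhoE rE.
have axisE := model_coef_axis arho ar_axis.
have nle := axis_order_le kD coordH coordG Fk modelE nFHG (w := iw m).
have [e [ek ae0 aemin]] : exists e, [/\ (e <= k)%N, arho (powm (iw m) e) != 0 &
    forall c, (c < e)%N -> arho (powm (iw m) c) = 0].
  have ex : exists e, (e <= k)%N && (arho (powm (iw m) e) != 0).
    apply/not_existsP => nex; apply: nle => j c ck; rewrite axisE.
    case: ifP => // _; apply/eqP/negPn/negP => ne; apply: (nex c).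
    by rewrite ck ne.
  case: (ex_minnP ex) => e /andP[ek ae] emin; exists e; split=> // c ce.
  apply/eqP/negPn/negP => ac; have := emin c; rewrite ac andbT.
  by move=> /(_ (ltnW (leq_trans ce ek))); rewrite leqNgt ce.
have e0 : (0 < e)%N.
  rewrite lt0n; apply: contraNneq ae0 => ->; apply/eqP/arho1.
  by rewrite deg_powm.
have a0 j c : (c < e)%N -> model_coef arho ar j (powm (iw m) c) = 0.
  by move=> ce; rewrite axisE; case: ifP => // _; exact: aemin.
have := axis_order_eq Dk kD coordH coordG Fan Fk modelE nFHG e0 a0
  (model_leading_unit arho1 ar1 ar_axis e0 ae0).
by move=> <-.
Qed.

End Necessity.

(** * The flat totally real submanifold *)

Section LinearMaps.
Variables (R : realType) (d e : nat).

Lemma Ck_cst k (V W : normedModType R) (U : set V) (c : W) : Ck k U (cst c).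
Proof.
elim: k c => [|k IH] c /=; first by move=> x _; exact: cst_continuous.
split=> [x _|v]; first exact: differentiable_cst.
by rewrite (_ : (fun x => 'D_v (cst c) x) = cst 0) //; apply/funext => x; exact: derive_cst.
Qed.

Lemma continuous_mulmxr (A : 'M[R]_(d, e)) :
  continuous (mulmxr A : 'rV[R]_d -> 'rV[R]_e).
Proof.
move=> x; apply/(@cvgrPdist_lt _ _ _ (nbhs x)) => eps e0.
pose K := \sum_i `|row i A|.
have K0 : 0 <= K by rewrite sumr_ge0.
have e1 : 0 < eps / (K + 1) by rewrite divr_gt0 // ltr_wpDl.
apply/nbhs_ballP; exists (eps / (K + 1)) => //= y.
rewrite mx_norm_ball /ball_ /= => xy; rewrite -mulmxBl.
have le (z : 'rV[R]_d) : `|z *m A| <= `|z| * K.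
  rewrite {1}[z]row_sum_delta mulmx_suml mulr_sumr.
  apply: le_trans (ler_norm_sum _ _ _) _; apply: ler_sum => i _.
  by rewrite -scalemxAl -rowE normrZ ler_wpM2r // coord_le_norm.
apply: le_lt_trans (le _) _; move: xy; rewrite ltr_pdivlMr ?ltr_wpDl //.
by apply: le_lt_trans; rewrite ler_wpM2l // lerDl.
Qed.

Lemma Ck_mulmxr k (U : set 'rV[R]_d) (A : 'M[R]_(d, e)) :
  Ck k U (mulmxr A : 'rV[R]_d -> 'rV[R]_e).
Proof.
case: k => [|k] /=; first by move=> x _; exact: continuous_mulmxr.
split=> [x _|v]; first exact/linear_differentiable/continuous_mulmxr.
rewrite (_ : (fun x => _) = cst (v *m A)); first exact: Ck_cst.
apply/funext => x; rewrite deriveE; last exact/linear_differentiable/continuous_mulmxr.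
by rewrite diff_lin //; exact: continuous_mulmxr.
Qed.

Lemma expands_sum (K : numFieldType) n (p : 'rV[K]_n) (s : seq 'I_n)
    (F : 'I_n -> 'rV[K]_n -> K) (a : 'I_n -> multiindex n -> K)
    (B : 'I_n -> K) (r : K) : 0 <= r ->
  (forall i, expands p (F i) (a i) r (B i)) ->
  expands p (fun x => \sum_(i <- s) F i x) (fun al => \sum_(i <- s) a i al) r
    (\sum_(i <- s) B i).
Proof.
move=> r0 H; elim: s => [|i s IH].
  have := @expands_mono K n p (fun=> 0) (zerom n) 0 r r0 (fun h => esym (mul0r _)).
  rewrite normr0 mul0r big_nil (_ : (fun x => \sum_(i <- [::]) F i x) = fun=> 0);
    last by apply/funext => x; rewrite big_nil.
  rewrite (_ : (fun al => \sum_(i <- [::]) a i al) = mono_coef (zerom n) 0) //.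
  by apply/funext => al; rewrite big_nil /mono_coef; case: ifP.
have := expandsD r0 (H i) IH; rewrite big_cons.
rewrite (_ : (fun x => \sum_(j <- i :: s) F j x) = fun x => F i x + \sum_(j <- s) F j x);
  last by apply/funext => x; rewrite big_cons.
rewrite (_ : (fun al => \sum_(j <- i :: s) a j al) = fun al => a i al + \sum_(j <- s) a j al) //.
by apply/funext => al; rewrite big_cons.
Qed.

Lemma linear_regular (reg : regularity) (U : set 'rV[R]_d)
    (f : 'rV[R]_d -> 'rV[R]_e) :
  (forall a x y, f (a *: x + y) = a *: f x + f y) -> regular_on reg U f.
Proof.
move=> lf; have f0 : f 0 = 0.
  by have := lf (-1) 0 0; rewrite scaler0 addr0 scaleN1r addNr.
have fZ a x : f (a *: x) = a *: f x by have := lf a x 0; rewrite !addr0 f0 addr0.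
have fD x y : f (x + y) = f x + f y by have := lf 1 x y; rewrite !scale1r.
have f_sum x : f x = \sum_i x 0 i *: f (delta_mx 0 i).
  rewrite {1}(row_sum_delta x); elim: (index_enum _) => [|i s IH].
    by rewrite !big_nil f0.
  by rewrite !big_cons fD fZ IH.
case: reg => /=.
  move=> k; rewrite (_ : f = mulmxr (\matrix_i f (delta_mx 0 i))).
    exact: Ck_mulmxr.
  apply/funext => x; rewrite f_sum /= {2}[x]row_sum_delta mulmx_suml.
  by apply: eq_bigr => i _; rewrite -scalemxAl -rowE rowK.
move=> p _ j.
pose c i := f (delta_mx 0 i) 0 j.
pose F i (x : 'rV[R]_d) := c i * (x 0 i - p 0 i).
have HF i : expands p (F i) (mono_coef (powm i 1) (c i)) 1 (`|c i| * 1 ^+ deg (powm i 1)).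
  by apply: expands_mono => // h; rewrite /F mxE addrAC subrr add0r monomial_powm expr1.
have Hs := expands_sum (index_enum 'I_d) ler01 HF.
have Hc := @expands_mono R d p (fun=> f p 0 j) (zerom d) (f p 0 j) 1 ler01
  (fun h => esym (etrans (congr1 _ (monomial_zerom h)) (mulr1 _))).
exists (fun al => mono_coef (zerom d) (f p 0 j) al + \sum_i mono_coef (powm i 1) (c i) al).
have := expandsD ler01 Hc Hs.
rewrite (_ : (fun x => _ + _) = fun y => f y 0 j).
  by apply: expands_has_expansion => //; exact: real_geometric_null.
apply/funext => x; rewrite -[x in RHS](subrK p) fD mxE addrC; congr (_ + _).
rewrite f_sum summxE; apply: eq_bigr => i _.
by rewrite !mxE mulrC.
Qed.

End LinearMaps.

Section RealLinear.
Variables (R : realType) (n : nat).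
Local Notation C := R[i].
Local Notation Cn := 'rV[C]_n.

Lemma realifyP (s : R) (z z' : Cn) :
  realify (s%:C%C *: z + z') = s *: realify z + realify z'.
Proof.
rewrite -realifyZ; apply/rowP => i; rewrite [RHS]mxE.
by case: (split_ordP i) => j ->; rewrite ?realify_l ?realify_r mxE raddfD.
Qed.

Lemma unrealifyP (s : R) (v v' : 'rV[R]_(n + n)) :
  unrealify (s *: v + v') = s%:C%C *: unrealify v + unrealify v'.
Proof.
by rewrite -[RHS]unrealifyK realifyP !realifyK.
Qed.

Lemma real_linear_regular (reg : regularity) (U : set 'rV[R]_(n + n))
    (S : Cn -> Cn) :
  (forall (s : R) z z', S (s%:C%C *: z + z') = s%:C%C *: S z + S z') ->
  regular_on reg U (fun v => realify (S (unrealify v))).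
Proof.
by move=> HS; apply: linear_regular => a x y; rewrite unrealifyP HS realifyP.
Qed.

(** The equations of [real_source] relate two real coordinates in this way. *)
Lemma tangent_relation (N : set Cn) p v (c e : R) (i j : 'I_(n + n)) :
  (forall z, N z -> c * realify z 0 i + e * realify z 0 j = 0) ->
  tangent N p v -> c * realify v 0 i + e * realify v 0 j = 0.
Proof.
move=> HN [gamma [_ near_N [dg gv]]].
have dcoord k : is_derive (0 : R) (1 : R) (fun t => realify (gamma t) 0 k) (realify v 0 k).
  split; first exact: (derivable_mxP _ _ _).1 dg 0 k.
  have := congr1 (fun w : 'rV[R]_(n + n) => w 0 k) (derive_mx dg).
  by rewrite gv [RHS]mxE => <-.
have Dij := is_deriveD (is_deriveZ c (dcoord i)) (is_deriveZ e (dcoord j)).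
have E : \forall t \near (0 : R), ((c \*: (fun t => realify (gamma t) 0 i)) +
    (e \*: (fun t => realify (gamma t) 0 j)) : R -> R) t = cst 0 t.
  by apply: nearR_S near_N => t /HN.
have := near_eq_derive (1 : R) E; rewrite derive_cst.
by case: Dij => _ ->.
Qed.

End RealLinear.

Section FlatModel.
Variables (R : realType) (m : nat).
Local Notation C := R[i].
Local Notation Cn := 'rV[R[i]]_m.+2.

Lemma to_sourceP (s : R) (z z' : Cn) :
  to_source (s%:C%C *: z + z') = s%:C%C *: to_source z + to_source z'.
Proof.
apply/rowP => k; rewrite !mxE; elim/source_ind: k => [||al]; rewrite !scaseE //.
  by rewrite rmorphD rmorphM /= conj_real.
rewrite !mxE raddfD -rmorphM -rmorphD /=; congr (_ %:C%C); congr (_ + _).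
by case: (z 0 (mid al)) => x y /=; rewrite mul0r subr0.
Qed.

(** Real-linear coordinates in which [real_source] is the subspace of real
    vectors. *)
Definition straighten (v : Cn) : Cn :=
  \row_k scase
    (Complex (complex.Re (v 0 ord0)) (complex.Re (v 0 (iw m)) - complex.Re (v 0 ord0)))
    (Complex (complex.Im (v 0 ord0)) (complex.Im (v 0 (iw m)) + complex.Im (v 0 ord0)))
    (fun al => v 0 (ix al)) k.

Definition unstraighten (v : Cn) : Cn :=
  \row_k scase
    (Complex (complex.Re (v 0 ord0)) (complex.Re (v 0 (iw m))))
    (Complex (complex.Im (v 0 ord0) + complex.Re (v 0 ord0))
             (complex.Im (v 0 (iw m)) - complex.Re (v 0 (iw m))))
    (fun al => v 0 (ix al)) k.

Lemma straightenK v : unstraighten (straighten v) = v.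
Proof.
apply/rowP => k; rewrite !mxE; elim/source_ind: k => [||al]; rewrite !scaseE //=.
  by case: (v 0 ord0).
  by rewrite subrK addrK; case: (v 0 (iw m)).
by rewrite mxE scaseE.
Qed.

Lemma unstraightenK v : straighten (unstraighten v) = v.
Proof.
apply/rowP => k; rewrite !mxE; elim/source_ind: k => [||al]; rewrite !scaseE //=.
  by rewrite addrK; case: (v 0 ord0).
  by rewrite subrK; case: (v 0 (iw m)).
by rewrite mxE scaseE.
Qed.

Lemma straightenP (s : R) (z z' : Cn) :
  straighten (s%:C%C *: z + z') = s%:C%C *: straighten z + straighten z'.
Proof.
apply/rowP => k; rewrite !mxE; elim/source_ind: k => [||al]; rewrite !scaseE //.
  case: (z 0 ord0) (z 0 (iw m)) (z' 0 ord0) (z' 0 (iw m)) => [x y] [x1 y1] [x2 y2] [x3 y3].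
  by apply/eqP; rewrite eq_complex /=; apply/andP; split; apply/eqP; ring.
  case: (z 0 ord0) (z 0 (iw m)) (z' 0 ord0) (z' 0 (iw m)) => [x y] [x1 y1] [x2 y2] [x3 y3].
by apply/eqP; rewrite eq_complex /=; apply/andP; split; apply/eqP; ring.
by rewrite !mxE.
Qed.

Lemma unstraightenP (s : R) (z z' : Cn) :
  unstraighten (s%:C%C *: z + z') = s%:C%C *: unstraighten z + unstraighten z'.
Proof.
by rewrite -[RHS]straightenK straightenP !unstraightenK.
Qed.

Lemma conjE (z : C) : z^* = Complex (complex.Re z) (- complex.Im z).
Proof. by case: z. Qed.

Lemma straighten_real v : real_source v <->
  forall k, complex.Im (straighten v 0 k) = 0.
Proof.
split=> [[vw vx] k|H].
  rewrite mxE; elim/source_ind: k => [||al]; rewrite scaseE //= vw conjE /=.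
    by rewrite subrr.
  by rewrite addNr.
have H0 := H ord0; have Hw := H (iw m).
rewrite mxE scaseE /= in H0; rewrite mxE scaseE /= in Hw.
split=> [|al]; last by have := H (ix al); rewrite mxE scaseE.
rewrite conjE; move/eqP: H0; rewrite subr_eq0 => /eqP <-.
by move/eqP: Hw; rewrite addr_eq0 => /eqP <-; case: (v 0 (iw m)).
Qed.

Lemma flat_submanifold (reg : regularity) :
  real_submanifold reg m.+2 (@real_source R m).
Proof.
move=> p _; exists setT, setT, (fun x => realify (straighten (unrealify x))),
  (fun x => realify (unstraighten (unrealify x))); split.
  by split=> //; exact: openT.
split.
- exact/real_linear_regular/straightenP.
- exact/real_linear_regular/unstraightenP.
- by move=> x _; split=> //; rewrite unrealifyK straightenK realifyK.
- by move=> x _; split=> //; rewrite unrealifyK unstraightenK realifyK.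
move=> x _; split=> [[z Nz <-] j|H].
  rewrite unrealifyK; case: (split_ordP j) => k -> /=; first by rewrite leqNgt ltn_ord.
  by move=> _; rewrite realify_r; exact: (straighten_real z).1 Nz k.
exists (unrealify x); last exact: realifyK.
apply/straighten_real => k; rewrite -realify_r; apply: H.
by rewrite /= leq_addr.
Qed.

Lemma flat_tangent p v : tangent (@real_source R m) p v -> real_source v.
Proof.
move=> Tv.
have E1 : 1 * realify v 0 (lshift _ (iw m)) + -1 * realify v 0 (lshift _ ord0) = 0.
  apply: tangent_relation Tv => z [zw _]; rewrite !realify_l zw conjE /=.
  by rewrite mul1r mulN1r subrr.
have E2 : 1 * realify v 0 (rshift _ (iw m)) + 1 * realify v 0 (rshift _ ord0) = 0.
  apply: tangent_relation Tv => z [zw _]; rewrite !realify_r zw conjE /=.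
  by rewrite !mul1r addNr.
split=> [|al].
  move: E1 E2; rewrite !realify_l !realify_r !mul1r mulN1r.
  move=> /eqP; rewrite subr_eq0 => /eqP E1 /eqP; rewrite addr_eq0 => /eqP E2.
  by rewrite conjE -E1 -E2; case: (v 0 (iw m)).
have E3 : 1 * realify v 0 (rshift _ (ix al)) + 0 * realify v 0 (rshift _ (ix al)) = 0.
  by apply: tangent_relation Tv => z [_ zx]; rewrite realify_r zx mulr0 mulr0 addr0.
by move: E3; rewrite realify_r mul1r mul0r addr0.
Qed.

Lemma flat_totally_real p : totally_real_at (@real_source R m) p.
Proof.
move=> v w /flat_tangent[vw vx] /flat_tangent[ww wx] E.
have Ek k : v 0 k = 'i * w 0 k by rewrite E mxE.
have w0 : w 0 ord0 = 0.
  have := vw; rewrite !Ek ww rmorphM /= conjCi mulNr => /eqP.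
  rewrite -subr_eq0 opprK -mulr2n -mulr_natl mulf_eq0 pnatr_eq0 /=.
  by rewrite mulf_eq0 (negbTE (i_neq0 R)) conjC_eq0 => /eqP.
apply/rowP => k; rewrite [RHS]mxE Ek; elim/source_ind: k => [||al].
- by rewrite w0 mulr0.
- by rewrite ww w0 conjC0 mulr0.
have := vx al; rewrite Ek -complexiE; move: (wx al).
case: (w 0 (ix al)) => x y /= ->; rewrite mul0r mul1r add0r => ->.
exact: mulr0.
Qed.

Lemma flat_totally_real_submanifold (reg : regularity) :
  totally_real_submanifold reg (@real_source R m).
Proof.
by split; [exact: flat_submanifold|move=> p _; exact: flat_totally_real].
Qed.

End FlatModel.

(** * The model as a finite map onto M *)

Section AxisSeries.
Variables (R : realType) (n : nat).
Local Notation C := R[i].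
Local Notation Cn := 'rV[C]_n.

(** Up to any order, the series on the axis is a polynomial that vanishes to
    that order. *)
Lemma axis_zero_coef (f : Cn -> C) a i (r : C) : has_expansion f 0 a ->
  0 < r -> (forall x, `|x| < r -> f (axis i x) = 0) ->
  forall c, a (powm i c) = 0.
Proof.
move=> fa r0 f0 c; have [s [B [s0 B0 H]]] := axis_remainder i fa.
pose p : {poly C} := \poly_(j < c.+1) a (powm i j).
have p0 : p = 0.
  apply: (flat1_poly (size_poly _ _)).
  have [t [t0 tr ts]] := common_radius r0 s0.
  exists t, (B / s ^+ c.+1); split=> //.
    by rewrite divr_ge0 // exprn_ge0 // ltW.
  move=> x xt; have := H x c.+1 (lt_le_trans xt ts).
  rewrite (f0 _ (lt_le_trans xt tr)) sub0r normrN (horner_coef_wide _ (size_poly _ _)).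
  rewrite mulrAC; congr (`|_| <= _); apply: eq_bigr => j _.
  by rewrite coef_poly ltn_ord.
have := congr1 (fun q : {poly C} => q`_c) p0.
by rewrite coef_poly ltnSn coef0.
Qed.

Lemma axis_coef_zero (f : Cn -> C) a i : has_expansion f 0 a ->
  (forall c, a (powm i c) = 0) ->
  exists2 r : C, 0 < r & forall x, `|x| < r -> f (axis i x) = 0.
Proof.
move=> [r r0 [_ H]] a0; exists r => // x xr.
have := H (axis i x); rewrite add0r => /(_ _) Hx.
have {}Hx : box_sum a (axis i x) N @[N --> \oo] --> f (axis i x).
  by apply: Hx => j; rewrite mxE; case: ifP => // _; rewrite normr0.
rewrite (_ : (fun N => box_sum a (axis i x) N) = cst 0) in Hx; last first.
  apply/funext => N; rewrite box_sum_axis big1 // => c _.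
  by rewrite a0 mul0r.
exact: (cvg_unique (@norm_hausdorff _ _) Hx (cvg_cst (0 : C))).
Qed.

Lemma near0_radius (P : C -> Prop) : (\forall x \near (0 : C), P x) <->
  exists2 r : C, 0 < r & forall x, `|x| < r -> P x.
Proof.
split=> [/nbhs_ballP[r /= r0 H]|[r r0 H]].
  by exists r => // x xr; apply: H; rewrite /ball /= sub0r normrN.
by apply/nbhs_ballP; exists r => //= x; rewrite /ball /= sub0r normrN => /H.
Qed.

End AxisSeries.

Section Sufficiency.
Variables (R : realType) (m : nat).
Local Notation C := R[i].
Local Notation Cn := 'rV[R[i]]_m.+2.
Variables (rho : C -> C -> 'rV[C]_m -> C).
Variables (r : 'I_m -> C -> C -> 'rV[C]_m -> C).
Variable M : set Cn.
Hypothesis r_real : forall al, \forall z \near (0 : Cn),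
  complex.Im (restr (r al) z) = 0.
Hypothesis M_graph : \forall z \near (0 : Cn), M z <->
     z 0 ord_max = restr rho z /\
     forall al, (complex.Im (z 0 (mid al)))%:C%C = restr (r al) z.

(** Reality of [r] is known on points of the target only; each point of
    [real_source] is the [to_source] of such a point. *)
Definition from_source (v : Cn) : Cn :=
  \row_j tcase (v 0 ord0) (fun al => v 0 (ix al)) 0 j.

Lemma from_sourceK v : real_source v -> to_source (from_source v) = v.
Proof.
move=> [vw vx]; apply/rowP => k; rewrite !mxE; elim/source_ind: k => [||al].
- by rewrite !(scaseE, tcaseE).
- by rewrite !(scaseE, tcaseE).
rewrite scaseE mxE tcaseE; move: (vx al); case: (v 0 (ix al)) => x y /= ->.
by [].
Qed.

Lemma near_from_source (P : Cn -> Prop) : (\forall z \near (0 : Cn), P z) ->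
  \forall v \near (0 : Cn), P (from_source v).
Proof.
apply: near_analytic_pullback => [j|]; last first.
  by apply/rowP => j; rewrite !mxE; elim/target_ind: j => [|al|]; rewrite tcaseE ?mxE.
elim/target_ind: j => [|al|].
- by apply: eq_analytic (analytic_coord R ord0) => z; rewrite mxE tcaseE.
- by apply: eq_analytic (analytic_coord R (ix al)) => z; rewrite mxE tcaseE.
- by apply: eq_analytic (analytic_cst _ 0) => z; rewrite mxE tcaseE.
Qed.

Local Notation F0 := (model rho r).

Lemma to_source_model : \forall v \near (0 : Cn), real_source v ->
  to_source (F0 v) = v /\
  forall al, complex.Im (complexified (r al) v) = 0.
Proof.
have H0 : \forall z \near (0 : Cn), forall al, complex.Im (restr (r al) z) = 0.
  exact: (@filter_forall _ _ _ (nbhs (0 : Cn)) _ r_real).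
have H := near_from_source H0; apply: near0S2 H (near0W (fun=> I)) => v Hv _ Nv.
have r0 al : complex.Im (complexified (r al) v) = 0.
  by have := Hv al; rewrite restrE from_sourceK.
split=> //; have [vw vx] := Nv; apply/rowP => k; rewrite !mxE.
elim/source_ind: k => [||al]; rewrite !scaseE ?tcaseE //.
rewrite mxE tcaseE -complexiE; move: (vx al) (r0 al).
case: (v 0 (ix al)) (complexified (r al) v) => [x y] [x' y'] /= -> ->.
by rewrite mul0r mulr0 subr0 addr0.
Qed.

Hypothesis F0an : forall j, analytic0 (fun z => F0 z 0 j).
Hypothesis F00 : F0 0 = 0.

Lemma model_in_M : \forall v \near (0 : Cn), real_source v -> M (F0 v).
Proof.
have H := near_analytic_pullback F0an F00 M_graph.
apply: near0S2 H to_source_model => v Hv Hs Nv; have [vE r0] := Hs Nv.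
apply/Hv; rewrite !restrE vE; split=> [|al]; first by rewrite mxE tcaseE.
rewrite restrE vE mxE tcaseE -complexiE; have := r0 al; have := Nv.2 al.
case: (v 0 (ix al)) (complexified (r al) v) => [x y] [x' y'] /= -> ->.
by rewrite mul0r mul1r !add0r.
Qed.

Lemma model_of_source : \forall z \near (0 : Cn), M z ->
  F0 (to_source z) = z.
Proof.
apply: near0S2 M_graph (near0W (fun=> I)) => z Hz _ /Hz[zmax zmid].
apply/rowP => j; rewrite mxE; elim/target_ind: j => [|al|]; rewrite tcaseE.
- by rewrite mxE scaseE.
- by rewrite mxE scaseE -restrE -zmid -complex_ReIm.
- by rewrite -restrE zmax.
Qed.

Lemma to_source_le (z : Cn) (c : C) : (forall j, `|z 0 j| < c) ->
  forall k, `|to_source z 0 k| < c.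
Proof.
move=> zc k; rewrite mxE; elim/source_ind: k => [||al]; rewrite scaseE //.
  by rewrite norm_conj.
by rewrite norm_real_complex; apply: le_lt_trans (normc_ge_Re _) (zc _).
Qed.

Lemma to_source_continuous : continuous (@to_source R m).
Proof.
move=> z A /nbhs_ballP[e e0 HA]; apply/nbhs_ballP; exists e => // z' [_ H].
apply: HA; split=> // i k; rewrite ord1.
have := @to_source_le (z - z') e _ k; rewrite -ball_normE /=.
have -> : to_source (z - z') = to_source z - to_source z'.
  have := to_sourceP (-1) z' z; rewrite rmorphN1 !scaleN1r.
  by rewrite addrC => ->; rewrite addrC.
rewrite !mxE; apply=> j; rewrite !mxE.
by have := H 0 j; rewrite -ball_normE.
Qed.

Lemma sufficiency (reg : regularity) e : multiplicity F0 e ->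
  finite_image_of reg M (@real_source R m) F0.
Proof.
move=> F0e; split.
- exact: flat_totally_real_submanifold.
- by split=> [|al]; rewrite !mxE ?conjC0.
- by split=> //; exists e.
have /near_boxP[s s0 Hs] := model_of_source.
have nU : \forall v \near (0 : Cn), (real_source v ->
    to_source (F0 v) = v /\ M (F0 v)) /\ forall j, `|F0 v 0 j| < s.
  have nb : \forall v \near (0 : Cn), forall j, `|F0 v 0 j| < s.
    apply: (near_analytic_pullback F0an F00 (P := fun y => forall j, `|y 0 j| < s)).
    by apply/near_boxP; exists s.
  have H := near0S2 (fun v (a : real_source v -> _) (b : real_source v -> _)
    (Nv : real_source v) => conj (proj1 (a Nv)) (b Nv)) to_source_model model_in_M.
  by apply: near0S2 H nb => v a b; split.
have /nbhs_ballP[t /= t0 Ht] := nU.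
pose U : set Cn := ball 0 t.
pose W : set Cn := ball 0 s `&` (@to_source R m) @^-1` U.
have ts0 : to_source (0 : Cn) = 0.
  by apply/rowP => k; rewrite !mxE; elim/source_ind: k => [||al]; rewrite scaseE ?mxE ?conjC0.
have ballsP (z : Cn) : ball 0 s z <-> forall j, `|z 0 j| < s.
  split=> [[_ H] j|H]; first by have := H 0 j; rewrite mxE -ball_normE /= sub0r normrN.
  split=> // i j; rewrite ord1 mxE -ball_normE /= sub0r normrN; exact: H.
exists U, W, (@to_source R m); split.
  split; first exact: ball_open.
  - apply: openI; first exact: ball_open.
    apply: open_comp; last exact: ball_open.
    by move=> z _; exact: to_source_continuous.
  - exact: ballxx.
  - split; first exact: ballxx.
    by rewrite /= ts0; exact: ballxx.
split.
- exact/real_linear_regular/to_sourceP.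
- move=> z Nz Uz; have [/(_ Nz)[zE Mz] sz] := Ht z Uz; split=> //.
  by split; [apply/ballsP|rewrite /= zE].
- move=> w Mw [/ballsP sw Uw]; split=> //; first exact: to_source_real.
  exact: Hs.
Qed.

End Sufficiency.

Theorem proposition3p1 (R : realType) (m : nat)
    (rho : R[i] -> R[i] -> 'rV[R[i]]_m -> R[i])
    (r : 'I_m -> R[i] -> R[i] -> 'rV[R[i]]_m -> R[i])
    (M : set 'rV[R[i]]_m.+2) (reg : regularity) :
  real_submanifold Analytic m.+2 M ->
  M `<=` closure [set p | M p /\ totally_real_at M p] ->
  ~ totally_real_at M 0 ->
  analytic_no_affine_part (joint rho) ->
  (forall al, analytic_no_affine_part (joint (r al))) ->
  (forall al, \forall z \near (0 : 'rV[R[i]]_m.+2),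
     complex.Im (restr (r al) z) = 0) ->
  (forall al, \forall z1 \near (0 : R[i]), r al 0 z1^* 0 = 0) ->
  (\forall z \near (0 : 'rV[R[i]]_m.+2), M z <->
     z 0 ord_max = restr rho z /\
     forall al, (complex.Im (z 0 (mid al)))%:C%C
                = restr (r al) z) ->
  let rho_nonzero := ~ (\forall z1 \near (0 : R[i]), rho 0 z1^* 0 = 0) in
  ((exists N F, finite_image_of reg M N F) <-> rho_nonzero) /\
  (rho_nonzero ->
   forall N F k, finite_image_of reg M N F -> multiplicity F k ->
   exists2 c : R[i], c != 0 &
     (fun z1 => rho 0 z1^* 0 - c * z1^* ^+ k)
       =O_ (0 : R[i]) (fun z1 => z1^* ^+ k.+1)).
Proof.
move=> _ _ _ [arho rhoE arho1] Hr r_real r_axis M_graph rho_nonzero.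
rewrite jointE in rhoE.
have {}arho1 : forall be : multiindex m.+2, (deg be <= 1)%N -> arho be = 0.
  exact: arho1.
have /(@choice _ _ _)[ar Har] : forall al, exists a : multiindex m.+2 -> R[i],
    has_expansion (complexified (r al)) 0 a /\
    forall be : multiindex m.+2, (deg be <= 1)%N -> a be = 0.
  by move=> al; have [a Ha a1] := Hr al; rewrite jointE in Ha; exists a.
have rE al := (Har al).1; have ar1 al := (Har al).2.
have ar_axis al c : ar al (powm (iw m) c) = 0.
  have /near0_radius[s s0 H] := r_axis al.
  have Hz x : `|x| < s -> complexified (r al) (axis (iw m) x) = 0.
    by move=> xs; rewrite complexified_axis; have := H x^*; rewrite conjCK norm_conj => ->.
  exact: (axis_zero_coef (rE al) s0 Hz c).
have F0E := model_expansion rhoE rE.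
have F0an j : analytic0 (fun z => model rho r z 0 j).
  by exists (model_coef arho ar j); exact: F0E.
have F00 := model_at0 rhoE rE arho1 ar1.
have MF0 : \forall t \near (0 : 'rV[R]_m.+2), M (model rho r (param t)).
  have H := near_flat_pullback (@param_flat R m) (model_in_M r_real M_graph F0an F00).
  by apply: near0S2 H (near0W (fun=> I)) => t Ht _; apply: Ht; exact: param_real.
have nec N F k : finite_image_of reg M N F -> multiplicity F k ->
    arho (powm (iw m) k) != 0 /\
    forall c, (c < k)%N -> arho (powm (iw m) c) = 0.
  move=> HF Fk.
  exact: (necessity rhoE rE arho1 ar1 ar_axis MF0 HF Fk).
split; last first.
  move=> _ N F k HF Fk; have [ak a0] := nec N F k HF Fk.
  exists (arho (powm (iw m) k)) => //.
  have [s [B [s0 B0 H]]] := axis_remainder (iw m) rhoE.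
  apply/eqO_exP; exists (B / s ^+ k.+1 + 1).
    by rewrite ltr_wpDl // divr_ge0 // exprn_ge0 // ltW.
  apply/near0_radius; exists s => // z zs.
  have := H z^* k.+1; rewrite norm_conj => /(_ zs).
  rewrite complexified_axis big_ord_recr /= big1 => [|c _]; last first.
    by rewrite a0 // mul0r.
  rewrite add0r => le; apply: le_trans le _.
  rewrite normrX norm_conj mulrAC ler_wpM2r ?exprn_ge0 //.
  by rewrite lerDl.
split=> [[N [F HF]] near0|nz].
  have [_ _ [_ _ [k Fk]] _] := HF; have [ak _] := nec N F k HF Fk.
  have /near0_radius[s s0 H] := near0.
  have Hz x : `|x| < s -> complexified rho (axis (iw m) x) = 0.
    by move=> xs; rewrite complexified_axis; have := H x^*; rewrite conjCK norm_conj => ->.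
  by move/eqP: ak; apply; exact: (axis_zero_coef rhoE s0 Hz k).
have ex : exists c, arho (powm (iw m) c) != 0.
  apply/not_existsP => all0; apply: nz; apply/near0_radius.
  have [s s0 H] : exists2 s : R[i], 0 < s & forall x, `|x| < s ->
      complexified rho (axis (iw m) x) = 0.
    by apply: axis_coef_zero rhoE _ => c; apply/eqP/negPn/negP; exact: all0.
  by exists s => // z zs; rewrite -complexified_axis H // norm_conj.
case: (ex_minnP ex) => e ae emin.
have e0 : (0 < e)%N.
  rewrite lt0n; apply: contraNneq ae => ->; apply/eqP/arho1.
  by rewrite deg_powm.
have a0 j c : (c < e)%N -> model_coef arho ar j (powm (iw m) c) = 0.
  move=> ce; rewrite model_coef_axis //; case: ifP => // _.
  by apply/eqP/negPn/negP => /emin; rewrite leqNgt ce.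
have F0e := multiplicity_axis e0 F0E a0
  (model_leading_unit arho1 ar1 ar_axis e0 ae).
exists (@real_source R m), (model rho r).
exact: (sufficiency r_real M_graph F0an F00 reg F0e).
Qed.
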